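(* Let $V$ be a finite-dimensional real vector space and let $\mathfrak g\subset\mathfrak{gl}(V)$ be a Lie subalgebra. Suppose $V=V_1\oplus V_2$, where $V_1$ and $V_2$ are $\mathfrak g$-invariant subspaces which are both faithful representations of $\mathfrak g$. If $\mathfrak g$ is the holonomy algebra of a torsion-free connection which is not locally symmetric, then $k^1(\mathfrak g)\neq\{0\}$.
   Context: A holonomy algebra of a torsion-free connection is the Lie algebra $\mathfrak g\subset\mathfrak{gl}(T_oM)$ (with $T_oM$ identified with $V$) of the restricted holonomy group at a point $o$ of a torsion-free connection $\nabla$ on the tangent bundle of a smooth manifold $M$. The connection is locally symmetric if its curvature tensor $R$ satisfies $\nabla R=0$. With $V=V_1\oplus V_2$ as in the claim, put $$k(\mathfrak g)=\{R\in V_1^*\otimes V_2^*\otimes\mathfrak g\mid R(x,y')z'=R(x,z')y',\ R(x,y')t=R(t,y')x\ \text{for all } x,t\in V_1,\ y',z'\in V_2\},$$ $$k^1(\mathfrak g)=\{D\in V^*\otimes k(\mathfrak g)\mid D_x(y,z')=D_y(x,z'),\ D_{t'}(y,z')=D_{z'}(y,t')\ \text{for all } x,y\in V_1,\ z',t'\in V_2\},$$ where $D_v\in k(\mathfrak g)$ denotes the value of $D$ at $v\in V$.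
   Formalization: The manifold M is assumed connected; otherwise the claim fails, e.g. when o lies in a flat component (so that the holonomy algebra is 0 and k^1 = {0}) while the connection is not locally symmetric on another component. *)

(* Defs.v *)
From HB Require Import structures.
From mathcomp Require Import all_boot all_order all_algebra.
From mathcomp Require Import all_classical all_reals all_analysis.

Set Implicit Arguments.
Unset Strict Implicit.
Unset Printing Implicit Defensive.

Import Order.TTheory GRing.Theory Num.Theory.
Import numFieldNormedType.Exports.

Local Open Scope classical_set_scope.
Local Open Scope ring_scope.

Section Smoothness.
Context {R : realType} {E F : normedModType R}.

(* Meant for open U: no condition is put on f outside of U. *)
Fixpoint Ck (k : nat) (U : set E) (f : E -> F) : Prop :=
  match k with
  | 0 => forall x, U x -> {for x, continuous f}
  | k'.+1 => (forall x, U x -> differentiable f x) /\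
             (forall v : E, Ck k' U ('D_v f))
  end.

Definition smooth (U : set E) (f : E -> F) : Prop := forall k, Ck k U f.

End Smoothness.

(* A connected, Hausdorff, second countable smooth manifold without boundary of
   dimension n, given by a (not necessarily maximal) smooth atlas.  The charts
   and their inverses are total functions, relevant only on [dom i] and on
   [img i] respectively. *)
Record manifold (R : realType) (n : nat) := Manifold {
  mspace :> topologicalType;
  mspace_hausdorff : hausdorff_space mspace;
  mspace_second_countable : @second_countable mspace;
  mspace_connected : connected [set: mspace];
  mindex : Type;
  dom : mindex -> set mspace;
  chart : mindex -> mspace -> 'rV[R]_n;
  chartV : mindex -> 'rV[R]_n -> mspace;
  img := fun i => chart i @` dom i;
  trans := fun i j => chart j \o chartV i;
  dom_cover : forall p, exists i, dom i p;
  dom_open : forall i, open (dom i);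
  img_open : forall i, open (img i);
  chartK : forall i p, dom i p -> chartV i (chart i p) = p;
  chart_continuous : forall i p, dom i p -> {for p, continuous (chart i)};
  chartV_continuous : forall i x, img i x -> {for x, continuous (chartV i)};
  trans_smooth : forall i j, smooth (chart i @` (dom i `&` dom j)) (trans i j)
}.

Arguments dom {R n} m i.
Arguments chart {R n} m i.
Arguments chartV {R n} m i.
Arguments img {R n} m i.
Arguments trans {R n} m i j.

(* A connection on the tangent bundle, given by its Christoffel symbols: in the
   chart i,  nabla_X Y = dY(X) + Gamma_i(X, Y).  The field [gamma_trans] says
   exactly that these local expressions define the same vector field on
   overlaps. *)
Record connection (R : realType) (n : nat) (M : manifold R n) := Connection {
  gamma : mindex M -> 'rV[R]_n -> 'rV[R]_n -> 'rV[R]_n -> 'rV[R]_n;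
  gamma_linear_l : forall i x, img M i x ->
    forall v, linear (fun u => gamma i x u v);
  gamma_linear_r : forall i x, img M i x -> forall u, linear (gamma i x u);
  gamma_smooth : forall i u v, smooth (img M i) (fun x => gamma i x u v);
  gamma_trans : forall i j x u v, (chart M i @` (dom M i `&` dom M j)) x ->
    'D_(gamma i x u v) (trans M i j) x =
    'D_u ('D_v (trans M i j)) x +
    gamma j (trans M i j x) ('D_u (trans M i j) x) ('D_v (trans M i j) x)
}.

Section Connections.
Context {R : realType} {n : nat} {M : manifold R n}.
Variable nabla : connection M.
Local Notation E := 'rV[R]_n.

Definition covD (i : mindex M) (X Y : E -> E) : E -> E :=
  fun x => 'D_(X x) Y x + gamma nabla i x (X x) (Y x).

(* Torsion, curvature and the covariant derivative of the curvature are
   tensors, so they are evaluated on vector fields with constant coordinates;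
   the brackets of such fields vanish. *)
Definition torsion (i : mindex M) (u v : E) : E -> E :=
  fun x => covD i (cst u) (cst v) x - covD i (cst v) (cst u) x.

Definition curvature (i : mindex M) (u v w : E) : E -> E :=
  fun x => covD i (cst u) (covD i (cst v) (cst w)) x
         - covD i (cst v) (covD i (cst u) (cst w)) x.

Definition nabla_curvature (i : mindex M) (z u v w : E) : E -> E :=
  fun x => covD i (cst z) (curvature i u v w) x
         - curvature i (covD i (cst z) (cst u) x) v w x
         - curvature i u (covD i (cst z) (cst v) x) w x
         - curvature i u v (covD i (cst z) (cst w) x) x.

Definition torsion_free : Prop :=
  forall i x, img M i x -> forall u v, torsion i u v x = 0.

Definition locally_symmetric : Prop :=
  forall i x, img M i x -> forall z u v w, nabla_curvature i z u v w x = 0.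

Definition smooth_curve (a b : R) (c : R -> M) : Prop :=
  (forall t : R, t \in `]a, b[ -> {for t, continuous c}) /\
  (forall i, smooth (`]a, b[%classic `&` c @^-1` dom M i) (chart M i \o c)).

(* Curves are functions on R of which only the restriction to [0, 1] matters.
   Each piece is smooth up to its end points, i.e. extends smoothly beyond. *)
Definition piecewise_smooth (c : R -> M) : Prop :=
  exists (m : nat) (s : nat -> R), s 0%N = 0 /\ s m = 1 /\
    forall k, (k < m)%N -> s k < s k.+1 /\
      exists (e : R) (c' : R -> M), 0 < e /\
        smooth_curve (s k - e) (s k.+1 + e) c' /\
        forall t : R, t \in `[s k, s k.+1] -> c t = c' t.

(* Homotopy of loops based at o, relative to the end points. *)
Definition null_homotopic (o : M) (c : R -> M) : Prop :=
  exists H : R * R -> M,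
    {within `[0, 1]%classic `*` `[0, 1]%classic, continuous H} /\
    forall t : R, t \in `[0, 1] ->
      H (0, t) = c t /\ H (1, t) = o /\ H (t, 0) = o /\ H (t, 1) = o.

(* A vector field along c is given by its coordinates v i t in every chart i
   whose domain contains c t.  It is parallel if it is continuous and satisfies
   the equation v' + Gamma(c', v) = 0 in all charts, for all but finitely many
   times. *)
Definition parallel (c : R -> M) (v : mindex M -> R -> E) : Prop :=
  (forall i j (t : R), t \in `[0, 1] -> dom M i (c t) -> dom M j (c t) ->
     v j t = 'D_(v i t) (trans M i j) (chart M i (c t))) /\
  (forall i, {within `[0, 1]%classic `&` c @^-1` dom M i, continuous (v i)}) /\
  (exists s : seq R, forall i (t : R),
     t \in `]0, 1[ -> t \notin s -> dom M i (c t) ->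
     is_derive t 1 (v i)
       (- gamma nabla i (chart M i (c t)) ('D_1 (chart M i \o c) t) (v i t))).

(* P is the matrix, acting on row vectors, of the parallel transport along the
   loop c based at a point of the domain of the chart i. *)
Definition parallel_transport (i : mindex M) (c : R -> M) (P : 'M[R]_n) :=
  forall u : E, exists v, parallel c v /\ v i 0 = u /\ v i 1 = u *m P.

(* The restricted holonomy group at o, in the coordinates of the chart i. *)
Definition restricted_holonomy_group (o : M) (i : mindex M) : set 'M[R]_n :=
  [set P | exists c : R -> M, [/\ piecewise_smooth c, c 0 = o, c 1 = o,
                              null_homotopic o c & parallel_transport i c P]].

End Connections.

(* The tangent space at 1 of a Lie subgroup H of GL_n, as the set of velocities
   of C^1 curves of H through 1.  (H need not be closed; a C^1 curve of GL_n
   contained in a connected Lie subgroup is C^1 in that subgroup, so that these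
   are exactly the elements of its Lie algebra.) *)
Definition lie_algebra (R : realType) (n : nat) (H : set 'M[R]_n) :
    set 'M[R]_n :=
  [set A | exists (e : R) (c : R -> 'M[R]_n),
     [/\ 0 < e, Ck 1 `](- e), e[%classic c,
         forall t : R, t \in `](- e), e[ -> H (c t),
         c 0 = 1%:M & 'D_1 c 0 = A]].

(* The holonomy algebra at o as a subset of gl(V); the tangent space at o, read
   in the chart i, is identified with V by theta. *)
Definition holonomy_algebra (R : realType) (n : nat) (M : manifold R n)
    (nabla : connection M) (o : M) (i : mindex M) (V : vectType R)
    (theta : {linear 'rV[R]_n -> V}) : set 'End(V) :=
  [set A | exists2 B, lie_algebra (restricted_holonomy_group nabla o i) B &
     forall u, A (theta u) = theta (u *m B)].

Section AlgebraicPart.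
Context {R : realType} {V : vectType R}.
Variables (g : {vspace 'End(V)}) (V1 V2 : {vspace V}).

Definition lie_subalgebra : Prop :=
  forall A B, A \in g -> B \in g -> (A \o B)%VF - (B \o A)%VF \in g.

Definition invariant_subspace (W : {vspace V}) : Prop :=
  forall A, A \in g -> (A @: W <= W)%VS.

Definition faithful_on (W : {vspace V}) : Prop :=
  forall A, A \in g -> (forall x, x \in W -> A x = 0) -> A = 0.

(* V1^* (x) V2^* (x) gl(V), as bilinear maps V1 x V2 -> gl(V). *)
Definition bilin := 'Hom(subvs_of V1, 'Hom(subvs_of V2, 'End(V))).

Definition k_g : set bilin :=
  [set S : bilin |
    [/\ forall (x : subvs_of V1) (y' : subvs_of V2), S x y' \in g,
       forall (x : subvs_of V1) (y' z' : subvs_of V2),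
         S x y' (vsval z') = S x z' (vsval y') &
       forall (x t : subvs_of V1) (y' : subvs_of V2),
         S x y' (vsval t) = S t y' (vsval x)]].

Definition k1_g : set 'Hom(V, bilin) :=
  [set D : 'Hom(V, bilin) |
    [/\ forall v, k_g (D v),
       forall (x y : subvs_of V1) (z' : subvs_of V2),
         D (vsval x) y z' = D (vsval y) x z' &
       forall (y : subvs_of V1) (z' t' : subvs_of V2),
         D (vsval t') y z' = D (vsval z') y t']].

End AlgebraicPart.

Arguments k_g {R V} g V1 V2.
Arguments k1_g {R V} g V1 V2.

(* Main.v *)
Require Import Defs.
From HB Require Import structures.
From mathcomp Require Import all_boot all_order all_algebra.
From mathcomp Require Import all_classical all_reals all_analysis.
From mathcomp Require Import ring lra.

Set Implicit Arguments.
Unset Strict Implicit.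
Unset Printing Implicit Defensive.

Import Order.TTheory GRing.Theory Num.Theory.
Import numFieldNormedType.Exports.

Local Open Scope classical_set_scope.
Local Open Scope ring_scope.

(* Curvature and its covariant derivative take values in the holonomy algebra: the holonomy of
   the triangle with vertices x, x + w, x + w + t v (in a chart) is a curve of holonomies through
   1, and its velocity at t = 0 is an integral of the curvature transported back to x along
   [x, x + w]; letting w = eps u tend to 0 puts R(u, v), hence, differentiating its transport
   along a segment, also (nabla_z R)(u, v) in the closed subspace g.  Transport along short
   segments and the connectedness of M show that g is the holonomy algebra at every point, so
   that g may be read at a point where nabla R <> 0.

   There T_z(u, v) = (nabla_z R)(u, v) is skew in u, v and satisfies both Bianchi identities.  If
   x, y lie in V1, the first one gives T_z(x, y) w in V1 for w in V2, and invariance of V2 puts it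
   in the intersection of V1 and V2; as V2 is faithful, T_z(x, y) = 0, and symmetrically on V2.
   Hence T is determined by its restriction to V1 x V2, and the two Bianchi identities are exactly
   the conditions defining k(g) and k^1(g). *)

(** * Linear differential equations *)

(** Only one half of the Ambrose-Singer theorem is proved, that curvature lies in the holonomy
    algebra. As [lie_algebra] consists of velocities of C^1 curves, an explicit C^1 curve of
    holonomies must be produced, and this dictates the triangle. A parallelogram with both sides of
    order t has holonomy 1 + O(t^2), hence zero velocity at t = 0. A triangle with one side w fixed
    has area of order t, and for t = 0 it is a segment run forth and back, so its holonomy passes
    through 1 with a useful first derivative.

    The price is that parallel transport must be C^1 in a parameter, whence the linear equations
    treated here. They are solved only along short segments of a chart, where the coefficients are
    at most 1/4, and on [-1, 2], because the pieces of a curve have to extend smoothly beyond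
    [0, 1].

    A second obstacle: [lie_algebra] yields a mere set of matrices, known to be a subspace only
    where it has been identified with g. The derivative of R involves the holonomy at all nearby
    points, so the passage from o to every other point has to precede it. *)

Section MatrixCalculus.
Context {R : realType}.

Lemma le_coord_norm m n (A : 'M[R]_(m, n)) i j : `|A i j| <= `|A|.
Proof.
rewrite [leRHS]/Num.Def.normr/= mx_normrE.
exact: (le_bigmax _ (fun ij : 'I_m * 'I_n => `|A ij.1 ij.2|) (i, j)).
Qed.

Lemma mx_norm_le m n (A : 'M[R]_(m, n)) (c : R) :
  0 <= c -> (forall i j, `|A i j| <= c) -> `|A| <= c.
Proof.
by move=> c0 Ac; rewrite [leLHS]/Num.Def.normr/= mx_normrE bigmax_le.
Qed.

Lemma cvg_mxP {T : Type} {F : set_system T} {FF : Filter F} m n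
    (f : T -> 'M[R]_(m, n)) (l : 'M[R]_(m, n)) :
  f @ F --> l <-> forall i j, f x i j @[x --> F] --> l i j.
Proof.
split=> [fl i j|fl].
  exact: (cvg_comp _ _ fl (@coord_continuous R m n i j l)).
apply/cvgrPdist_le => /= e e0.
near=> x.
apply: mx_norm_le; first exact: ltW.
move=> i j; rewrite !mxE/=.
suff : forall ij : 'I_m * 'I_n, `|l ij.1 ij.2 - f x ij.1 ij.2| <= e.
  by move/(_ (i, j)).
near: x; apply: filter_forall => /= -[i j] /=.
by move: (fl i j) => /cvgrPdist_le; exact.
Unshelve. all: by end_near. Qed.

Lemma cvg_mulmx {T : Type} {F : set_system T} {FF : Filter F} m n p
    (f : T -> 'M[R]_(m, n)) (g : T -> 'M[R]_(n, p)) (a : 'M[R]_(m, n))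
    (b : 'M[R]_(n, p)) :
  f @ F --> a -> g @ F --> b ->
  (fun x => f x *m g x) @ F --> (a *m b : 'M[R]_(m, p)).
Proof.
move=> /cvg_mxP fa /cvg_mxP gb; apply/cvg_mxP => i j; rewrite mxE.
rewrite (_ : (fun x => _) = (fun x => \sum_k f x i k * g x k j)); last first.
  by apply/funext => x; rewrite mxE.
elim: (index_enum _) => [|k r IH].
  by rewrite big_nil; under eq_fun do rewrite big_nil; exact: cvg_cst.
rewrite big_cons; under eq_fun do rewrite big_cons.
by apply: cvgD IH; apply: cvgM; [exact: fa|exact: gb].
Qed.

Lemma is_derive_mxP {V : normedModType R} m n (f : V -> 'M[R]_(m, n)) x v D :
  is_derive x v f D <-> forall i j, is_derive x v (fun y => f y i j) (D i j).
Proof.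
split=> [[fx fD] i j|fD].
  have := fx; move=> /derivable_mxP /(_ i j) fij.
  by apply: DeriveDef => //; rewrite -fD derive_mx// mxE.
have fx : derivable f x v by apply/derivable_mxP => i j; have [] := fD i j.
apply: DeriveDef => //; rewrite derive_mx//; apply/matrixP => i j.
by rewrite mxE; have [] := fD i j.
Qed.

Lemma is_derive_mulr {V : normedModType R} (f g : V -> R) (x v : V) df dg :
  is_derive x v f df -> is_derive x v g dg ->
  is_derive x v (fun y => f y * g y) (df * g x + f x * dg).
Proof.
move=> fD gD; rewrite addrC (mulrC df).
exact: is_deriveM.
Qed.

Lemma is_derive_mulmx {V : normedModType R} m n p (f : V -> 'M[R]_(m, n))
    (g : V -> 'M[R]_(n, p)) x v df dg :
  is_derive x v f df -> is_derive x v g dg ->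
  is_derive x v (fun y => f y *m g y) (df *m g x + f x *m dg).
Proof.
move=> /is_derive_mxP fD /is_derive_mxP gD; apply/is_derive_mxP => i j.
rewrite (_ : (fun y => _) = \sum_k ((fun y => f y i k) * (fun y => g y k j))).
  rewrite !mxE -big_split/=; apply: is_derive_sum => k.
  exact: is_derive_mulr (fD i k) (gD k j).
by apply/funext => y; rewrite mxE fct_sumE.
Qed.

Lemma is_derive_trmx {V : normedModType R} m n (f : V -> 'M[R]_(m, n)) x v df :
  is_derive x v f df -> is_derive x v (fun y => (f y)^T) df^T.
Proof.
move=> /is_derive_mxP fD; apply/is_derive_mxP => i j.
by under eq_fun do rewrite mxE; rewrite mxE.
Qed.

Lemma is_derive_affine m n (x w : 'M[R]_(m, n)) (t : R) :
  is_derive t (1 : R) (fun r => x + r *: w) w.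
Proof.
apply/is_derive_mxP => i j.
rewrite (_ : (fun r => _) = (fun r => x i j + r * w i j)); last first.
  by apply/funext => r; rewrite !mxE.
have := is_deriveD (is_derive_cst (x i j) t (1 : R))
  (is_derive_mulr (is_derive_id t 1) (is_derive_cst (w i j) t (1 : R))).
by rewrite mulr0 addr0 mul1r add0r.
Qed.

Lemma is_derive_scalel m n (w : 'M[R]_(m, n)) (t : R) :
  is_derive t (1 : R) (fun r => r *: w) w.
Proof. by have := is_derive_affine 0 w t; under eq_fun do rewrite add0r. Qed.

Lemma is_derive_continuous {W : normedModType R} (f : R -> W) x D :
  is_derive x (1 : R) f D -> {for x, continuous f}.
Proof. by move=> [fx _]; exact/differentiable_continuous/derivable1_diffP. Qed.

Lemma continuous_mulmx {T : topologicalType} m n p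
    (f : T -> 'M[R]_(m, n)) (g : T -> 'M[R]_(n, p)) x :
  {for x, continuous f} -> {for x, continuous g} ->
  {for x, continuous (fun y => f y *m g y)}.
Proof. by move=> fx gx; exact: cvg_mulmx. Qed.

(** In the maximum norm the estimate may be made entry by entry, each with its own intermediate
    point, without loss in the constant. *)
Lemma mean_value_bound m n (F D : R -> 'M[R]_(m, n)) (K a b : R) :
  a <= b -> 0 <= K ->
  (forall s, s \in `[a, b] -> is_derive s (1 : R) F (D s)) ->
  (forall s, s \in `[a, b] -> `|D s| <= K) ->
  `|F b - F a| <= K * (b - a).
Proof.
move=> ab K0 FD DK; apply: mx_norm_le; first by rewrite mulr_ge0// subr_ge0.
move=> i j; rewrite !mxE.
have FDij s : s \in `[a, b] -> is_derive s (1 : R) (fun s => F s i j) (D s i j).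
  by move=> /FD/is_derive_mxP.
have FDo s : s \in `]a, b[ -> is_derive s (1 : R) (fun s => F s i j) (D s i j).
  by move=> sab; apply: FDij; apply: subset_itv_oo_cc.
have cF : {within `[a, b], continuous (fun s => F s i j)}.
  by apply: derivable_within_continuous => s /FDij[].
have [c cab E] := MVT_segment ab FDo cF.
rewrite E normrM (ger0_norm (_ : 0 <= b - a)) ?subr_ge0//.
rewrite ler_wpM2r ?subr_ge0//.
by apply: le_trans (DK _ cab); exact: le_coord_norm.
Qed.

(* The factor n makes the maximum norm submultiplicative. *)
Definition nrm n (A : 'M[R]_n) : R := n%:R * `|A|.

Lemma nrm_ge0 n (A : 'M[R]_n) : 0 <= nrm A. Proof. exact: mulr_ge0. Qed.

Lemma nrmM n (A B : 'M[R]_n) : nrm (A *m B) <= nrm A * nrm B.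
Proof.
rewrite /nrm -mulrA ler_wpM2l//; apply: mx_norm_le => [|i j].
  by rewrite !mulr_ge0.
rewrite mxE (le_trans (ler_norm_sum _ _ _))//.
rewrite (@le_trans _ _ (\sum_(k < n) `|A| * `|B|))//.
  by apply: ler_sum => k _; rewrite normrM ler_pM// le_coord_norm.
by rewrite sumr_const card_ord -[leLHS]mulr_natl mulrCA.
Qed.

Lemma nrmD n (A B : 'M[R]_n) : nrm (A + B) <= nrm A + nrm B.
Proof. by rewrite /nrm -mulrDr ler_wpM2l// ler_normD. Qed.

Lemma nrmN n (A : 'M[R]_n) : nrm (- A) = nrm A.
Proof. by rewrite /nrm normrN. Qed.

Lemma nrmZ n c (A : 'M[R]_n) : nrm (c *: A) = `|c| * nrm A.
Proof. by rewrite /nrm normrZ mulrCA. Qed.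

Lemma nrm_mean_value_bound n (F D : R -> 'M[R]_n) (K a b : R) :
  a <= b -> 0 <= K ->
  (forall s, s \in `[a, b] -> is_derive s (1 : R) F (D s)) ->
  (forall s, s \in `[a, b] -> nrm (D s) <= K) ->
  nrm (F b - F a) <= K * (b - a).
Proof.
(* For n = 0 the factor of [nrm] is 0 and cannot be divided out. *)
case: n F D => [|n] F D ab K0 FD DK.
  by rewrite /nrm mul0r mulr_ge0// subr_ge0.
have n0 : 0 < n.+1%:R :> R by [].
rewrite /nrm mulrC -ler_pdivlMr// mulrAC.
apply: mean_value_bound FD _ => //; first by rewrite divr_ge0.
by move=> s /DK; rewrite ler_pdivlMr// mulrC.
Qed.

End MatrixCalculus.

Section Antiderivative.
Context {R : realType}.

(** Integrating from a negative a makes 0 an interior point, so that the derivative there is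
    two-sided; the value at 0 is subtracted afterwards. *)
Lemma antiderivative (f : R -> R) (a : R) : continuous f -> a < 0 ->
  exists F : R -> R, F 0 = 0 /\ forall s, a < s -> is_derive s 1 F (f s).
Proof.
move=> cf a0.
pose G s := (\int[@lebesgue_measure R]_(t in `[a, s]) f t)%R.
have GD s : a < s -> is_derive s 1 G (f s).
  move=> as_.
  have s1 : s < s + 1 by rewrite ltrDl.
  have fi : (@lebesgue_measure R).-integrable `[a, s + 1] (EFin \o f).
    apply: continuous_compact_integrable; first exact: segment_compact.
    by apply: continuous_subspaceT.
  have [dG GE] := continuous_FTC1_closed s1 fi as_ (cf s).
  by rewrite derive1E in GE; exact: DeriveDef dG GE.
exists (fun s => G s - G 0); split; first by rewrite subrr.
move=> s /GD Gs.
by apply: is_derive_eq; rewrite subr0.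
Qed.

Lemma antiderivative_mx m n (f : R -> 'M[R]_(m, n)) (a : R) :
  continuous f -> a < 0 ->
  exists F : R -> 'M[R]_(m, n),
    F 0 = 0 /\ forall s, a < s -> is_derive s (1 : R) F (f s).
Proof.
move=> cf a0.
have /choice[F FP] : forall ij : 'I_m * 'I_n, exists F : R -> R,
    F 0 = 0 /\ forall s, a < s -> is_derive s 1 F (f s ij.1 ij.2).
  move=> ij; apply: antiderivative => // s.
  by have /cvg_mxP := cf s; exact.
exists (fun s => \matrix_(i, j) F (i, j) s); split.
  by apply/matrixP => i j; rewrite !mxE; have [] := FP (i, j).
move=> s as_; apply/is_derive_mxP => i j.
under eq_fun do rewrite mxE.
by have [_] := FP (i, j); exact.
Qed.

End Antiderivative.

Section GeometricLimit.
Context {R : realType}.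

Lemma le_geometric0 (x c : R) :
  (forall k, x <= c / 2 ^+ k) -> x <= 0.
Proof.
move=> xc; rewrite leNgt; apply/negP => x0.
have /archi_boundP : 0 <= `|c / x| by [].
set k := Num.bound _ => ck.
have := xc k; rewrite ler_pdivlMr ?exprn_gt0//; apply/negP; rewrite -ltNge.
rewrite mulrC -ltr_pdivrMr// (le_lt_trans (ler_norm _))// (lt_trans ck)//.
by rewrite -natrX ltr_nat ltn_expl.
Qed.

(** The intervals of radius c / 2^k around u k are nested, so the supremum of their left ends lies
    in all of them; this gives the limit together with its rate. *)
Lemma geometric_limit (u : nat -> R) (c : R) :
  (forall k, `|u k.+1 - u k| <= c / 2 ^+ k.+1) ->
  exists l, forall k, `|l - u k| <= c / 2 ^+ k.
Proof.
move=> uc.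
have c0 : 0 <= c.
  by have := le_trans (normr_ge0 _) (uc 0); rewrite pmulr_lge0// invr_gt0.
pose v k := u k + c / 2 ^+ k; pose w k := u k - c / 2 ^+ k.
have half k : c / 2 ^+ k = c / 2 ^+ k.+1 + c / 2 ^+ k.+1.
  by rewrite exprSr; field; rewrite expf_neq0.
have vS k : v k.+1 <= v k.
  have := uc k; rewrite ler_norml => /andP[_]; rewrite /v (half k); lra.
have wS k : w k <= w k.+1.
  have := uc k; rewrite ler_norml => /andP[+ _]; rewrite /w (half k); lra.
have vm m k : (k <= m)%N -> v m <= v k.
  by move=> /subnK <-; elim: (m - k)%N => // j; apply: le_trans; exact: vS.
have wm m k : (k <= m)%N -> w k <= w m.
  move=> /subnK <-; elim: (m - k)%N => // j /le_trans; apply; exact: wS.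
have wv m k : w m <= v k.
  apply: (@le_trans _ _ (w (maxn m k))); first by rewrite wm ?leq_maxl.
  apply: (@le_trans _ _ (v (maxn m k))); last by rewrite vm ?leq_maxr.
  rewrite /w /v lerD2l.
  have : 0 <= c / 2 ^+ maxn m k by rewrite divr_ge0// exprn_ge0.
  lra.
exists (sup (range w)) => k.
have wsup m : w m <= sup (range w).
  apply: ub_le_sup; last by exists m.
  by exists (v 0) => _ [j _ <-].
have supv m : sup (range w) <= v m.
  apply: ge_sup; first by exists (w 0), 0.
  by move=> _ [j _ <-].
rewrite ler_norml; have := wsup k; have := supv k.
by rewrite /v /w => ? ?; apply/andP; split; lra.
Qed.

Lemma norm_le_nrm n (A : 'M[R]_n) : `|A| <= nrm A.
Proof.
case: n A => [|n] A; first by apply: mx_norm_le => [|[]//]; exact: nrm_ge0.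
by rewrite /nrm ler_peMl// ler1n.
Qed.

Lemma nrm_le0_eq0 n (A : 'M[R]_n) : nrm A <= 0 -> A = 0.
Proof.
by move=> /(le_trans (norm_le_nrm A)); rewrite normr_le0 => /eqP.
Qed.

(** The limit is taken entrywise; the factor n is lost on the way back from entries to [nrm]. *)
Lemma geometric_limit_mx n (u : nat -> 'M[R]_n) (c : R) :
  (forall k, nrm (u k.+1 - u k) <= c / 2 ^+ k.+1) ->
  exists l, forall k, nrm (l - u k) <= n%:R * c / 2 ^+ k.
Proof.
move=> uc.
have c0 : 0 <= c.
  by have := le_trans (nrm_ge0 _) (uc 0); rewrite pmulr_lge0// invr_gt0.
have /choice[l lP] : forall ij : 'I_n * 'I_n, exists l : R,
    forall k, `|l - u k ij.1 ij.2| <= c / 2 ^+ k.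
  move=> ij; apply: geometric_limit => k.
  apply: le_trans (uc k); apply: le_trans (norm_le_nrm _).
  by have := le_coord_norm (u k.+1 - u k) ij.1 ij.2; rewrite !mxE.
exists (\matrix_(i, j) l (i, j)) => k.
rewrite /nrm -mulrA ler_wpM2l//; apply: mx_norm_le => [|i j].
  by rewrite divr_ge0// exprn_ge0.
by rewrite !mxE; exact: (lP (i, j)).
Qed.

End GeometricLimit.

Lemma derive0_cst {R : realType} m n (F : R -> 'M[R]_(m, n)) (a b : R) :
  (forall s, s \in `[a, b] -> is_derive s (1 : R) F 0) ->
  forall s, s \in `[a, b] -> F s = F a.
Proof.
move=> FD s; rewrite in_itv/= => /andP[as_ sb].
apply/eqP; rewrite -subr_eq0 -normr_le0 -(mul0r (s - a)).
apply: (@mean_value_bound _ _ _ _ (fun=> 0)) => // r; last by rewrite normr0.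
rewrite in_itv/= => /andP[ar rs]; apply: FD.
by rewrite in_itv/= ar (le_trans rs).
Qed.

Section Clamp.
Context {R : realType}.

(** The retraction of the line onto [a, b]; composition with it extends functions continuous on
    [a, b] to continuous functions on R. *)
Definition clamp (a b s : R) := Num.max (Num.min s b) a.

Lemma clamp_continuous a b : continuous (clamp a b).
Proof.
have lipM (x y c : R) : `|Num.max x c - Num.max y c| <= `|x - y|.
  wlog yx : x y / y <= x => [H|].
    have [/H//|/ltW/H] := leP y x.
    by rewrite distrC (distrC y).
  rewrite [leRHS]ger0_norm ?subr_ge0//.
  rewrite ger0_norm; last by rewrite subr_ge0 ge_max !le_max yx lexx orbT.
  by case: (leP x c); case: (leP y c); lra.
have lipm (x y c : R) : `|Num.min x c - Num.min y c| <= `|x - y|.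
  by rewrite -(opprK x) -(opprK y) -(opprK c) -!oppr_max -opprD normrN
    (le_trans (lipM _ _ _))// opprK addrC opprK distrC.
move=> s; apply/cvgrPdist_lt => /= e e0; exists e => //= r sr.
by apply: le_lt_trans sr; exact: le_trans (lipM _ _ _) (lipm _ _ _).
Qed.

Lemma clamp_itv a b s : a <= b -> clamp a b s \in `[a, b].
Proof.
by move=> ab; rewrite in_itv/= /clamp le_max lexx orbT ge_max ab ge_min lexx orbT.
Qed.

Lemma clamp_id a b s : s \in `[a, b] -> clamp a b s = s.
Proof.
by rewrite in_itv/= => /andP[as_ sb]; rewrite /clamp min_l// max_l.
Qed.

End Clamp.

(** * Picard iteration and fundamental matrices *)

Section LinearODE.
Context {R : realType}.

(** The first Picard iterate contributes [nrm 1] and its distance to the solution at most n times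
    that. The bound depends on n alone, which makes later estimates uniform in the coefficients. *)
Definition ode_bound n : R := n.+1%:R * nrm (1%:M : 'M[R]_n).

(** Points of [-1, 2] are at distance at most 2 from 0, so with coefficients bounded by 1/4 the
    integral operator contracts by the factor 2 / 4 = 1 / 2 on the whole interval, and no gluing of
    local solutions occurs. *)
Lemma picard n (A : R -> 'M[R]_n) :
  continuous A -> (forall s, nrm (A s) <= 4^-1) ->
  exists X : R -> 'M[R]_n, [/\ X 0 = 1%:M,
    forall s : R, s \in `](-1), 2[ -> is_derive s (1 : R) X (X s *m A s) &
    forall s, nrm (X s) <= ode_bound n].
Proof.
move=> cA A4.
pose N := nrm (1%:M : 'M[R]_n).
have N0 : 0 <= N by exact: nrm_ge0.
(* An antiderivative is chosen for every f, with a dummy value when f is not continuous, so that the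
   Picard operator is total and can be iterated. *)
have /choice[I IP] : forall f : R -> 'M[R]_n, exists F : R -> 'M[R]_n,
    continuous f ->
    F 0 = 0 /\ forall s : R, -2 < s -> is_derive s (1 : R) F (f s).
  move=> f; have [cf|ncf] := pselect (continuous f).
    by have [|F FP] := antiderivative_mx (a := -2) cf; [lra|exists F].
  by exists (fun=> 0) => /ncf.
(* Freezing the iterates outside [-1, 2] makes them continuous on R and lets all estimates hold for
   every s. *)
pose c := clamp (-1 : R) 2.
have c_itv s : c s \in `[-1, 2] by apply: clamp_itv; lra.
have c0 : c 0 = 0 by apply: clamp_id; rewrite in_itv/=; apply/andP; split; lra.
pose T (f : R -> 'M[R]_n) s := 1%:M + I (fun r => f r *m A r) (c s).
have cfA (f : R -> 'M[R]_n) : continuous f -> continuous (fun r => f r *m A r).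
  by move=> cf s; apply: continuous_mulmx; [exact: cf|exact: cA].
have ID (f : R -> 'M[R]_n) : continuous f -> forall s : R, s \in `[-1, 2] ->
    is_derive s (1 : R) (I (fun r => f r *m A r)) (f s *m A s).
  move=> cf s; rewrite in_itv/= => /andP[s1 _].
  by have [_] := IP _ (cfA _ cf); apply; lra.
have T0 (f : R -> 'M[R]_n) : continuous f -> T f 0 = 1%:M.
  by move=> cf; rewrite /T c0 (IP _ (cfA _ cf)).1 addr0.
have cT (f : R -> 'M[R]_n) : continuous f -> continuous (T f).
  move=> cf s; apply: cvgD; first exact: cvg_cst.
  apply: (@continuous_comp _ _ _ c); first exact: clamp_continuous.
  by apply: is_derive_continuous; exact: ID.
have TD (f : R -> 'M[R]_n) (s : R) : continuous f -> s \in `](-1), 2[ ->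
    is_derive s (1 : R) (T f) (f s *m A s).
  move=> cf s12.
  apply: (@near_eq_is_derive _ _ _ (fun r => 1%:M + I (fun r => f r *m A r) r)).
    near=> r; rewrite /T /c clamp_id//.
    apply: subset_itv_oo_cc; near: r; exact: near_in_itvoo.
  rewrite -[X in is_derive _ _ _ X]add0r; apply: is_deriveD.
  by apply: ID => //; exact: subset_itv_oo_cc.
have Tlip (f g : R -> 'M[R]_n) (K : R) : continuous f -> continuous g -> 0 <= K ->
    (forall s, nrm (f s - g s) <= K) -> forall s, nrm (T f s - T g s) <= K / 2.
  move=> cf cg K0 fgK s; rewrite /T opprD addrACA subrr add0r.
  set F := I _; set G := I _.
  pose H r := F r - G r.
  have H0 : H 0 = 0.
    by rewrite /H /F /G (IP _ (cfA _ cf)).1 (IP _ (cfA _ cg)).1 subrr.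
  have HD (r : R) : r \in `[-1, 2] -> is_derive r (1 : R) H ((f r - g r) *m A r).
    by move=> r12; rewrite mulmxBl; apply: is_deriveB; exact: ID.
  have HK r : nrm ((f r - g r) *m A r) <= K / 4.
    by apply: le_trans (nrmM _ _) _; apply: ler_pM => //; exact: nrm_ge0.
  have := c_itv s; rewrite in_itv/= => /andP[c1 c2].
  have K4 : 0 <= K / 4 by lra.
  rewrite -/(H (c s)); have [cs0|cs0] := leP 0 (c s).
    have HD' r : r \in `[0, c s] -> is_derive r (1 : R) H ((f r - g r) *m A r).
      rewrite in_itv/= => /andP[r0 rc]; apply: HD.
      by rewrite in_itv/=; apply/andP; split; lra.
    have := nrm_mean_value_bound cs0 K4 HD' (fun r _ => HK r).
    by rewrite H0 !subr0 => /le_trans; apply; nra.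
  have HD' r : r \in `[c s, 0] -> is_derive r (1 : R) H ((f r - g r) *m A r).
    rewrite in_itv/= => /andP[r0 rc]; apply: HD.
    by rewrite in_itv/=; apply/andP; split; lra.
  have := nrm_mean_value_bound (ltW cs0) K4 HD' (fun r _ => HK r).
  by rewrite H0 !sub0r nrmN => /le_trans; apply; nra.
pose S k := iter k T (fun=> 1%:M).
have cS k : continuous (S k).
  by elim: k => [|k IH]; [exact: cst_continuous|exact: cT].
have S0 k : S k 0 = 1%:M by case: k => //= k; exact: T0.
have Sc k s : nrm (S k.+1 s - S k s) <= N / 2 ^+ k.+1.
  elim: k s => [|k IH] s.
    (* The initial iterate 1 is itself the image of 0 under T, so the first increment is an instance
       of the Lipschitz estimate too. *)
    have : nrm (T (S 0%N) s - T (fun=> 0) s) <= N / 2.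
      apply: Tlip => //; first exact: cst_continuous.
      by move=> r; rewrite subr0.
    rewrite expr1; congr (nrm (_ - _) <= _).
    rewrite /T; set f := (X in I X).
    have c00 : continuous (fun _ : R => 0 : 'M[R]_n) by move=> r; exact: cvg_cst.
    have cf : continuous f by exact: cfA.
    suff -> : I f (c s) = 0 by rewrite addr0.
    have ID0 (r : R) : r \in `[-1, 2] -> is_derive r (1 : R) (I f) 0.
      by move=> r12; have := ID _ c00 r r12; rewrite mul0mx.
    rewrite (derive0_cst ID0 (c_itv s)) -(derive0_cst ID0 (c_itv 0)) c0.
    exact: (IP _ cf).1.
  rewrite exprSr invfM mulrA; apply: (Tlip (S k.+1) (S k)) => //.
  by rewrite divr_ge0// exprn_ge0.
have /choice[X XS] : forall s, exists l : 'M[R]_n, forall k,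
    nrm (l - S k s) <= n%:R * N / 2 ^+ k.
  by move=> s; apply: geometric_limit_mx => k.
have cX : continuous X.
  move=> s; apply/cvgrPdist_le => e e0.
  have [k kP] : exists k, n%:R * N / 2 ^+ k <= e / 3.
    apply: contrapT => /forallNP h.
    have := @le_geometric0 R (e / 3) (n%:R * N).
    have -> : (e / 3 <= 0) = false by apply/negbTE; rewrite -ltNge; lra.
    case/(_ _)/Bool.diff_false_true => k.
    by apply/ltW; rewrite ltNge; apply/negP; exact: h.
  near=> r.
  have -> : X s - X r = (X s - S k s) + (S k s - S k r) - (X r - S k r).
    by apply/matrixP => i j; rewrite !mxE; ring.
  apply: le_trans (ler_normB _ _) _.
  apply: le_trans (lerD (ler_normD _ _) (lexx _)) _.
  have Xk z := le_trans (norm_le_nrm _) (le_trans (XS z k) kP).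
  have h : `|S k s - S k r| <= e / 3.
    near: r; move/cvgrPdist_le: (cS k s); apply; lra.
  have := Xk s; have := Xk r; lra.
have XT s : X s = T X s.
  apply/eqP; rewrite -subr_eq0; apply/eqP/nrm_le0_eq0.
  apply: (@le_geometric0 _ _ (n%:R * N)) => k.
  have -> : X s - T X s = (X s - S k.+1 s) + (S k.+1 s - T X s).
    by rewrite addrA subrK.
  apply: le_trans (nrmD _ _) _.
  have h : nrm (T (S k) s - T X s) <= n%:R * N / 2 ^+ k / 2.
    apply: Tlip => //; first by rewrite divr_ge0 ?mulr_ge0// exprn_ge0.
    by move=> r; rewrite -opprB nrmN.
  have := XS s k.+1; rewrite exprSr invfM mulrA; move: h.
  rewrite -[S k.+1 s]/(T (S k) s); lra.
exists X; split.
- by rewrite XT T0.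
- move=> s s12; have -> : X = T X by apply/funext.
  by rewrite -XT; exact: TD.
- move=> s; rewrite -[X s](subrK (S 0%N s)).
  apply: le_trans (nrmD _ _) _; rewrite /ode_bound -addn1 natrD mulrDl mul1r.
  by rewrite lerD//; have := XS s 0%N; rewrite expr0 divr1.
Unshelve. all: by end_near. Qed.

(** X is the fundamental matrix for row vectors. Its inverse Y is carried along as a solution of the
    adjoint equation, so that invertibility and a bound on the inverse come without determinants. *)
Record fundamental n (A X Y : R -> 'M[R]_n) : Prop := Fundamental {
  fundX0 : X 0 = 1%:M;
  fundY0 : Y 0 = 1%:M;
  fundX : forall s : R, s \in `](-1), 2[ -> is_derive s (1 : R) X (X s *m A s);
  fundY : forall s : R, s \in `](-1), 2[ -> is_derive s (1 : R) Y (- A s *m Y s);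
  fundXb : forall s, nrm (X s) <= ode_bound n;
  fundYb : forall s, nrm (Y s) <= ode_bound n;
  fundXY : forall s, s \in `[0, 1] -> X s *m Y s = 1%:M
}.

Lemma nrm_trmx n (A : 'M[R]_n) : nrm A^T = nrm A.
Proof.
rewrite /nrm; congr (_ * _); apply/eqP; rewrite eq_le; apply/andP; split.
  by apply: mx_norm_le => // i j; rewrite mxE; exact: le_coord_norm.
apply: mx_norm_le => // i j.
by have := le_coord_norm A^T j i; rewrite mxE.
Qed.

Lemma continuous_trmx {T : topologicalType} m n (f : T -> 'M[R]_(m, n)) x :
  {for x, continuous f} -> {for x, continuous (fun y => (f y)^T)}.
Proof.
move=> fx; apply/cvg_mxP => i j; rewrite mxE.
under eq_fun do rewrite mxE.
by move: fx => /cvg_mxP; exact.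
Qed.

(** Y is the transpose of the Picard solution for the coefficient - A^T; then X Y has derivative X A
    Y - X A Y = 0. *)
Lemma linear_ode n (A : R -> 'M[R]_n) :
  (forall s : R, s \in `[-1, 2] -> {for s, continuous A}) ->
  (forall s : R, s \in `[-1, 2] -> nrm (A s) <= 4^-1) ->
  exists X Y, fundamental A X Y.
Proof.
move=> cA A4.
have le12 : -1 <= 2 :> R by lra.
pose B s := A (clamp (-1) 2 s).
have cB : continuous B.
  move=> s; apply: (@continuous_comp _ _ _ (clamp (-1) 2)).
    exact: clamp_continuous.
  exact/cA/clamp_itv.
have B4 s : nrm (B s) <= 4^-1 by exact/A4/clamp_itv.
have BA s : s \in `](-1), 2[ -> B s = A s.
  by move=> s12; rewrite /B clamp_id//; exact: subset_itv_oo_cc.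
have [X [X0 XD Xb]] := picard cB B4.
have cC : continuous (fun s => - (B s)^T).
  by move=> s; apply: cvgN; apply: continuous_trmx; exact: cB.
have C4 s : nrm (- (B s)^T) <= 4^-1 by rewrite nrmN nrm_trmx.
have [W [W0 WD Wb]] := picard cC C4.
have YD (s : R) : s \in `](-1), 2[ ->
    is_derive s (1 : R) (fun s => (W s)^T) (- A s *m (W s)^T).
  move=> s12; have /is_derive_trmx := WD s s12.
  by rewrite trmx_mul linearN/= trmxK BA.
have XD' (s : R) : s \in `](-1), 2[ -> is_derive s (1 : R) X (X s *m A s).
  by move=> s12; rewrite -BA//; exact: XD.
exists X, (fun s => (W s)^T); split => //.
- by rewrite W0 trmx1.
- by move=> s; rewrite nrm_trmx.
- move=> s s01.
  have D0 (r : R) : r \in `[0, 1] -> is_derive r (1 : R) (fun s => X s *m (W s)^T) 0.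
    rewrite in_itv/= => /andP[r0 r1].
    have r12 : r \in `](-1), 2[ by rewrite in_itv/=; apply/andP; split; lra.
    have := is_derive_mulmx (XD' r r12) (YD r r12).
    by rewrite mulNmx mulmxN -mulmxA subrr.
  by have /= -> := derive0_cst D0 s01; rewrite X0 W0 trmx1 mulmx1.
Qed.

End LinearODE.

(** * Differentiable dependence on a parameter *)

Section ParameterDependence.
Context {R : realType}.

Lemma nrm_cvg {T : Type} {F : set_system T} {FF : Filter F} n
    (f : T -> 'M[R]_n) (l : 'M[R]_n) :
  f @ F --> l <-> forall e, 0 < e -> \forall x \near F, nrm (f x - l) <= e.
Proof.
split=> [fl e e0|fl].
  case: n f l fl => [|n] f l fl.
    by near=> x; rewrite /nrm mul0r ltW.
  near=> x; rewrite /nrm -ler_pdivlMl// distrC.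
  near: x; move/cvgrPdist_le : fl; apply.
  by rewrite mulr_gt0// invr_gt0.
apply/cvgrPdist_le => /= e /fl fe.
near=> x; rewrite distrC; apply: le_trans (norm_le_nrm _) _.
by near: x.
Unshelve. all: by end_near. Qed.

Lemma is_derive_nrmP n (F : R -> 'M[R]_n) (t : R) (D : 'M[R]_n) :
  (forall e, 0 < e -> \forall r \near t,
     nrm (F r - F t - (r - t) *: D) <= e * `|r - t|) ->
  is_derive t (1 : R) F D.
Proof.
move=> FD.
have FtD : h^-1 *: (F (h *: (1 : R) + t) - F t) @[h --> 0^'] --> D.
  apply/nrm_cvg => e e0.
  have /nbhs_ballP[d /= d0 dP] := FD _ e0.
  exists d => //= h /=; rewrite sub0r normrN => hd h0.
  have : ball t d (h *: 1 + t).
    by rewrite /ball/= [_%:A]mulr1 opprD addrCA subrr addr0 normrN.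
  move/dP; rewrite addrK [_%:A]mulr1 => H.
  rewrite -[D](scalerK h0) -scalerBr nrmZ normfV ler_pdivrMl ?normr_gt0//.
  by rewrite mulrC.
apply: DeriveDef; first by apply/cvg_ex; exists D.
exact: cvg_lim.
Qed.

Lemma nrm_mean_value_bound_sym n (F D : R -> 'M[R]_n) (K a b : R) : 0 <= K ->
  (forall r : R, `|a - r| <= `|a - b| -> is_derive r (1 : R) F (D r)) ->
  (forall r : R, `|a - r| <= `|a - b| -> nrm (D r) <= K) ->
  nrm (F b - F a) <= K * `|b - a|.
Proof.
move=> K0 FD FK; have [ab|/ltW ba] := leP a b.
  rewrite (ger0_norm (_ : 0 <= b - a)) ?subr_ge0//.
  have lear r : r \in `[a, b] -> `|a - r| <= `|a - b|.
    by rewrite in_itv/= => /andP[ar rb]; rewrite !ler0_norm; lra.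
  have FD' r : r \in `[a, b] -> is_derive r (1 : R) F (D r) by move=> /lear/FD.
  exact: (nrm_mean_value_bound ab K0 FD' (fun r h => FK r (lear r h))).
rewrite -nrmN opprB distrC (ger0_norm (_ : 0 <= a - b)) ?subr_ge0//.
have lear r : r \in `[b, a] -> `|a - r| <= `|a - b|.
  by rewrite in_itv/= => /andP[ar rb]; rewrite !ger0_norm; lra.
have FD' r : r \in `[b, a] -> is_derive r (1 : R) F (D r) by move=> /lear/FD.
exact: (nrm_mean_value_bound ba K0 FD' (fun r h => FK r (lear r h))).
Qed.

(** Compactness of [0, 1] turns continuity at each (t0, s) into an estimate uniform in s. *)
Lemma tube n (f : R * R -> 'M[R]_n) (t0 e : R) :
  (forall s : R, s \in `[0, 1] -> {for (t0, s), continuous f}) -> 0 < e ->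
  \forall t \near t0, forall s : R, s \in `[0, 1] -> nrm (f (t, s) - f (t0, s)) <= e.
Proof.
move=> cf e0.
have K : compact (`[0, 1]%classic : set R) by exact: segment_compact.
have /compact_near_coveringP/near_covering_withinP := K.
move=> /(_ R (nbhs t0) (fun t s => nrm (f (t, s) - f (t0, s)) <= e)) H.
have : \forall t \near t0, `[0, 1]%classic `<=` (fun s => nrm (f (t, s) - f (t0, s)) <= e).
  apply: H => s s01.
  have e2 : 0 < e / 2 by lra.
  have /nrm_cvg/(_ _ e2) := cf s s01.
  case=> -[U V] /= [Ut Vs] UV.
  exists (V, U) => //= -[s' t] /= [Vs' Ut'] _.
  have -> : f (t, s') - f (t0, s') =
    (f (t, s') - f (t0, s)) - (f (t0, s') - f (t0, s)).
    by apply/matrixP => i j; rewrite !mxE; ring.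
  apply: le_trans (nrmD _ _) _; rewrite nrmN.
  have h1 := UV (t, s') (conj Ut' Vs').
  have h2 := UV (t0, s') (conj (nbhs_singleton Ut) Vs').
  by move: h1 h2 => /=; lra.
by apply: filterS => t tP s s01; exact: tP.
Qed.

Lemma nrm_bounded_itv n (f : R -> 'M[R]_n) :
  (forall s : R, s \in `[0, 1] -> {for s, continuous f}) ->
  exists2 K, 0 <= K & forall s : R, s \in `[0, 1] -> nrm (f s) <= K.
Proof.
move=> cf.
have cn : {within `[0, 1], continuous (fun s => nrm (f s))}.
  apply: continuous_in_subspaceT => s /[1!inE] s01.
  by apply: cvgM; [exact: cvg_cst|apply: cvg_norm; exact: cf].
have [c c01 cP] := EVT_max ler01 cn.
by exists (nrm (f c)) => //; exact: nrm_ge0.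
Qed.

Variables (n : nat) (e : R) (A A' X Y : R -> R -> 'M[R]_n).
Hypothesis fundA : forall t, `|t| < e -> fundamental (A t) (X t) (Y t).
Hypothesis derivA : forall t s : R, `|t| < e -> s \in `[0, 1] ->
  is_derive t (1 : R) (A ^~ s) (A' t s).
Hypothesis contA' : forall t s : R, `|t| < e -> s \in `[0, 1] ->
  {for (t, s), continuous (fun p => A' p.1 p.2)}.

Let B := @ode_bound R n.

Lemma B0 : 0 <= B. Proof. by rewrite mulr_ge0// nrm_ge0. Qed.

Lemma itv01 (s : R) : s \in `[0, 1] -> s \in `](-1), 2[.
Proof. by rewrite !in_itv/= => /andP[? ?]; apply/andP; split; lra. Qed.

Lemma in01 : (1 : R) \in `[0, 1]. Proof. by rewrite in_itv/= lexx ler01. Qed.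

Lemma contA's (t s : R) : `|t| < e -> s \in `[0, 1] -> {for s, continuous (A' t)}.
Proof.
move=> te s01.
have h : (fun s' : R => (t, s')) @ s --> (t, s).
  by apply: (@cvg_pair _ _ _ (nbhs s) (nbhs t) (nbhs s) _ _ _ (fun=> t) id);
    [exact: cvg_cst|exact: cvg_id].
exact: cvg_comp h (contA' te s01).
Qed.

Lemma near_lt (t0 : R) : `|t0| < e -> \forall t \near t0, `|t| < e.
Proof.
move=> t0e; exists (e - `|t0|) => /=; first by rewrite subr_gt0.
move=> t /= tt0; rewrite -(subrK t0 t) (le_lt_trans (ler_normD _ _))//.
by rewrite -ltrBrDr distrC.
Qed.

(** Uniformity in s comes from the mean value bound for [A r s - r *: A' t0 s], whose derivative in
    r is small for all s at once by [tube]. *)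
Lemma expandA (t0 d : R) : `|t0| < e -> 0 < d -> \forall t \near t0,
  forall s : R, s \in `[0, 1] ->
  nrm (A t s - A t0 s - (t - t0) *: A' t0 s) <= d * `|t - t0|.
Proof.
move=> t0e d0.
have /nbhs_ballP[r1 /= r10 r1P] := near_lt t0e.
have /nbhs_ballP[r2 /= r20 r2P] := tube (fun s h => contA' t0e h) d0.
exists (Num.min r1 r2) => /=; first by rewrite lt_min r10.
move=> t /=; rewrite lt_min => /andP[tr1 tr2] s s01.
pose F r := A r s - r *: A' t0 s.
have FD r : `|t0 - r| <= `|t0 - t| -> is_derive r (1 : R) F (A' r s - A' t0 s).
  move=> rt; apply: is_deriveB; first by apply: derivA => //; apply: r1P; exact: le_lt_trans rt _.
  exact: is_derive_scalel.
have FK r : `|t0 - r| <= `|t0 - t| -> nrm (A' r s - A' t0 s) <= d.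
  by move=> rt; apply: r2P => //; exact: le_lt_trans rt _.
have -> : A t s - A t0 s - (t - t0) *: A' t0 s = F t - F t0.
  by rewrite /F; apply/matrixP => i j; rewrite !mxE; ring.
exact: (nrm_mean_value_bound_sym (ltW d0) FD FK).
Qed.

(* [X t Y t0 - 1] solves a linear equation with a small right-hand side. *)
Lemma lipX (t0 : R) : `|t0| < e -> exists2 K, 0 <= K & \forall t \near t0,
  forall s : R, s \in `[0, 1] -> nrm (A t s - A t0 s) <= K * `|t - t0| /\
  nrm (X t s - X t0 s) <= K * `|t - t0| /\ nrm (Y t s - Y t0 s) <= K * `|t - t0|.
Proof.
move=> t0e.
have [a a0 aP] := nrm_bounded_itv (fun s h => contA's t0e h).
(* The three summands are the Lipschitz constants obtained below for A, X and Y; their sum serves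
   all three. *)
pose K := a + 1 + B * B * B * (a + 1) + B * B * (B * B * B * (a + 1)).
have BK : 0 <= B * B * B * (a + 1) by rewrite !mulr_ge0//; lra.
have BBK : 0 <= B * B * (B * B * B * (a + 1)) by rewrite !mulr_ge0//; lra.
exists K; first by rewrite /K; lra.
near=> t => s s01; pose P r := X t r *m Y t0 r.
have te : `|t| < e by near: t; exact: near_lt.
have tt0 : 0 <= `|t - t0| by [].
have hA r : r \in `[0, 1] -> nrm (A t r - A t0 r) <= (a + 1) * `|t - t0|.
  move=> r01.
  have h : forall s : R, s \in `[0, 1] ->
     nrm (A t s - A t0 s - (t - t0) *: A' t0 s) <= 1 * `|t - t0|.
    by near: t; apply: expandA.
  rewrite -[A t r - A t0 r](subrK ((t - t0) *: A' t0 r)).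
  apply: le_trans (nrmD _ _) _; rewrite nrmZ.
  have := h r r01; have := aP r r01.
  by move=> h1 h2; nra.
have FD (r : R) : r \in `[0, 1] -> is_derive r (1 : R) P (X t r *m (A t r - A t0 r) *m Y t0 r).
  move=> r01.
  have := is_derive_mulmx (fundX (fundA te) (itv01 r01)) (fundY (fundA t0e) (itv01 r01)).
  by rewrite mulNmx mulmxN mulmxBr mulmxBl !mulmxA.
have := s01; rewrite in_itv/= => /andP[s0 s1].
have hXY : nrm (X t s *m Y t0 s - 1%:M) <= B * (a + 1) * B * `|t - t0|.
  have K0 : 0 <= B * (a + 1) * B * `|t - t0| by rewrite !mulr_ge0//; lra.
  have le01 r : r \in `[0, s] -> r \in `[0, 1].
    by rewrite !in_itv/= => /andP[? ?]; apply/andP; split; lra.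
  have FD' r : r \in `[0, s] ->
      is_derive r (1 : R) P (X t r *m (A t r - A t0 r) *m Y t0 r).
    by move=> /le01/FD.
  have FK r : r \in `[0, s] -> nrm (X t r *m (A t r - A t0 r) *m Y t0 r) <=
      B * (a + 1) * B * `|t - t0|.
    move=> /le01 r01; apply: le_trans (nrmM _ _) _.
    rewrite [leRHS]mulrAC; apply: ler_pM; rewrite ?nrm_ge0//; last exact: (fundYb (fundA t0e)).
    apply: le_trans (nrmM _ _) _; rewrite -[leRHS]mulrA.
    by apply: ler_pM; rewrite ?nrm_ge0//; [exact: (fundXb (fundA te))|exact: hA].
  have := nrm_mean_value_bound s0 K0 FD' FK.
  rewrite {2}/P (fundX0 (fundA te)) (fundY0 (fundA t0e)) mulmx1 => /le_trans; apply.
  by rewrite subr0 ler_piMr.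
have XE : X t s - X t0 s = (X t s *m Y t0 s - 1%:M) *m X t0 s.
  by rewrite mulmxBl mul1mx -mulmxA (mulmx1C (fundXY (fundA t0e) s01)) mulmx1.
have hX : nrm (X t s - X t0 s) <= B * B * B * (a + 1) * `|t - t0|.
  rewrite XE; apply: le_trans (nrmM _ _) _.
  rewrite (_ : B * B * B * _ * _ = (B * (a + 1) * B * `|t - t0|) * B); last by ring.
  by apply: ler_pM; rewrite ?nrm_ge0//; exact: (fundXb (fundA t0e)).
have YE : Y t s - Y t0 s = - (Y t s *m (X t s - X t0 s) *m Y t0 s).
  rewrite mulmxBr mulmxBl (mulmx1C (fundXY (fundA te) s01)) mul1mx.
  by rewrite -mulmxA (fundXY (fundA t0e) s01) mulmx1 opprB.
have hY : nrm (Y t s - Y t0 s) <= B * B * (B * B * B * (a + 1)) * `|t - t0|.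
  rewrite YE nrmN; apply: le_trans (nrmM _ _) _.
  rewrite (_ : B * B * _ * _ = (B * (B * B * B * (a + 1) * `|t - t0|)) * B); last by ring.
  apply: ler_pM; rewrite ?nrm_ge0//; last exact: (fundYb (fundA t0e)).
  apply: le_trans (nrmM _ _) _.
  by apply: ler_pM; rewrite ?nrm_ge0//; exact: (fundYb (fundA te)).
have hA' := hA s s01.
by split; [|split]; rewrite /K; nra.
Unshelve. all: by end_near. Qed.

Lemma fundamental_continuous (t s : R) : `|t| < e -> s \in `[0, 1] ->
  {for s, continuous (X t)} /\ {for s, continuous (Y t)}.
Proof.
move=> te /itv01 s01; split.
  exact: is_derive_continuous (fundX (fundA te) s01).
exact: is_derive_continuous (fundY (fundA te) s01).
Qed.

(** The integrand of Duhamel's formula: the t-derivative of X at s = 1 is the integral of V over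
    [0, 1], times X. *)
Let V t s := X t s *m A' t s *m Y t s.

Lemma variation_antiderivative (t : R) : `|t| < e ->
  exists Z : R -> 'M[R]_n, Z 0 = 0 /\
    forall s : R, s \in `[0, 1] -> is_derive s (1 : R) Z (V t s).
Proof.
move=> te.
have cV : continuous (fun s => V t (clamp 0 1 s)).
  move=> s; apply: (@continuous_comp _ _ _ (clamp (0 : R) 1) (V t)).
    exact: clamp_continuous.
  have c01 : clamp 0 1 s \in `[0, 1] by exact: clamp_itv.
  have [cX cY] := fundamental_continuous te c01.
  apply: continuous_mulmx; last exact: cY.
  by apply: continuous_mulmx; [exact: cX|exact: contA's].
have [|Z [Z0 ZD]] := antiderivative_mx (a := -1) cV; first by lra.
exists Z; split => // s s01; have := ZD s; rewrite clamp_id//; apply.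
by move: s01; rewrite in_itv/= => /andP[]; lra.
Qed.

(** It suffices to expand X(t) Y(t0) as 1 + (t - t0) Z up to o(t - t0) and to multiply by X(t0) on
    the right. *)
Lemma fundamental_derivable (t0 : R) (Z : R -> 'M[R]_n) : `|t0| < e ->
  Z 0 = 0 -> (forall s : R, s \in `[0, 1] -> is_derive s (1 : R) Z (V t0 s)) ->
  is_derive t0 (1 : R) (X ^~ 1) (Z 1 *m X t0 1).
Proof.
move=> t0e Z0 ZD; apply: is_derive_nrmP => eps eps0.
have [K K0 KP] := lipX t0e.
(* The parenthesis bounds W' up to the factor d |t - t0|, the next B pays for the multiplication by
   [X t0 1], and 1 makes C positive. *)
pose C := (K * K * B + B * B) * B + 1.
have c0 : 0 <= K * K * B + B * B by apply: addr_ge0; rewrite !mulr_ge0.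
have C0 : 0 < C by rewrite /C ltr_wpDl// mulr_ge0 ?B0.
pose d := eps / C.
have d0 : 0 < d by rewrite divr_gt0.
near=> t.
have te : `|t| < e by near: t; exact: near_lt.
have td : `|t - t0| <= d.
  by near: t; apply/nbhs_ballP; exists d => //= r /ltW; rewrite distrC.
have lipt : forall s : R, s \in `[0, 1] -> nrm (A t s - A t0 s) <= K * `|t - t0| /\
  nrm (X t s - X t0 s) <= K * `|t - t0| /\ nrm (Y t s - Y t0 s) <= K * `|t - t0|.
  by near: t.
have expt : forall s : R, s \in `[0, 1] ->
  nrm (A t s - A t0 s - (t - t0) *: A' t0 s) <= d * `|t - t0|.
  by near: t; exact: expandA.
(* W starts at 1, and in W' the terms of first order in t - t0 cancel: what remains is a product of
   two Lipschitz increments and the Taylor remainder of A. *)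
pose W s := X t s *m Y t0 s - (t - t0) *: Z s.
pose W' s := (X t s - X t0 s) *m (A t s - A t0 s) *m Y t0 s +
  X t0 s *m (A t s - A t0 s - (t - t0) *: A' t0 s) *m Y t0 s.
have WD (s : R) : s \in `[0, 1] -> is_derive s (1 : R) W (W' s).
  move=> s01.
  have h1 := is_derive_mulmx (fundX (fundA te) (itv01 s01)) (fundY (fundA t0e) (itv01 s01)).
  have h2 := is_deriveZ (t - t0) (ZD s s01).
  have := is_deriveB h1 h2.
  rewrite (_ : _ - _ *: V t0 s = W' s) //.
  rewrite /W' /V !(mulmxBl, mulmxBr) -!scalemxAr -!scalemxAl mulNmx mulmxN !mulmxA.
  by apply/matrixP => i j; rewrite !mxE; ring.
have WK (s : R) : s \in `[0, 1] -> nrm (W' s) <= (K * K * B + B * B) * d * `|t - t0|.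
  move=> s01; have [hA [hX _]] := lipt s s01; have hE := expt s s01.
  apply: le_trans (nrmD _ _) _; rewrite mulrDl [leRHS]mulrDl.
  apply: lerD.
    apply: (@le_trans _ _ ((K * `|t - t0|) * (K * `|t - t0|) * B)).
      apply: le_trans (nrmM _ _) _.
      apply: ler_pM; rewrite ?nrm_ge0//; last exact: (fundYb (fundA t0e)).
      apply: le_trans (nrmM _ _) _.
      by apply: ler_pM; rewrite ?nrm_ge0.
    rewrite (_ : _ * B = K * K * B * `|t - t0| * `|t - t0|); last by ring.
    by rewrite ler_wpM2r// ler_wpM2l// !mulr_ge0.
  apply: (@le_trans _ _ (B * (d * `|t - t0|) * B)); last first.
    by rewrite le_eqVlt; apply/orP; left; apply/eqP; ring.
  apply: le_trans (nrmM _ _) _.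
  apply: ler_pM; rewrite ?nrm_ge0//; last exact: (fundYb (fundA t0e)).
  apply: le_trans (nrmM _ _) _.
  by apply: ler_pM; rewrite ?nrm_ge0//; exact: (fundXb (fundA t0e)).
have WK0 : 0 <= (K * K * B + B * B) * d * `|t - t0|.
  by rewrite mulr_ge0// mulr_ge0// ltW.
have := nrm_mean_value_bound ler01 WK0 WD WK.
rewrite {2}/W (fundX0 (fundA te)) (fundY0 (fundA t0e)) mulmx1 Z0 scaler0 !subr0 mulr1 => W1.
have -> : X t 1 - X t0 1 - (t - t0) *: (Z 1 *m X t0 1) = (W 1 - 1%:M) *m X t0 1.
  rewrite /W !mulmxBl -mulmxA (mulmx1C (fundXY (fundA t0e) in01)) mulmx1 mul1mx.
  by rewrite scalemxAl; apply/matrixP => i j; rewrite !mxE; ring.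
apply: le_trans (nrmM _ _) _.
apply: (@le_trans _ _ ((K * K * B + B * B) * d * `|t - t0| * B)).
  by apply: ler_pM; rewrite ?nrm_ge0//; exact: (fundXb (fundA t0e)).
rewrite (_ : (K * K * B + B * B) * d * `|t - t0| * B =
  ((K * K * B + B * B) * B * d) * `|t - t0|); last by ring.
rewrite ler_wpM2r// /d mulrA ler_pdivrMr// mulrC ler_wpM2l// ?ltW// /C.
by rewrite ltrDl.
Unshelve. all: by end_near. Qed.

Lemma variation_continuous (t0 : R) (Z : R -> R -> 'M[R]_n) : `|t0| < e ->
  (forall t : R, `|t| < e -> Z t 0 = 0 /\
    forall s : R, s \in `[0, 1] -> is_derive s (1 : R) (Z t) (V t s)) ->
  {for t0, continuous (fun t => Z t 1 *m X t 1)}.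
Proof.
move=> t0e ZP.
have [K K0 KP] := lipX t0e.
have [a a0 aP] := nrm_bounded_itv (fun s h => contA's t0e h).
have cX : {for t0, continuous (X ^~ 1)}.
  have [Z0 ZD] := ZP _ t0e.
  exact: is_derive_continuous (fundamental_derivable t0e Z0 ZD).
apply: continuous_mulmx; last exact: cX.
apply/nrm_cvg => eps eps0.
pose C := K * (a + 1) * B + B * B + B * a * K + 1.
have c0 : 0 <= K * (a + 1) * B + B * B + B * a * K.
  have a1 : 0 <= a + 1 by rewrite addr_ge0.
  by do 2?apply: addr_ge0; rewrite !mulr_ge0.
have C0 : 0 < C by rewrite /C ltr_wpDl.
(* The minimum with 1 is what bounds [A' t s] by a + 1. *)
pose d := Num.min 1 (eps / C).
have d0 : 0 < d by rewrite lt_min ltr01 divr_gt0.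
near=> t.
have te : `|t| < e by near: t; exact: near_lt.
have td : `|t - t0| <= d.
  by near: t; apply/nbhs_ballP; exists d => //= r /ltW; rewrite distrC.
have lipt : forall s : R, s \in `[0, 1] -> nrm (A t s - A t0 s) <= K * `|t - t0| /\
  nrm (X t s - X t0 s) <= K * `|t - t0| /\ nrm (Y t s - Y t0 s) <= K * `|t - t0|.
  by near: t.
have A't : forall s : R, s \in `[0, 1] -> nrm (A' t s - A' t0 s) <= d.
  by near: t; exact: (tube (fun s h => contA' t0e h)).
pose W s := Z t s - Z t0 s.
have WD (s : R) : s \in `[0, 1] -> is_derive s (1 : R) W (V t s - V t0 s).
  move=> s01; apply: is_deriveB; first exact: (ZP _ te).2.
  exact: (ZP _ t0e).2.
have WK (s : R) : s \in `[0, 1] -> nrm (V t s - V t0 s) <= (C - 1) * d.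
  move=> s01; have [_ [hX hY]] := lipt s s01; have hA := A't s s01.
  have hA0 := aP s s01.
  have Xd : nrm (X t s - X t0 s) <= K * d by apply: le_trans hX _; exact: ler_wpM2l.
  have Yd : nrm (Y t s - Y t0 s) <= K * d by apply: le_trans hY _; exact: ler_wpM2l.
  have d1 : d <= 1 by rewrite /d ge_min lexx.
  have hA1 : nrm (A' t s) <= a + 1.
    rewrite -[A' t s](subrK (A' t0 s)) addrC.
    by apply: le_trans (nrmD _ _) _; apply: lerD => //; exact: le_trans d1.
  have -> : V t s - V t0 s = (X t s - X t0 s) *m A' t s *m Y t s +
      X t0 s *m (A' t s - A' t0 s) *m Y t s + X t0 s *m A' t0 s *m (Y t s - Y t0 s).
    rewrite /V !(mulmxBl, mulmxBr).
    by apply/matrixP => i j; rewrite !mxE; ring.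
  have bX r s' := fundXb (fundA (t := r) _) s'.
  have bX0 : nrm (X t0 s) <= B := fundXb (fundA t0e) s.
  have bY : nrm (Y t s) <= B := fundYb (fundA te) s.
  apply: (@le_trans _ _ (K * d * (a + 1) * B + B * d * B + B * a * (K * d))).
    do !(apply: le_trans (nrmD _ _) _; apply: lerD).
    - apply: le_trans (nrmM _ _) _; apply: ler_pM; rewrite ?nrm_ge0//.
      by apply: le_trans (nrmM _ _) _; apply: ler_pM; rewrite ?nrm_ge0.
    - apply: le_trans (nrmM _ _) _; apply: ler_pM; rewrite ?nrm_ge0//.
      by apply: le_trans (nrmM _ _) _; apply: ler_pM; rewrite ?nrm_ge0.
    - apply: le_trans (nrmM _ _) _; apply: ler_pM; rewrite ?nrm_ge0//.
      by apply: le_trans (nrmM _ _) _; apply: ler_pM; rewrite ?nrm_ge0.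
  by rewrite le_eqVlt; apply/orP; left; apply/eqP; rewrite /C; ring.
have WK0 : 0 <= (C - 1) * d.
  by rewrite mulr_ge0 ?(ltW d0)// /C addrK.
have := nrm_mean_value_bound ler01 WK0 WD WK.
rewrite {2}/W (ZP _ te).1 (ZP _ t0e).1 !subr0 mulr1 => /le_trans; apply.
apply: (@le_trans _ _ (C * (eps / C))); last by rewrite mulrCA divff ?mulr1// gt_eqF.
apply: ler_pM => //; first by rewrite /C addrK.
- exact: ltW.
- by rewrite gerDl lerN10.
- by rewrite /d ge_min lexx orbT.
Unshelve. all: by end_near. Qed.

(** Continuity of F' is needed for the C^1 curves in [lie_algebra]; the antiderivative Z is exported
    because the velocity of a holonomy is later compared with an integral of curvature through Z. *)
Theorem fundamental_param_C1 : exists F' : R -> 'M[R]_n, forall t : R, `|t| < e ->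
  [/\ is_derive t (1 : R) (X ^~ 1) (F' t), {for t, continuous F'} &
   exists Z : R -> 'M[R]_n, [/\ Z 0 = 0,
     forall s : R, s \in `[0, 1] ->
       is_derive s (1 : R) Z (X t s *m A' t s *m Y t s) &
     F' t = Z 1 *m X t 1]].
Proof.
have /choice[Z ZP] : forall t : R, exists Z : R -> 'M[R]_n, `|t| < e -> Z 0 = 0 /\
    forall s : R, s \in `[0, 1] -> is_derive s (1 : R) Z (V t s).
  move=> t; have [te|te] := boolP (`|t| < e); last by exists (fun=> 0).
  by have [Z ZP] := variation_antiderivative te; exists Z.
exists (fun t => Z t 1 *m X t 1) => t te; have [Z0 ZD] := ZP t te; split.
- exact: fundamental_derivable.
- exact: variation_continuous.
- by exists (Z t).
Qed.

End ParameterDependence.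

(** * Functions of class C^k *)

Section DifferentialCalculus.
Context {R : realType}.

Lemma near_eq_differentiable {E F : normedModType R} (f g : E -> F) x :
  (\near x, f x = g x) -> differentiable f x -> differentiable g x.
Proof.
move=> fg /[dup] dfx /diff_locallyP[cdf fE].
have gE : g \o shift x = cst (g x) + 'd f x +o_ 0 id.
  apply/eqaddoP => e e0; move/eqaddoP : fE => /(_ _ e0) fE.
  have fg0 : \forall h \near (0 : E), f (h + x) = g (h + x).
    by move: fg; rewrite (near_shift (0 : E)); apply: filterS => h /=; rewrite subr0.
  apply: filterS2 fE fg0 => h; rewrite !fctE /= => + fgh.
  by rewrite -fgh -(nbhs_singleton fg).
have dg := @diff_unique _ _ _ _ ('d f x) x cdf gE.
by apply/diff_locallyP; rewrite dg.
Qed.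

Lemma open_near {T : topologicalType} (U : set T) x (P : T -> Prop) :
  open U -> U x -> (forall y, U y -> P y) -> \near x, P x.
Proof. by move=> oU Ux UP; apply: filterS UP _; exact: open_nbhs_nbhs. Qed.

Lemma near_eq_continuous {T U : topologicalType} (f g : T -> U) x :
  (\near x, f x = g x) -> {for x, continuous f} -> {for x, continuous g}.
Proof.
move=> fg cf; rewrite /prop_for /continuous_at -(nbhs_singleton fg).
by apply: cvg_trans cf; exact: near_eq_cvg.
Qed.

Lemma is_derive_line {E F : normedModType R} (f : E -> F) (x w : E) (t : R) D :
  is_derive (x + t *: w) w f D ->
  is_derive t (1 : R) (fun r => f (x + r *: w)) D.
Proof.
move=> [fd fD].
have qE : (fun h : R => h^-1 *: (f (x + (h *: (1 : R) + t) *: w) - f (x + t *: w))) =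
    (fun h : R => h^-1 *: (f (h *: w + (x + t *: w)) - f (x + t *: w))).
  by apply/funext => h; rewrite [_%:A]mulr1 scalerDl addrCA.
apply: DeriveDef; first by rewrite /derivable /= qE.
by rewrite /derive /= qE.
Qed.

Lemma derive_scale_dir {F : normedModType R} (f : R -> F) (a t : R) D :
  is_derive t (1 : R) f D -> is_derive t a f (a *: D).
Proof.
move=> [/derivable1_diffP fd <-]; apply: DeriveDef.
  exact: diff_derivable.
by rewrite !deriveE// -linearZ/= [_%:A]mulr1.
Qed.

Lemma is_derive_reparam {F : normedModType R} (f : R -> F) (p a t : R) D :
  is_derive (p + t * a) (1 : R) f D ->
  is_derive t (1 : R) (fun r => f (p + r * a)) (a *: D).
Proof. by move=> fD; apply: is_derive_line; exact: derive_scale_dir. Qed.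

Section CkTheory.
Context {E F : normedModType R}.
Implicit Types (f g : E -> F) (U V : set E).

Lemma Ck_sub k U V f : U `<=` V -> Ck k V f -> Ck k U f.
Proof.
elim: k f => /= [|k IH] f UV; first by move=> H x /UV/H.
by move=> [fd fD]; split=> [x /UV/fd//|v]; apply: IH.
Qed.

Lemma Ck_eq k U f g : open U -> (forall x, U x -> f x = g x) ->
  Ck k U f -> Ck k U g.
Proof.
move=> oU; elim: k f g => /= [|k IH] f g fg.
  by move=> cf x Ux; apply: near_eq_continuous (cf x Ux); exact: open_near oU Ux fg.
move=> [fd fD]; split=> [x Ux|v].
  by apply: near_eq_differentiable (fd x Ux); exact: open_near oU Ux fg.
apply: IH (fD v) => x Ux.
by apply: near_eq_derive; exact: open_near oU Ux fg.
Qed.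

Lemma Ck_continuous k U f x : Ck k U f -> U x -> {for x, continuous f}.
Proof.
case: k => [|k] /=; first exact.
by move=> [fd _] /fd; exact: differentiable_continuous.
Qed.

Lemma Ck_add k U f g : open U -> Ck k U f -> Ck k U g ->
  Ck k U (fun x => f x + g x).
Proof.
move=> oU; elim: k f g => /= [|k IH] f g.
  by move=> cf cg x Ux; apply: cvgD; [exact: cf|exact: cg].
move=> [fd fD] [gd gD]; split=> [x Ux|v].
  by apply: differentiableD; [exact: fd|exact: gd].
apply: (@Ck_eq k _ (fun x => 'D_v f x + 'D_v g x)) => [//|x Ux|]; last exact: IH.
apply/esym/deriveD; apply: diff_derivable; [exact: fd|exact: gd].
Qed.

Lemma Ck_sum {I : Type} (r : seq I) k U (f : I -> E -> F) : open U ->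
  (forall i, Ck k U (f i)) -> Ck k U (fun x => \sum_(i <- r) f i x).
Proof.
move=> oU fk; elim: r => [|i r IH].
  apply: (@Ck_eq k _ (fun x => 0)) => [//|x Ux|]; first by rewrite big_nil.
  elim: k {f fk} => /= [|k IH]; first by move=> x _; exact: cvg_cst.
  split=> [x _|v]; first exact: differentiable_cst.
  by apply: (@Ck_eq k _ (fun x => 0)) => [//|x Ux|//]; rewrite derive_cst.
apply: (@Ck_eq k _ (fun x => f i x + \sum_(i <- r) f i x)) => [//|x Ux|].
  by rewrite big_cons.
exact: Ck_add.
Qed.

End CkTheory.

Lemma Ck_linear_comp {E F G : normedModType R} (L : {linear F -> G}) k (U : set E)
    (f : E -> F) :
  open U -> continuous L -> Ck k U f -> Ck k U (fun x => L (f x)).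
Proof.
move=> oU cL; elim: k f => /= [|k IH] f.
  by move=> cf x Ux; apply: continuous_comp; [exact: cf|exact: cL].
move=> [fd fD].
have dL y : differentiable L y by exact: linear_differentiable.
split=> [x Ux|v]; first by apply: differentiable_comp => //; exact: fd.
apply: (@Ck_eq E G k _ (fun x => L ('D_v f x))) => [//|x Ux|]; last exact: IH.
have := fd x Ux => fdx.
rewrite [RHS](@deriveE _ _ _ (L \o f)); last exact: differentiable_comp.
by rewrite diff_comp//= diff_lin// deriveE.
Qed.

Lemma Ck_scale {E F : normedModType R} k (U : set E) (f : E -> F) (c : R) :
  open U -> Ck k U f -> Ck k U (fun x => c *: f x).
Proof.
by move=> oU; apply: (Ck_linear_comp (L := *:%R c)) => // x; exact: scaler_continuous.
Qed.


Lemma line_continuous {E : normedModType R} (x w : E) :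
  continuous (fun t : R => x + t *: w).
Proof.
by move=> t; apply: cvgD; [exact: cvg_cst|apply: cvgZr_tmp; exact: cvg_id].
Qed.

Lemma Ck_line {E F : normedModType R} (f : E -> F) k (U : set E) (x w : E) :
  open U -> Ck k U f ->
  Ck k ((fun t : R => x + t *: w) @^-1` U) (fun t : R => f (x + t *: w)).
Proof.
move=> oU.
have oV : open ((fun t : R => x + t *: w) @^-1` U).
  by apply: open_comp => // t _; exact: line_continuous.
elim: k f => /= [|k IH] f.
  move=> cf t Ut; apply: (@continuous_comp _ _ _ (fun t : R => x + t *: w)).
    exact: line_continuous.
  exact: cf.
move=> [fd fD].
have D t : U (x + t *: w) ->
    is_derive t (1 : R) (fun t => f (x + t *: w)) ('D_w f (x + t *: w)).
  move=> Ut; apply: is_derive_line; apply: DeriveDef => //.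
  exact/diff_derivable/fd.
split=> [t Ut|h]; first by apply/derivable1_diffP; have [] := D t Ut.
apply: (@Ck_eq R F k _ (fun t => h *: 'D_w f (x + t *: w))) => [//|t Ut|].
  by have [_ <-] := derive_scale_dir h (D t Ut).
by apply: Ck_scale => //; exact: (IH _ (fD w)).
Qed.

Lemma linear_mx_continuous m n p q (L : {linear 'M[R]_(m, n) -> 'M[R]_(p, q)}) :
  continuous L.
Proof.
move=> M; apply/(@cvg_mxP R _ (nbhs M) (nbhs_filter M)) => i j.
have LE (N : 'M[R]_(m, n)) :
    L N i j = \sum_kl N kl.1 kl.2 * L (delta_mx kl.1 kl.2) i j.
  rewrite {1}[N]matrix_sum_delta pair_bigA linear_sum summxE.
  by apply: eq_bigr => -[k l] _; rewrite linearZ mxE.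
under eq_fun do rewrite LE.
rewrite LE.
pose S r (N : 'M[R]_(m, n)) := \sum_(kl <- r) N kl.1 kl.2 * L (delta_mx kl.1 kl.2) i j.
suff H r : S r @ M --> S r M by exact: H.
elim: r => [|k r IH].
  have -> : S [::] = cst 0 by apply/funext => N; rewrite /S big_nil.
  by apply: cst_continuous.
rewrite /S big_cons; under eq_fun do rewrite big_cons.
by apply: cvgD IH; apply: cvgM; [exact: coord_continuous|exact: cvg_cst].
Qed.

Lemma is_derive_linear_comp {V : normedModType R} m n p q
    (L : {linear 'M[R]_(m, n) -> 'M[R]_(p, q)}) (f : V -> 'M[R]_(m, n)) x v D :
  is_derive x v f D -> is_derive x v (fun y => L (f y)) (L D).
Proof.
move=> [fd fD].
have qE : (fun h : R => h^-1 *: (L (f (h *: v + x)) - L (f x))) =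
    L \o (fun h : R => h^-1 *: (f (h *: v + x) - f x)).
  by apply/funext => h /=; rewrite -linearB -linearZZ.
have cL := @linear_mx_continuous _ _ _ _ L.
have H : (fun h : R => h^-1 *: (L (f (h *: v + x)) - L (f x))) @ 0^' --> L D.
  rewrite qE; apply: (@cvg_comp _ _ _ _ L _ (nbhs D)); last exact: cL.
  by rewrite -fD; exact: fd.
apply: DeriveDef; first by apply/cvg_ex; exists (L D).
exact: cvg_lim.
Qed.

(* Both mixed derivatives are limits of the same second difference quotient. *)
Lemma second_difference {E : normedModType R} (f : E -> R) (U : set E) (x u v : E)
    (h : R) : 0 < h ->
  (forall y, U y -> derivable f y u) ->
  (forall y, U y -> derivable ('D_u f) y v) ->
  (forall a b : R, 0 <= a <= h -> 0 <= b <= h -> U (x + a *: u + b *: v)) ->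
  exists a b : R, [/\ 0 <= a <= h, 0 <= b <= h &
    f (x + h *: u + h *: v) - f (x + h *: u) - f (x + h *: v) + f x =
    h * h * 'D_v ('D_u f) (x + a *: u + b *: v)].
Proof.
move=> h0 fu fuv Uh.
have h0' : 0 <= h by exact: ltW.
have hh : 0 <= h <= h by rewrite h0' lexx.
have z0 : 0 <= (0 : R) <= h by rewrite lexx h0'.
pose g (s : R) := f (x + h *: v + s *: u) - f (x + s *: u).
pose dg s := 'D_u f (x + h *: v + s *: u) - 'D_u f (x + s *: u).
have gD s : s \in `[0, h] -> is_derive s (1 : R) g (dg s).
  rewrite in_itv/= => s0h; apply: is_deriveB; apply: is_derive_line.
    apply: DeriveDef => //; apply: fu; rewrite addrAC; exact: Uh.
  apply: DeriveDef => //; apply: fu.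
  by have := Uh s 0 s0h z0; rewrite scale0r addr0.
have [|a] := @MVT_segment R g dg 0 h h0' (fun s sh => gD s (subset_itv_oo_cc sh)).
  by apply: derivable_within_continuous => s /gD[].
rewrite in_itv/= => a0h gE.
pose k (s : R) := 'D_u f (x + a *: u + s *: v).
have kD s : s \in `[0, h] -> is_derive s (1 : R) k ('D_v ('D_u f) (x + a *: u + s *: v)).
  rewrite in_itv/= => s0h; apply: (@is_derive_line _ _ ('D_u f) (x + a *: u) v s).
  by apply: DeriveDef => //; apply: fuv; exact: Uh.
have [|b] := @MVT_segment R k _ 0 h h0' (fun s sh => kD s (subset_itv_oo_cc sh)).
  by apply: derivable_within_continuous => s /kD[].
rewrite in_itv/= => b0h kE.
exists a, b; split => //.
move: gE kE; rewrite /g /dg /k !scale0r !addr0 !subr0 => gE kE.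
rewrite -mulrA (mulrC h (_ * _)) (mulrC h) -kE.
rewrite (addrAC x (a *: u)) -gE (addrAC x (h *: v)); ring.
Qed.

(** For Schwarz's theorem: the two orders of differentiation yield intermediate points y and z that
    differ, but both tend to x. *)
Lemma eq_at_limit {E : normedModType R} (P Q : E -> R) (x : E) :
  {for x, continuous P} -> {for x, continuous Q} ->
  (forall r : R, 0 < r -> exists y z, [/\ ball x r y, ball x r z & P y = Q z]) ->
  P x = Q x.
Proof.
move=> cP cQ PQ.
apply/eqP; rewrite -subr_eq0 -normr_le0; apply/ler_addgt0Pr => e e0; rewrite add0r.
have e2 : 0 < e / 2 by lra.
move/cvgrPdist_le : cP => /(_ _ e2)/nbhs_ballP[r1 /= r10 r1P].
move/cvgrPdist_le : cQ => /(_ _ e2)/nbhs_ballP[r2 /= r20 r2P].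
have r0 : 0 < Num.min r1 r2 by rewrite lt_min r10.
have [y [z [xy xz PyQz]]] := PQ _ r0.
have Hy : `|P x - P y| <= e / 2.
  by apply: r1P; apply: le_ball xy; rewrite ge_min lexx.
have Hz : `|Q x - Q z| <= e / 2.
  by apply: r2P; apply: le_ball xz; rewrite ge_min lexx orbT.
move: Hy Hz; rewrite PyQz !ler_norml => /andP[? ?] /andP[? ?].
by apply/andP; split; lra.
Qed.

Lemma Schwarz_real {E : normedModType R} (f : E -> R) (U : set E) (x u v : E) :
  open U -> U x ->
  (forall y, U y -> derivable f y u) -> (forall y, U y -> derivable f y v) ->
  (forall y, U y -> derivable ('D_u f) y v) ->
  (forall y, U y -> derivable ('D_v f) y u) ->
  {for x, continuous ('D_v ('D_u f))} -> {for x, continuous ('D_u ('D_v f))} ->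
  'D_v ('D_u f) x = 'D_u ('D_v f) x.
Proof.
move=> oU Ux fu fv fuv fvu c1 c2; apply: eq_at_limit c1 c2 _ => e e0.
have /nbhs_ballP[r' /= r'0 r'P] : nbhs x U by exact: open_nbhs_nbhs.
pose r := Num.min e r'.
have r0 : 0 < r by rewrite lt_min e0.
have rP : ball x r `<=` U.
  by apply: subset_trans r'P; apply: le_ball; rewrite ge_min lexx orbT.
have re : ball x r `<=` ball x e by apply: le_ball; rewrite ge_min lexx.
(* The parallelogram with sides h u and h v must fit into the ball; the 1 covers u = v = 0. *)
pose h := r / (2 * (`|u| + `|v| + 1)).
have K0 : 0 < 2 * (`|u| + `|v| + 1) by have := normr_ge0 u; have := normr_ge0 v; lra.
have h0 : 0 < h by rewrite divr_gt0.
have hr : h * (`|u| + `|v|) < r.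
  rewrite /h mulrAC ltr_pdivrMr// ltr_pM2l//.
  by have := normr_ge0 u; have := normr_ge0 v; lra.
have inball (a b : R) : 0 <= a <= h -> 0 <= b <= h -> ball x r (x + a *: u + b *: v).
  move=> /andP[a0 ah] /andP[b0 bh]; rewrite -ball_normE /ball_/=.
  rewrite -addrA opprD addrA subrr add0r normrN.
  apply: le_lt_trans (ler_normD _ _) _; rewrite !normrZ !ger0_norm//.
  by apply: le_lt_trans hr; rewrite mulrDr lerD// ler_wpM2r.
have [a [b [ah bh abE]]] := second_difference h0 fu fuv
  (fun a b ha hb => rP _ (inball a b ha hb)).
have inball' (c d : R) : 0 <= c <= h -> 0 <= d <= h -> ball x r (x + c *: v + d *: u).
  by move=> ha hb; rewrite addrAC; exact: inball.
have [c [d [ch dh cdE]]] := second_difference h0 fv fvu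
  (fun a b ha hb => rP _ (inball' a b ha hb)).
exists (x + a *: u + b *: v), (x + c *: v + d *: u).
split; [exact/re/inball|exact/re/inball'|].
apply: (@mulfI _ (h * h)); first by rewrite mulf_neq0 ?gt_eqF.
apply: etrans (esym abE) (etrans _ cdE).
by rewrite (addrAC x (h *: v)) (addrAC (f _) (- f (x + h *: u))).
Qed.

Lemma Schwarz {E : normedModType R} m n (f : E -> 'M[R]_(m, n)) (U : set E) (x u v : E) :
  open U -> U x -> Ck 2 U f -> 'D_v ('D_u f) x = 'D_u ('D_v f) x.
Proof.
move=> oU Ux [fd f2].
have D1 y w : U y -> is_derive y w f ('D_w f y).
  by move=> Uy; apply: DeriveDef => //; exact/diff_derivable/fd.
have D2 y w z : U y -> is_derive y z ('D_w f) ('D_z ('D_w f) y).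
  by move=> Uy; apply: DeriveDef => //; apply: diff_derivable; apply: (f2 w).1.
have cD w z : {for x, continuous ('D_z ('D_w f))} by exact: ((f2 w).2 z x Ux).
apply/matrixP => i j.
pose g y := f y i j.
have gD y w : U y -> derivable g y w.
  by move=> /(D1 y w)/is_derive_mxP/(_ i j)[].
have gE y w : U y -> 'D_w g y = 'D_w f y i j.
  by move=> /(D1 y w)/is_derive_mxP/(_ i j)[].
have D2g y w z : U y -> is_derive y z ('D_w g) ('D_z ('D_w f) y i j).
  move=> Uy; have /is_derive_mxP/(_ i j) := D2 y w z Uy.
  by apply: near_eq_is_derive; apply: (open_near oU Uy) => p Up; rewrite gE.
have D2E w z : 'D_z ('D_w g) x = 'D_z ('D_w f) x i j.
  by have [] := D2g x w z Ux.
have cg w z : {for x, continuous ('D_z ('D_w g))}.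
  have cDij : {for x, continuous (fun y => 'D_z ('D_w f) y i j)}.
    by have /cvg_mxP/(_ i j) := cD w z; exact.
  apply: near_eq_continuous cDij; apply: (open_near oU Ux) => y Uy.
  by have [_ ->] := D2g y w z Uy.
have dD w z y (Uy : U y) : derivable ('D_w g) y z by have [] := D2g y w z Uy.
have E1 := Schwarz_real oU Ux (fun y => gD y u) (fun y => gD y v) (dD u v) (dD v u)
  (cg u v) (cg v u).
exact: etrans (esym (D2E u v)) (etrans E1 (D2E v u)).
Qed.

End DifferentialCalculus.

(** * Paths and homotopies *)

Section Pasting.

Lemma within_continuousP {X Y : topologicalType} (A : set X) (f : X -> Y) :
  {within A, continuous f} <->
  forall x, A x -> f @ within A (nbhs x) --> f x.
Proof.
by rewrite continuous_subspace_in; split=> H x; [move=> Ax|rewrite inE => Ax];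
  have := H x; rewrite ?inE => /(_ Ax); rewrite /continuous_at nbhs_subspace_in.
Qed.

Lemma continuous_within {X Y : topologicalType} (A : set X) (f : X -> Y) :
  (forall x, A x -> {for x, continuous f}) -> {within A, continuous f}.
Proof.
move=> cf; apply/within_continuousP => x Ax.
by apply: cvg_within_filter; exact: cf.
Qed.

Lemma within_continuous_comp {X Y Z : topologicalType} (A : set X) (B : set Y)
    (g : Y -> Z) (h : X -> Y) (f : X -> Z) :
  {within B, continuous g} -> (forall x, A x -> {for x, continuous h}) ->
  (forall x, A x -> B (h x)) -> (forall x, A x -> f x = g (h x)) ->
  {within A, continuous f}.
Proof.
move=> /within_continuousP cg ch AB fE; apply/within_continuousP => x Ax.
move=> U; rewrite fE// => Ugh.
have Hn : \forall y \near x, B (h y) -> U (g (h y)) :=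
  ch x Ax _ (cg _ (AB _ Ax) _ Ugh).
have : \forall y \near x, A y -> U (f y); last exact.
by apply: filterS Hn => y H Ay; rewrite fE//; apply: H; exact: AB.
Qed.

Lemma within_continuous_post {X Y Z : topologicalType} (A : set X) (f : X -> Y)
    (g : Y -> Z) :
  {within A, continuous f} -> (forall x, A x -> {for f x, continuous g}) ->
  {within A, continuous (g \o f)}.
Proof.
move=> /within_continuousP cf cg; apply/within_continuousP => x Ax.
exact: cvg_comp (cf x Ax) (cg x Ax).
Qed.

Lemma within_continuous_paste {X Y : topologicalType} (A K1 K2 : set X) (f : X -> Y) :
  closed K1 -> closed K2 -> A `<=` K1 `|` K2 ->
  {within A `&` K1, continuous f} -> {within A `&` K2, continuous f} ->
  {within A, continuous f}.
Proof.
move=> cK1 cK2 AK /within_continuousP c1 /within_continuousP c2.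
apply/within_continuousP => x Ax U Ufx.
have side (K : set X) : closed K ->
    (forall y, (A `&` K) y -> f @ within (A `&` K) (nbhs y) --> f y) ->
    \forall y \near x, A y -> K y -> U (f y).
  move=> cK H; have [Kx|nKx] := pselect (K x).
    have := H x (conj Ax Kx) U Ufx; rewrite /nbhs/= /within/=.
    by apply: filterS => y /= Uy Ay Ky; exact: Uy.
  have : nbhs x (~` K) by apply: open_nbhs_nbhs; split => //; exact: closed_openC.
  by apply: filterS => y nKy _ /nKy.
have FF : Filter (nbhs x) := nbhs_filter x.
have H := @filterI _ (nbhs x) FF _ _ (side _ cK1 c1) (side _ cK2 c2).
have : \forall y \near x, A y -> U (f y); last exact.
by apply: (@filterS _ _ FF _ _ _ H) => y [H1 H2] Ay; have [Ky|Ky] := AK _ Ay; [exact: H1|exact: H2].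
Qed.

End Pasting.

Section Concatenation.
Context {R : realType}.

Definition concat {T : Type} (c d : R -> T) (t : R) : T :=
  if t <= 2^-1 then c (2 * t) else d (2 * t - 1).

Lemma concat_le {T : Type} (c d : R -> T) t : t <= 2^-1 -> concat c d t = c (2 * t).
Proof. by rewrite /concat => ->. Qed.

Lemma concat_ge {T : Type} (c d : R -> T) t : c 1 = d 0 -> 2^-1 <= t ->
  concat c d t = d (2 * t - 1).
Proof.
move=> cd; rewrite /concat le_eqVlt => /predU1P[<-|t2]; last by rewrite leNgt t2.
by rewrite lexx divff ?subrr// pnatr_eq0.
Qed.

Lemma concat0 {T : Type} (c d : R -> T) : concat c d 0 = c 0.
Proof. by rewrite concat_le ?mulr0// invr_ge0. Qed.

Lemma concat1 {T : Type} (c d : R -> T) : concat c d 1 = d 1.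
Proof.
rewrite /concat leNgt (_ : 2^-1 < 1) /=; last by lra.
by congr d; ring.
Qed.

Lemma comp_concat {T U : Type} (f : T -> U) (c d : R -> T) :
  f \o concat c d = concat (f \o c) (f \o d).
Proof. by apply/funext => t; rewrite /concat /=; case: ifP. Qed.

Lemma affine_continuous (a b : R) : continuous (fun t : R => a * t + b).
Proof.
by move=> t; apply: cvgD; [apply: cvgM; [exact: cvg_cst|exact: cvg_id]|exact: cvg_cst].
Qed.

Lemma closed_ge_half : closed [set t : R | 2^-1 <= t].
Proof. exact: closed_ge. Qed.

Lemma closed_le_half : closed [set t : R | t <= 2^-1].
Proof. exact: closed_le. Qed.

(** Agreement at the joint is asked only on C, and the domains are arbitrary, because the lemma is
    also applied to coordinate fields along a curve, which are meaningful, and agree at the joint,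
    only while the curve is in the chart. *)
Lemma within_concat {T : topologicalType} (c d : R -> T) (A B C : set R) :
  (forall t, C t -> 2^-1 <= t -> concat c d t = d (2 * t - 1)) ->
  (forall t, C t -> t <= 2^-1 -> A (2 * t)) ->
  (forall t, C t -> 2^-1 <= t -> B (2 * t - 1)) ->
  {within A, continuous c} -> {within B, continuous d} ->
  {within C, continuous (concat c d)}.
Proof.
move=> cdE CA CB cc cd.
apply: (within_continuous_paste closed_le_half closed_ge_half).
- by move=> t _; have [?|/ltW ?] := leP t 2^-1; [left|right].
- apply: (@within_continuous_comp R R T _ A c (fun t : R => 2 * t + 0) _ cc).
  + by move=> t _; exact: affine_continuous.
  + by move=> t [Ct t2]; rewrite addr0; exact: CA.
  + by move=> t [Ct t2]; rewrite addr0 concat_le.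
- apply: (@within_continuous_comp R R T _ B d (fun t : R => 2 * t + (-1)) _ cd).
  + by move=> t _; exact: affine_continuous.
  + by move=> t [Ct t2]; exact: CB.
  + by move=> t [Ct t2]; exact: cdE.
Qed.

Lemma half_itvl (t : R) : t \in `[0, 1] -> t <= 2^-1 -> 2 * t \in `[0, 1].
Proof. by rewrite !in_itv/= => /andP[? ?] ?; apply/andP; split; lra. Qed.

Lemma half_itvr (t : R) : t \in `[0, 1] -> 2^-1 <= t -> 2 * t - 1 \in `[0, 1].
Proof. by rewrite !in_itv/= => /andP[? ?] ?; apply/andP; split; lra. Qed.

Lemma concat_continuous {T : topologicalType} (c d : R -> T) : c 1 = d 0 ->
  {within `[0, 1], continuous c} -> {within `[0, 1], continuous d} ->
  {within `[0, 1], continuous (concat c d)}.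
Proof.
move=> cd cc cd'; apply: (within_concat _ _ _ cc cd').
- by move=> t _; exact: concat_ge.
- by move=> t; exact: half_itvl.
- by move=> t; exact: half_itvr.
Qed.

End Concatenation.

Section Homotopy.
Context {R : realType} {n : nat} {M : manifold R n}.

Definition unit_square : set (R * R) := `[0, 1]%classic `*` `[0, 1]%classic.

(* Contracted in two steps: first the loop in the middle, then the path run forth and
   back. *)
Lemma null_homotopic_lasso (c l : R -> M) (c' : R -> M) :
  {within `[0, 1], continuous c} -> (forall t, t \in `[0, 1] -> c' t = c (1 - t)) ->
  l 0 = c 1 -> l 1 = c 1 ->
  null_homotopic (c 1) l ->
  null_homotopic (c 0) (concat c (concat l c')).
Proof.
move=> cc c'E l0 l1 [H [cH HP]].
have i01 : (1 : R) \in `[0, 1] by rewrite in_itv/= lexx ler01.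
have i00 : (0 : R) \in `[0, 1] by rewrite in_itv/= lexx ler01.
(* At stage s the path c is followed only up to parameter m s, which is 1 until s = 1/2 and then
   decreases to 0. K is the middle loop: H at double speed, then constant at c (m s). G has its
   breaks at 1/2 and 3/4, as [concat c (concat l c')] has. *)
pose m (s : R) := clamp 0 1 (2 - 2 * s).
pose K (s b : R) := if s <= 2^-1 then H (2 * s, b) else c (2 - 2 * s).
pose G (p : R * R) := if p.2 <= 2^-1 then c (2 * p.2 * m p.1)
  else if p.2 <= 3 / 4 then K p.1 (4 * p.2 - 2) else c ((4 - 4 * p.2) * m p.1).
have m01 s : m s \in `[0, 1] by exact: clamp_itv.
have m_le s : s <= 2^-1 -> m s = 1.
  by move=> s2; rewrite /m /clamp min_r ?max_l//; lra.
have m_ge s : s \in `[0, 1] -> 2^-1 <= s -> m s = 2 - 2 * s.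
  by rewrite in_itv/= => /andP[? ?] ?; rewrite /m clamp_id// in_itv/=; apply/andP; split; lra.
have mul01 (a b : R) : a \in `[0, 1] -> b \in `[0, 1] -> a * b \in `[0, 1].
  rewrite !in_itv/= => /andP[? ?] /andP[? ?]; apply/andP; split; first exact: mulr_ge0.
  exact: mulr_ile1.
have K_ge s b : s \in `[0, 1] -> b \in `[0, 1] -> 2^-1 <= s -> K s b = c (2 - 2 * s).
  move=> s01 b01; rewrite /K le_eqVlt => /predU1P[<-|s2]; last by rewrite leNgt s2.
  rewrite lexx divff ?pnatr_eq0//.
  by have [_ [-> _]] := HP _ b01; congr c; ring.
(* This is the matching of the three pieces of G at times 1/2 and 3/4. *)
have Kq s b : s \in `[0, 1] -> b = 0 \/ b = 1 -> K s b = c (m s).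
  move=> s01 b01; have [s2|/ltW s2] := leP s 2^-1; last first.
    by rewrite K_ge ?m_ge//; case: b01 => ->.
  rewrite m_le// /K s2.
  by have [_ [_ [h0 h1]]] := HP _ (half_itvl s01 s2); case: b01 => ->.
have cm : continuous m.
  move=> s; apply: (@continuous_comp _ _ _ (fun s : R => 2 - 2 * s) (clamp 0 1)).
    apply: cvgB; first exact: cvg_cst.
    by apply: cvgM; [exact: cvg_cst|exact: cvg_id].
  exact: clamp_continuous.
have cm1 (p : R * R) : {for p, continuous (fun p : R * R => m p.1)}.
  apply: (@continuous_comp _ _ _ (fst : R * R -> R) m); last exact: cm.
  exact: cvg_fst.
have c1 (p : R * R) : {for p, continuous (fun p : R * R => 2 * p.2 * m p.1)}.
  apply: cvgM; last exact: cm1.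
  by apply: cvgM; [exact: cvg_cst|exact: cvg_snd].
have c3 (p : R * R) : {for p, continuous (fun p : R * R => (4 - 4 * p.2) * m p.1)}.
  apply: cvgM; last exact: cm1.
  apply: cvgB; first exact: cvg_cst.
  by apply: cvgM; [exact: cvg_cst|exact: cvg_snd].
have c21 (p : R * R) : {for p, continuous (fun p : R * R => (2 * p.1, 4 * p.2 - 2))}.
  apply: (@cvg_pair _ _ _ (nbhs p) (nbhs (2 * p.1)) (nbhs (4 * p.2 - 2)) _ _ _
    (fun p : R * R => 2 * p.1) (fun p : R * R => 4 * p.2 - 2)).
    by apply: cvgM; [exact: cvg_cst|exact: cvg_fst].
  apply: cvgB; last exact: cvg_cst.
  by apply: cvgM; [exact: cvg_cst|exact: cvg_snd].
have c22 (p : R * R) : {for p, continuous (fun p : R * R => 2 - 2 * p.1)}.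
  apply: cvgB; first exact: cvg_cst.
  by apply: cvgM; [exact: cvg_cst|exact: cvg_fst].
have clo2 (a : R) : closed [set p : R * R | p.2 <= a].
  by apply: (@closed_comp _ _ snd [set x | x <= a]);
    [move=> ? _; exact: cvg_snd|exact: closed_le].
have clo2' (a : R) : closed [set p : R * R | a <= p.2].
  by apply: (@closed_comp _ _ snd [set x | a <= x]);
    [move=> ? _; exact: cvg_snd|exact: closed_ge].
have clo1 (a : R) : closed [set p : R * R | p.1 <= a].
  by apply: (@closed_comp _ _ fst [set x | x <= a]);
    [move=> ? _; exact: cvg_fst|exact: closed_le].
have clo1' (a : R) : closed [set p : R * R | a <= p.1].
  by apply: (@closed_comp _ _ fst [set x | a <= x]);
    [move=> ? _; exact: cvg_fst|exact: closed_ge].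
have cG : {within unit_square, continuous G}.
  apply: (within_continuous_paste (clo2 2^-1) (clo2' 2^-1)).
  - by move=> p _; have [?|/ltW ?] := leP p.2 2^-1; [left|right].
  - apply: (@within_continuous_comp _ _ _ _ _ c (fun p : R * R => 2 * p.2 * m p.1) _ cc).
    + by move=> p _; exact: c1.
    + move=> p [[p1 p2] p22]; apply: mul01 => //; exact: half_itvl.
    + by move=> p [_ /= p2]; rewrite /G p2.
  apply: (within_continuous_paste (clo2 (3 / 4)) (clo2' (3 / 4))).
  - by move=> p _; have [?|/ltW ?] := leP p.2 (3 / 4); [left|right].
  - have KG p : (unit_square `&` [set p | 2^-1 <= p.2] `&` [set p | p.2 <= 3 / 4]) p ->
        G p = K p.1 (4 * p.2 - 2).
      move=> [[[/= p1 p2] p22] p24]; rewrite /G; case: ifPn => p22'; last by rewrite p24.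
      have -> : p.2 = 2^-1 by apply/eqP; rewrite eq_le p22 p22'.
      by rewrite Kq//; [congr c; field|left; field].
    apply: (within_continuous_paste (clo1 2^-1) (clo1' 2^-1)).
    + by move=> p _; have [?|/ltW ?] := leP p.1 2^-1; [left|right].
    + apply: (@within_continuous_comp _ _ _ _ _ H
        (fun p : R * R => (2 * p.1, 4 * p.2 - 2)) _ cH).
      * by move=> p _; exact: c21.
      * move=> p [[[[/= p1 p2] p22] p24] p12]; split => /=; first exact: half_itvl.
        by rewrite /= in_itv/=; apply/andP; split; lra.
      * by move=> p [/KG -> /= p12]; rewrite /K p12.
    + apply: (@within_continuous_comp _ _ _ _ _ c (fun p : R * R => 2 - 2 * p.1) _ cc).
      * by move=> p _; exact: c22.
      * move=> p [[[[/= p1 p2] p22] p24] p12]; move: p1.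
        by rewrite /= !in_itv/= => /andP[? ?]; apply/andP; split; lra.
      * move=> p [Hp /= p12]; rewrite KG// K_ge//; case: Hp => -[[p1 p2] p22] p24//.
        by rewrite in_itv/=; apply/andP; split; move: p22 p24 => /=; lra.
  - apply: (@within_continuous_comp _ _ _ _ _ c (fun p : R * R => (4 - 4 * p.2) * m p.1) _ cc).
    + by move=> p _; exact: c3.
    + move=> p [[[/= p1 p2] p22] p24]; apply: mul01 => //; move: p2.
      by rewrite /= !in_itv/= => /andP[? ?]; apply/andP; split; lra.
    + move=> p [[[/= p1 p2] p22] p24]; rewrite /G ifN; last by rewrite -ltNge; lra.
      case: ifPn => // p24'.
      have -> : p.2 = 3 / 4 by apply/eqP; rewrite eq_le p24 p24'.
      by rewrite Kq//; [congr c; field|right; field].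
exists G; split => // t t01; split; [|split; [|split]].
- rewrite /G /concat /= m_le ?invr_ge0// !mulr1; case: ifPn => // t2.
  rewrite (_ : (2 * t - 1 <= 2^-1) = (t <= 3 / 4)); last by apply/idP/idP; lra.
  case: ifPn => t4.
    rewrite /K invr_ge0 ler0n mulr0.
    have b01 : 4 * t - 2 \in `[0, 1].
      by move: t2; rewrite -ltNge => t2; rewrite in_itv/=; apply/andP; split; lra.
    by have [-> _] := HP _ b01; congr l; ring.
  rewrite c'E; first by congr c; ring.
  move: t2 t4 t01; rewrite -!ltNge !in_itv/= => ? ? /andP[? ?].
  by apply/andP; split; lra.
- have m1 : m 1 = 0 by rewrite m_ge//; [ring|lra].
  rewrite /G /= m1 !mulr0; case: ifPn => // t2; case: ifPn => // t4.
  rewrite K_ge//; [by congr c; ring| |by lra].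
  by move: t2; rewrite -ltNge in_itv/= => ?; apply/andP; split; lra.
- by rewrite /G /= invr_ge0 ler0n mulr0 mul0r.
- rewrite /G /= ifN; last by rewrite -ltNge; lra.
  rewrite ifN; last by rewrite -ltNge; lra.
  by rewrite (_ : 4 - 4 * 1 = 0) ?mul0r//; ring.
Qed.

(** The straight-line contraction to x0 in coordinates; the last hypothesis keeps it inside the
    image of the chart. *)
Lemma null_homotopic_chart (i : mindex M) (k : R -> 'rV[R]_n) (x0 : 'rV[R]_n) (c : R -> M) :
  {within `[0, 1], continuous k} -> k 0 = x0 -> k 1 = x0 ->
  (forall t, t \in `[0, 1] -> c t = chartV M i (k t)) ->
  (forall s t, s \in `[0, 1] -> t \in `[0, 1] -> img M i (k t + s *: (x0 - k t))) ->
  null_homotopic (chartV M i x0) c.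
Proof.
move=> ck k0 k1 cE kimg.
pose h (p : R * R) := k p.2 + p.1 *: (x0 - k p.2).
have ck2 : {within unit_square, continuous (fun p : R * R => k p.2)}.
  apply: (@within_continuous_comp _ _ _ _ _ k (snd : R * R -> R) _ ck).
  - by move=> p _; exact: cvg_snd.
  - by move=> p [].
  - by [].
have ch : {within unit_square, continuous h}.
  apply/within_continuousP => p Sp; move/within_continuousP : ck2 => /(_ p Sp) kp.
  apply: cvgD => //; apply: cvgZ.
    by apply: cvg_within_filter; exact: cvg_fst.
  by apply: cvgB => //; exact: cvg_cst.
exists (chartV M i \o h); split.
  apply: within_continuous_post ch _ => p [p1 p2].
  by apply: chartV_continuous; exact: kimg.
move=> t t01; rewrite /h /= !scale0r !addr0 !scale1r !k0 !k1 subrr scaler0 addr0.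
by rewrite addrC subrK cE.
Qed.

End Homotopy.

(** * Parallel transport and holonomy *)

Lemma derive_comp {R : realType} {E F G : normedModType R} (f : E -> F) (g : F -> G) (x v : E) :
  differentiable f x -> differentiable g (f x) ->
  'D_v (g \o f) x = 'D_('D_v f x) g (f x).
Proof.
move=> df dg; rewrite !deriveE//; last exact: differentiable_comp.
by rewrite diff_comp.
Qed.

Section Charts.
Context {R : realType} {n : nat} {M : manifold R n}.
Implicit Types (i j k : mindex M) (x : 'rV[R]_n).

Definition overlap i j := chart M i @` (dom M i `&` dom M j).

Lemma img_dom i x : img M i x -> dom M i (chartV M i x).
Proof. by move=> [p ip <-]; rewrite chartK. Qed.

Lemma chartVK i x : img M i x -> chart M i (chartV M i x) = x.
Proof. by move=> [p ip <-]; rewrite chartK. Qed.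

Lemma chart_img i p : dom M i p -> img M i (chart M i p).
Proof. by move=> ip; exists p. Qed.

Lemma overlapP i j x : overlap i j x <-> img M i x /\ dom M j (chartV M i x).
Proof.
split=> [[p [ip jp] <-]|[ix jx]]; first by rewrite chartK//; split => //; exact: chart_img.
by exists (chartV M i x); [split => //; exact: img_dom|exact: chartVK].
Qed.

Lemma overlap_open i j : open (overlap i j).
Proof.
rewrite openE => x /overlapP[ix jx].
have H1 : nbhs x (img M i) by apply: open_nbhs_nbhs; split => //; exact: img_open.
have H2 : \forall y \near x, dom M j (chartV M i y).
  apply: (chartV_continuous ix); apply: open_nbhs_nbhs; split => //; exact: dom_open.
by apply: filterS2 H1 H2 => y ? ?; apply/overlapP.
Qed.

Arguments overlap_open : clear implicits.

Lemma trans_overlap i j k x : overlap i j x -> overlap i k x ->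
  overlap j k (trans M i j x) /\ trans M j k (trans M i j x) = trans M i k x.
Proof.
move=> /overlapP[ix jx] /overlapP[_ kx].
have E : chartV M j (trans M i j x) = chartV M i x by rewrite /trans/= chartK.
by split; [apply/overlapP; rewrite E; split => //; exact: chart_img|rewrite {1}/trans/= E].
Qed.

Lemma trans_differentiable i j x : overlap i j x -> differentiable (trans M i j) x.
Proof. by move=> ijx; have [+ _] := @trans_smooth R n M i j 1; exact. Qed.

Lemma derive_trans_comp i j k x (w : 'rV[R]_n) : overlap i j x -> overlap i k x ->
  'D_w (trans M i k) x = 'D_('D_w (trans M i j) x) (trans M j k) (trans M i j x).
Proof.
move=> ijx ikx; have [jkx _] := trans_overlap ijx ikx.
rewrite -derive_comp; [|exact: trans_differentiable..].
apply: near_eq_derive.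
have H1 : nbhs x (overlap i j) by apply: open_nbhs_nbhs; split => //; exact: overlap_open.
have H2 : nbhs x (overlap i k) by apply: open_nbhs_nbhs; split => //; exact: overlap_open.
by apply: filterS2 H1 H2 => y ijy iky /=; have [_ ->] := trans_overlap ijy iky.
Qed.

Lemma derive_trans_id i x (w : 'rV[R]_n) : img M i x -> 'D_w (trans M i i) x = w.
Proof.
move=> ix; rewrite -[RHS](derive_id x w); apply: near_eq_derive.
apply: (@open_near _ (img M i) x _ (@img_open _ _ M i) ix) => y iy.
by rewrite /trans/= chartVK.
Qed.

End Charts.

Section Jacobian.
Context {R : realType} {m n : nat}.
Implicit Types (f : 'rV[R]_m -> 'rV[R]_n) (x w z : 'rV[R]_m).

Definition jac f x : 'M[R]_(m, n) := \matrix_(k, l) 'D_(delta_mx 0 k) f x 0 l.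

Lemma mul_jac f x w : differentiable f x -> w *m jac f x = 'D_w f x.
Proof.
move=> df; apply/rowP => l; rewrite mxE deriveE//.
rewrite {2}[w]row_sum_delta linear_sum summxE.
by apply: eq_bigr => k _; rewrite !mxE deriveE// linearZ mxE.
Qed.

Definition jac2 f w x : 'M[R]_(m, n) := \matrix_(k, l) 'D_w ('D_(delta_mx 0 k) f) x 0 l.

Lemma is_derive_jac f (U : set 'rV[R]_m) x w : Ck 2 U f -> U x ->
  is_derive x w (jac f) (jac2 f w x).
Proof.
move=> [fd f2] Ux; apply/is_derive_mxP => k l.
under eq_fun do rewrite mxE; rewrite mxE.
have [f2d _] := f2 (delta_mx 0 k).
have : is_derive x w ('D_(delta_mx 0 k) f) ('D_w ('D_(delta_mx 0 k) f) x).
  by apply: DeriveDef => //; apply: diff_derivable; exact: f2d.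
by move/is_derive_mxP.
Qed.

Lemma mul_jac2 f (U : set 'rV[R]_m) x w z : open U -> Ck 2 U f -> U x ->
  z *m jac2 f w x = 'D_w ('D_z f) x.
Proof.
move=> oU f2 Ux.
have := is_derive_mulmx (is_derive_cst z x w) (is_derive_jac w f2 Ux).
rewrite mul0mx add0r => -[_ <-]; apply: near_eq_derive.
by apply: (open_near oU Ux) => y Uy; rewrite mul_jac//; exact: f2.1.
Qed.

End Jacobian.

Section SegmentTransport.
Context {R : realType} {n : nat} {M : manifold R n} (nabla : connection M).
Local Notation E := 'rV[R]_n.

(** The connection form in direction u, as a matrix acting on row vectors from the right. *)
Definition gamma_mx (i : mindex M) (x u : E) : 'M[R]_n :=
  \matrix_(k, l) gamma nabla i x u (delta_mx 0 k) 0 l.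

Lemma mul_gamma_mx i x u v : img M i x -> v *m gamma_mx i x u = gamma nabla i x u v.
Proof.
move=> ix.
pose lin := GRing.isLinear.Build _ _ _ _ _ (gamma_linear_r nabla ix u).
pose g : {linear E -> E} := HB.pack (gamma nabla i x u) lin.
apply/rowP => l; rewrite mxE -[gamma nabla i x u v]/(g v) {2}[v]row_sum_delta.
rewrite linear_sum summxE; apply: eq_bigr => k _.
by rewrite !mxE linearZ mxE.
Qed.

Lemma gamma_mx_linear i x : img M i x -> linear (gamma_mx i x).
Proof.
move=> ix a u v; apply/matrixP => k l; rewrite !mxE.
by rewrite (gamma_linear_l nabla ix (delta_mx 0 k)) !mxE.
Qed.

Lemma gamma_mxZ i x a u : img M i x -> gamma_mx i x (a *: u) = a *: gamma_mx i x u.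
Proof.
move=> ix.
pose g : {linear E -> 'M[R]_n} := HB.pack (gamma_mx i x)
  (GRing.isLinear.Build _ _ _ _ _ (gamma_mx_linear ix)).
by rewrite -[LHS]/(g _) linearZ.
Qed.

Lemma gamma_mxD i x u v : img M i x ->
  gamma_mx i x (u + v) = gamma_mx i x u + gamma_mx i x v.
Proof. by move=> ix; have := gamma_mx_linear ix 1 u v; rewrite !scale1r. Qed.

Lemma gamma_mxN i x u : img M i x -> gamma_mx i x (- u) = - gamma_mx i x u.
Proof. by move=> ix; rewrite -scaleN1r gamma_mxZ// scaleN1r. Qed.

Definition segment (i : mindex M) (y w : E) (t : R) : M := chartV M i (y + t *: w).

Lemma segment_continuous i y w (t : R) :
  img M i (y + t *: w) -> {for t, continuous (segment i y w)}.
Proof.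
move=> iy; apply: (@continuous_comp _ _ _ (fun t : R => y + t *: w)).
  exact: line_continuous.
exact: chartV_continuous.
Qed.

(** A single piece with margin 1 beyond both ends of [0, 1]; this is the origin of the interval ]-1,
    2[. *)
Lemma segment_piecewise_smooth i y w :
  (forall t : R, t \in `](-1), 2[ -> img M i (y + t *: w)) ->
  piecewise_smooth (segment i y w).
Proof.
move=> iyw; exists 1%N, (fun k => k%:R); split => //; split => // k.
rewrite ltnS leqn0 => /eqP ->; split; first exact: ltr01.
exists 1, (segment i y w); split; first exact: ltr01.
have E : `](0 - 1), (1 + 1)[ = `](-1), 2[ :> interval R by rewrite sub0r.
split => //; split=> [t|j].
  by rewrite E => /iyw; exact: segment_continuous.
move=> k'.
have := Ck_line y w (@overlap_open R n M i j) (@trans_smooth R n M i j k').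
apply: Ck_sub => t [/= t12 jt]; apply/overlapP; split => //.
by apply: iyw; rewrite -E.
Qed.

(* Row vectors are transported by right multiplication: [u X] is parallel when
   [X' = - X Gamma(w)]. *)
Definition segment_field i y w (X : R -> 'M[R]_n) (u : E) (j : mindex M) (t : R) : E :=
  'D_(u *m X t) (trans M i j) (y + t *: w).

(** The equation is given in chart i but required in every chart j. There the field is u X times the
    Jacobian of the transition; the second derivative that appears on differentiating is absorbed by
    [gamma_trans], leaving the equation of chart j. *)
Lemma segment_parallel i y w (X : R -> 'M[R]_n) u :
  (forall t : R, t \in `](-1), 2[ -> img M i (y + t *: w)) ->
  (forall t : R, t \in `](-1), 2[ ->
     is_derive t (1 : R) X (X t *m - gamma_mx i (y + t *: w) w)) ->
  parallel nabla (segment i y w) (segment_field i y w X u).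
Proof.
move=> iyw XD.
have i12 (t : R) : t \in `[0, 1] -> t \in `](-1), 2[.
  by rewrite !in_itv/= => /andP[? ?]; apply/andP; split; lra.
have vD j (t : R) : t \in `[0, 1] -> dom M j (segment i y w t) ->
    is_derive t (1 : R) (segment_field i y w X u j)
      (- gamma nabla j (chart M j (segment i y w t))
           ('D_1 (chart M j \o segment i y w) t) (segment_field i y w X u j t)).
  move=> t01 jt; set x := y + t *: w.
  have ix : img M i x by apply/iyw/i12.
  have ijx : overlap i j x by apply/overlapP.
  have oU := @overlap_open R n M i j.
  have s2 := @trans_smooth R n M i j 2.
  have dt : differentiable (trans M i j) x by exact: trans_differentiable.
  have lD : 'D_1 (chart M j \o segment i y w) t = 'D_w (trans M i j) x.
    have : is_derive t (1 : R) (fun t => trans M i j (y + t *: w)) ('D_w (trans M i j) x).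
      by apply: is_derive_line; apply: DeriveDef => //; exact: diff_derivable.
    by case.
  have zD : is_derive t (1 : R) (fun t => u *m X t) (u *m X t *m - gamma_mx i x w).
    have := is_derive_mulmx (is_derive_cst u t (1 : R)) (XD t (i12 t t01)).
    by rewrite mul0mx add0r mulmxA.
  have jD : is_derive t (1 : R) (fun t => jac (trans M i j) (y + t *: w))
      (jac2 (trans M i j) w x).
    by apply: (@is_derive_line _ _ _ (jac (trans M i j))); exact: is_derive_jac s2 ijx.
  have := is_derive_mulmx zD jD; rewrite -/x.
  rewrite mulmxN mulNmx (mul_gamma_mx _ _ ix) (mul_jac _ dt) (mul_jac2 _ _ oU s2 ijx).
  rewrite (@gamma_trans _ _ _ nabla i j x w (u *m X t) ijx) opprD addrAC addNr add0r lD.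
  rewrite -[trans M i j x]/(chart M j (segment i y w t)).
  apply: near_eq_is_derive.
  have N : nbhs x (overlap i j) by apply: open_nbhs_nbhs.
  have : \forall r \near t, overlap i j (y + r *: w) := @line_continuous R _ y w t _ N.
  apply: filterS => r ijr; rewrite /segment_field mul_jac; first by [].
  exact: trans_differentiable.
split; [|split].
- move=> j k t t01 jt kt; rewrite /segment_field.
  have ix : img M i (y + t *: w) by apply/iyw/i12.
  by rewrite (@derive_trans_comp _ _ _ i j k)//; apply/overlapP.
- move=> j; apply: continuous_within => t [t01 jt].
  exact: is_derive_continuous (vD j t t01 jt).
- exists [::] => j t t01 _ jt; apply: vD => //; exact: subset_itv_oo_cc.
Qed.

End SegmentTransport.

Section PathTransport.
Context {R : realType} {n : nat} {M : manifold R n} (nabla : connection M).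
Local Notation E := 'rV[R]_n.

Lemma smooth_curve_affine (a b a' b' p q : R) (c : R -> M) :
  smooth_curve a b c ->
  (forall t : R, t \in `]a', b'[ -> p + t * q \in `]a, b[) ->
  smooth_curve a' b' (fun t => c (p + t * q)).
Proof.
move=> [cc cs] ab; split=> [t /ab tab|i k].
  apply: (@continuous_comp _ _ _ (fun t : R => p + t *: (q : R)) c).
    exact: line_continuous.
  exact: cc.
have oU : open (`]a, b[%classic `&` c @^-1` dom M i).
  rewrite openE => t [tab it].
  have H1 : \forall r \near t, r \in `]a, b[ by exact: near_in_itvoo.
  have H2 : \forall r \near t, dom M i (c r).
    by apply: (cc t tab); apply: open_nbhs_nbhs; split => //; exact: dom_open.
  exact: filterS2 H1 H2.
have := Ck_line p q oU (cs i k).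
by apply: Ck_sub => t [tab it]; split => //=; exact: ab.
Qed.

Lemma nodes_le (m : nat) (s : nat -> R) : (forall k, (k < m)%N -> s k < s k.+1) ->
  forall k l, (k <= l <= m)%N -> s k <= s l.
Proof.
move=> ss k l /andP[/subnK <-]; elim: (l - k)%N => // j IH jm.
by apply: le_trans (IH (ltnW jm)) _; apply: ltW; exact: ss.
Qed.

Lemma piecewise_smooth_concat (c d : R -> M) : c 1 = d 0 ->
  piecewise_smooth c -> piecewise_smooth d -> piecewise_smooth (concat c d).
Proof.
move=> cd [m1 [s1 [s10 [s1m H1]]]] [m2 [s2 [s20 [s2m H2]]]].
have le1 := nodes_le (fun k km => (H1 k km).1).
have le2 := nodes_le (fun k km => (H2 k km).1).
(* At the common node k = m1 both formulas give 1/2, so the second one is valid from m1 on. *)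
pose s k := if (k <= m1)%N then s1 k / 2 else (1 + s2 (k - m1)%N) / 2.
have sE k : (m1 <= k)%N -> s k = (1 + s2 (k - m1)%N) / 2.
  rewrite leq_eqVlt => /predU1P[<-|mk]; last by rewrite /s leqNgt mk.
  by rewrite /s leqnn s1m subnn s20 addr0.
exists (m1 + m2)%N, s; split; first by rewrite /s leq0n s10 mul0r.
split; first by rewrite sE ?leq_addr// addKn s2m; field.
move=> k km; have [km1|m1k] := ltnP k m1.
  have [sk [e [c' [e0 [c's cE]]]]] := H1 k km1.
  rewrite /s (ltnW km1) km1; split; first by rewrite ltr_pM2r.
  exists (e / 2), (fun t => c' (0 + t * 2)); split; first by rewrite divr_gt0.
  split.
    apply: smooth_curve_affine c's _ => t.
    by rewrite !in_itv/= => /andP[? ?]; apply/andP; split; lra.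
  move=> t; rewrite in_itv/= => /andP[t1 t2].
  have s1k : s1 k.+1 <= 1 by rewrite -s1m; apply: le1; rewrite km1 leqnn.
  rewrite concat_le; last by lra.
  rewrite add0r mulrC; apply: cE.
  by rewrite in_itv/=; apply/andP; split; lra.
have km2 : (k - m1 < m2)%N by rewrite ltn_subLR.
have [sk [e [c' [e0 [c's cE]]]]] := H2 _ km2.
rewrite !sE ?leqW// subSn//.
split; first by rewrite ltr_pM2r// ltrD2l.
exists (e / 2), (fun t => c' (-1 + t * 2)); split; first by rewrite divr_gt0.
split.
  apply: smooth_curve_affine c's _ => t.
  by rewrite !in_itv/= => /andP[? ?]; apply/andP; split; lra.
move=> t; rewrite in_itv/= => /andP[t1 t2].
have s2k : 0 <= s2 (k - m1)%N by rewrite -s20; apply: le2; rewrite leq0n ltnW.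
rewrite concat_ge//; last by lra.
rewrite (_ : 2 * t - 1 = -1 + t * 2); last by ring.
by apply: cE; rewrite in_itv/=; apply/andP; split; lra.
Qed.

Lemma nodes_between (m : nat) (s : nat -> R) (t : R) : s 0%N <= t -> t < s m ->
  exists2 k, (k < m)%N & s k <= t < s k.+1.
Proof.
elim: m => [|m IH] s0t tsm; first by have := le_lt_trans s0t tsm; rewrite ltxx.
have [/(IH s0t)[k km kt]|smt] := ltP t (s m); first by exists k => //; exact: ltnW.
by exists m => //; rewrite smt.
Qed.

(** [parallel] mentions the velocity of the curve without asserting that it exists, whereas
    rescaling it under a reparametrization requires derivability. This can fail only at the nodes,
    which join the exceptional times. *)
Lemma piecewise_smooth_derivable (c : R -> M) : piecewise_smooth c ->
  exists s : seq R, forall i (t : R), t \in `]0, 1[ -> t \notin s -> dom M i (c t) ->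
    derivable (chart M i \o c) t 1.
Proof.
move=> [m [s [s0 [sm H]]]].
exists [seq s k | k <- iota 0 m.+1] => i t t01 ts it.
move: (t01); rewrite in_itv/= => /andP[t0 t1].
have [||k km /andP[skt tsk]] := @nodes_between m s t; rewrite ?s0 ?sm ?ltW//.
have [_ [e [c' [e0 [c's cE]]]]] := H k km.
have {}skt : s k < t.
  rewrite lt_neqAle skt andbT; apply: contra ts => /eqP <-.
  by apply/mapP; exists k => //; rewrite mem_iota/= add0n ltnS ltnW.
have near_c : \forall r \near t, chart M i (c' r) = chart M i (c r).
  have : \forall r \near t, r \in `]s k, s k.+1[ by apply: near_in_itvoo; rewrite in_itv/= skt.
  by apply: filterS => r /subset_itv_oo_cc rk; rewrite cE.
apply: near_eq_derivable near_c _.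
have [_ /(_ i 1%N)[+ _]] := c's.
move=> /(_ t) dc'; apply: diff_derivable; apply: dc'; split => /=.
  by rewrite in_itv/=; apply/andP; split; lra.
by rewrite -cE// in_itv/= !ltW.
Qed.

(** The charts serve only to read vectors at the two ends; in between, the path may leave them. In
    this form transports along consecutive paths multiply. *)
Definition path_transport (i j : mindex M) (c : R -> M) (P : 'M[R]_n) : Prop :=
  [/\ piecewise_smooth c, dom M i (c 0), dom M j (c 1) &
   forall u : E, exists v, [/\ parallel nabla c v, v i 0 = u & v j 1 = u *m P]].

Lemma half_notin (t : R) (s : seq R) :
  t \notin [seq r / 2 | r <- s] -> 2 * t \notin s.
Proof.
apply: contra => h; apply/mapP; exists (2 * t) => //.
by rewrite mulrAC divff ?mul1r// pnatr_eq0.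
Qed.

Lemma half_notin1 (t : R) (s : seq R) :
  t \notin [seq (1 + r) / 2 | r <- s] -> 2 * t - 1 \notin s.
Proof.
apply: contra => h; apply/mapP; exists (2 * t - 1) => //.
by rewrite addrC subrK mulrAC divff ?mul1r// pnatr_eq0.
Qed.

(** Both sides of the equation scale by a: the left by the chain rule, the right by linearity of
    Gamma in the velocity. *)
Lemma parallel_reparam i (p a t : R) (c c' : R -> M) (v v' : R -> E) :
  (\forall r \near t, c' r = c (p + r * a)) ->
  (\forall r \near t, v' r = v (p + r * a)) ->
  dom M i (c (p + t * a)) -> derivable (chart M i \o c) (p + t * a) 1 ->
  is_derive (p + t * a) (1 : R) v (- gamma nabla i (chart M i (c (p + t * a)))
    ('D_1 (chart M i \o c) (p + t * a)) (v (p + t * a))) ->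
  is_derive t (1 : R) v' (- gamma nabla i (chart M i (c' t))
    ('D_1 (chart M i \o c') t) (v' t)).
Proof.
move=> cc' vv' it cD vD.
have c'D : 'D_1 (chart M i \o c') t = a *: 'D_1 (chart M i \o c) (p + t * a).
  have [_ <-] := is_derive_reparam (derivableP cD).
  by apply: near_eq_derive; apply: filterS cc' => r /= ->.
rewrite c'D (nbhs_singleton cc') (nbhs_singleton vv').
set x := chart M i _; set u := (X in a *: X); set z := v _.
have ix : img M i x by exact: chart_img.
have -> : gamma nabla i x (a *: u) z = a *: gamma nabla i x u z.
  by rewrite -!mul_gamma_mx// gamma_mxZ// scalemxAr.
rewrite -scalerN; apply: near_eq_is_derive (is_derive_reparam vD).
by apply: filterS vv' => r ->.
Qed.

Lemma parallel_concat (j : mindex M) (c d : R -> M) v w : c 1 = d 0 ->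
  piecewise_smooth c -> piecewise_smooth d ->
  dom M j (c 1) -> v j 1 = w j 0 ->
  parallel nabla c v -> parallel nabla d w ->
  parallel nabla (concat c d) (fun i => concat (v i) (w i)).
Proof.
move=> cd /piecewise_smooth_derivable[sc cD] /piecewise_smooth_derivable[sd dD] jc vw.
move=> [vt [vc [sv vD]]] [wt [wc [sw wD]]].
have i11 : (1 : R) \in `[0, 1] by rewrite in_itv/= lexx ler01.
have i00 : (0 : R) \in `[0, 1] by rewrite in_itv/= lexx ler01.
(* Agreement at the joint in the single chart j propagates to all charts, since both fields obey the
   same change of coordinates. *)
have vwi i : dom M i (c 1) -> v i 1 = w i 0.
  move=> ic; rewrite (vt j i _ i11 jc ic) vw cd.
  by rewrite cd in jc ic; exact/esym/wt.
split; [|split].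
- move=> i k t t01; rewrite /concat; case: ifPn => t2 it kt.
    by apply: vt => //; exact: half_itvl.
  by apply: wt => //; apply: half_itvr => //; rewrite ltW// ltNge.
- move=> i; apply: (within_concat _ _ _ (vc i) (wc i)).
  + move=> t [t01 it]; rewrite le_eqVlt => /predU1P[tE|t2]; last by rewrite /concat leNgt t2.
    rewrite /concat -tE lexx divff ?pnatr_eq0// subrr; apply: vwi.
    by move: it; rewrite /= /concat -tE lexx divff ?pnatr_eq0.
  + move=> t [t01 it] t2; split; first exact: half_itvl.
    by move: it; rewrite /= concat_le.
  + move=> t [t01 it] t2; split; first exact: half_itvr.
    by move: it; rewrite /= concat_ge.
(* Excluded are the joint and the rescaled exceptional times of both curves and both fields. *)
exists (2^-1 :: [seq r / 2 | r <- sc ++ sv] ++ [seq (1 + r) / 2 | r <- sd ++ sw]).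
move=> i t t01; rewrite inE mem_cat !negb_or => /and3P[t2 /half_notin + /half_notin1].
rewrite !mem_cat !negb_or => /andP[tsc tsv] /andP[tsd tsw].
move: (t01); rewrite in_itv/= => /andP[t0 t1].
move: t2; rewrite neq_lt => /orP[t2|t2].
  have t201 : 2 * t \in `]0, 1[ by rewrite in_itv/=; apply/andP; split; lra.
  move=> it0; have it : dom M i (c (2 * t)) by move: it0; rewrite concat_le ?ltW.
  have nt : \forall r \near t, r < 2^-1 by exact: lt_nbhsl.
  apply: (@parallel_reparam i 0 2 t c (concat c d) (v i)); rewrite ?add0r ?(mulrC t) //.
  - by apply: filterS nt => r r2; rewrite concat_le ?ltW// add0r mulrC.
  - by apply: filterS nt => r r2; rewrite concat_le ?ltW// add0r mulrC.
  - exact: cD.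
  - exact: vD.
have t201 : 2 * t - 1 \in `]0, 1[ by rewrite in_itv/=; apply/andP; split; lra.
move=> it0; have it : dom M i (d (2 * t - 1)) by move: it0; rewrite concat_ge ?ltW.
have nt : \forall r \near t, 2^-1 < r by exact: lt_nbhsr.
have tE (r : R) : -1 + r * 2 = 2 * r - 1 by ring.
apply: (@parallel_reparam i (-1) 2 t d (concat c d) (w i)); rewrite ?tE //.
- by apply: filterS nt => r r2; rewrite tE /concat leNgt r2.
- by apply: filterS nt => r r2; rewrite tE /concat leNgt r2.
- exact: dD.
- exact: wD.
Qed.

Lemma path_transport_concat (i j k : mindex M) (c d : R -> M) P Q : c 1 = d 0 ->
  path_transport i j c P -> path_transport j k d Q ->
  path_transport i k (concat c d) (P *m Q).
Proof.
move=> cd [cs ic jc cP] [ds jd kd dQ]; split.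
- exact: piecewise_smooth_concat.
- by rewrite concat0.
- by rewrite concat1.
- move=> u; have [v [vc vi vj]] := cP u; have [w [wd wj wk]] := dQ (u *m P).
  exists (fun i => concat (v i) (w i)); split.
  + by apply: (parallel_concat (j := j)) => //; rewrite vj wj.
  + by rewrite concat0.
  + by rewrite concat1 wk mulmxA.
Qed.

Lemma restricted_holonomyP (o : M) (i : mindex M) (P : 'M[R]_n) : dom M i o ->
  restricted_holonomy_group nabla o i P <->
  exists c : R -> M, [/\ c 0 = o, c 1 = o, null_homotopic o c & path_transport i i c P].
Proof.
move=> io; split=> [[c [cs c0 c1 cn cP]]|[c [c0 c1 cn [cs _ _ cP]]]].
  exists c; split => //; split => //; rewrite ?c0 ?c1// => u.
  by have [v [? [? ?]]] := cP u; exists v.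
by exists c; split => // u; have [v [? ? ?]] := cP u; exists v.
Qed.

Lemma segment_path_transport i y w (X : R -> 'M[R]_n) :
  (forall t : R, t \in `](-1), 2[ -> img M i (y + t *: w)) ->
  X 0 = 1%:M ->
  (forall t : R, t \in `](-1), 2[ ->
     is_derive t (1 : R) X (X t *m - gamma_mx nabla i (y + t *: w) w)) ->
  path_transport i i (segment (M := M) i y w) (X 1).
Proof.
move=> iyw X0 XD.
have i12 (t : R) : t \in `[0, 1] -> t \in `](-1), 2[.
  by rewrite !in_itv/= => /andP[? ?]; apply/andP; split; lra.
have iy (t : R) : t \in `[0, 1] -> img M i (y + t *: w) by move=> /i12/iyw.
have iy0 : img M i (y + (0 : R) *: w) by apply: iy; rewrite in_itv/= lexx ler01.
have iy1 : img M i (y + (1 : R) *: w) by apply: iy; rewrite in_itv/= lexx ler01.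
split; [exact: segment_piecewise_smooth|exact: img_dom|exact: img_dom|].
move=> u; exists (segment_field i y w X u); split.
- exact: segment_parallel.
- by rewrite /segment_field X0 mulmx1 derive_trans_id.
- by rewrite /segment_field derive_trans_id.
Qed.

(* Running backwards, [(X 1)^-1 X (1 - s)] solves the reversed equation. *)
Lemma segment_rev_path_transport i y w (X Y : R -> 'M[R]_n) :
  (forall t : R, t \in `](-1), 2[ -> img M i (y + t *: w)) ->
  (forall t : R, t \in `](-1), 2[ ->
     is_derive t (1 : R) X (X t *m - gamma_mx nabla i (y + t *: w) w)) ->
  X 0 = 1%:M -> Y 1 *m X 1 = 1%:M ->
  path_transport i i (segment (M := M) i (y + w) (- w)) (Y 1).
Proof.
move=> iyw XD X0 YX.
have E (t : R) : y + w + t *: (- w) = y + (1 - t) *: w.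
  by rewrite scalerN scalerBl scale1r addrA.
have rev (t : R) : t \in `](-1), 2[ -> 1 - t \in `](-1), 2[.
  by rewrite !in_itv/= => /andP[? ?]; apply/andP; split; lra.
have := @segment_path_transport i (y + w) (- w) (fun t => Y 1 *m X (1 - t)).
rewrite /= subrr X0 mulmx1; apply.
- by move=> t t12; rewrite E; exact/iyw/rev.
- by rewrite subr0.
move=> t t12; rewrite E.
have ix : img M i (y + (1 - t) *: w) by exact/iyw/rev.
rewrite gamma_mxN// opprK.
have XDr : is_derive t (1 : R) (fun t => X (1 - t))
    (X (1 - t) *m gamma_mx nabla i (y + (1 - t) *: w) w).
  have := XD _ (rev t t12).
  rewrite -{1}(mulrN1 t) => /is_derive_reparam.
  rewrite scaleN1r mulmxN opprK; under eq_fun do rewrite mulrN1.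
  by [].
have := is_derive_mulmx (is_derive_cst (Y 1) t (1 : R)) XDr.
by rewrite mul0mx add0r mulmxA.
Qed.

End PathTransport.

(** * Change of chart and of base point *)

Section HolonomyTransfer.
Context {R : realType} {n : nat} {M : manifold R n} (nabla : connection M).
Local Notation E := 'rV[R]_n.
Local Notation hol := (restricted_holonomy_group nabla).

Lemma lie_algebra_conj (H H' : set 'M[R]_n) (S T B : 'M[R]_n) :
  S *m T = 1%:M -> (forall P, H P -> H' (T *m P *m S)) ->
  lie_algebra H B -> lie_algebra H' (T *m B *m S).
Proof.
move=> ST HH' [e [c [e0 ck cH c0 cD]]].
pose L : {linear 'M[R]_n -> 'M[R]_n} := mulmxr S \o mulmx T.
exists e, (fun t => L (c t)); split; first exact: e0.
- apply: (Ck_linear_comp (L := L)) ck; first exact: interval_open.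
  exact: linear_mx_continuous.
- by move=> t te; exact: HH' (cH t te).
- by rewrite /= c0 mulmx1 (mulmx1C ST).
- have [dc _] := ck.
  have : is_derive (0 : R) (1 : R) c ('D_1 c 0).
    apply: DeriveDef => //; apply/derivable1_diffP/dc.
    by rewrite /= in_itv/= oppr_lt0 e0.
  by move=> /(is_derive_linear_comp L)[_ ->]; rewrite cD.
Qed.

(** The matrix is the transport along the lasso that follows c, runs through the loop, and returns
    along c'; matrices of row-vector transports multiply in the order of travel. *)
Lemma holonomy_conj i (c c' : R -> M) (S T P : 'M[R]_n) :
  {within `[0, 1], continuous c} -> (forall t, t \in `[0, 1] -> c' t = c (1 - t)) ->
  path_transport nabla i i c T -> path_transport nabla i i c' S ->
  hol (c 1) i P -> hol (c 0) i (T *m P *m S).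
Proof.
move=> cc c'E cT c'S.
have i11 : (1 : R) \in `[0, 1] by rewrite in_itv/= lexx ler01.
have i00 : (0 : R) \in `[0, 1] by rewrite in_itv/= lexx ler01.
have [_ ic0 ic1 _] := cT.
move=> /restricted_holonomyP => /(_ ic1)[l [l0 l1 ln lP]].
apply/restricted_holonomyP => //.
exists (concat c (concat l c')); split.
- by rewrite concat0.
- by rewrite concat1 concat1 c'E// subrr.
- exact: null_homotopic_lasso.
rewrite -mulmxA; apply: path_transport_concat cT _; first by rewrite concat0.
by apply: path_transport_concat lP c'S; rewrite l1 c'E// subr0.
Qed.

Lemma jac_transK i j x : overlap (M := M) i j x ->
  jac (trans M i j) x *m jac (trans M j i) (trans M i j x) = 1%:M.
Proof.
move=> ijx; have [ix jx] := (overlapP i j x).1 ijx.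
have iix : overlap (M := M) i i x by apply/overlapP; split => //; exact: img_dom.
have [jix _] := trans_overlap ijx iix.
apply/row_matrixP => k; rewrite !rowE mulmxA.
rewrite mul_jac; last exact: trans_differentiable.
rewrite mul_jac; last exact: trans_differentiable.
by rewrite -(derive_trans_comp _ ijx iix) derive_trans_id// mulmx1.
Qed.

(** Loop and parallel fields remain the same; only their coordinates at the two ends are converted
    by the Jacobians. *)
Lemma holonomy_change_chart q i j P : dom M i q -> dom M j q -> hol q i P ->
  hol q j (jac (trans M j i) (chart M j q) *m P *m jac (trans M i j) (chart M i q)).
Proof.
move=> iq jq [c [cs c0 c1 cn cP]]; exists c; split => // u.
have i11 : (1 : R) \in `[0, 1] by rewrite in_itv/= lexx ler01.
have i00 : (0 : R) \in `[0, 1] by rewrite in_itv/= lexx ler01.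
have ijx : overlap (M := M) i j (chart M i q) by exists q.
have jix : overlap (M := M) j i (chart M j q) by exists q.
have E : trans M j i (chart M j q) = chart M i q by rewrite /trans/= chartK.
have [v [vp [v0 v1]]] := cP (u *m jac (trans M j i) (chart M j q)).
have [vt _] := vp; exists v; split => //.
have dt : differentiable (trans M i j) (chart M i q) by exact: trans_differentiable.
have JJ := jac_transK jix; rewrite E in JJ.
have iq0 : dom M i (c 0) by rewrite c0.
have jq0 : dom M j (c 0) by rewrite c0.
have iq1 : dom M i (c 1) by rewrite c1.
have jq1 : dom M j (c 1) by rewrite c1.
split.
  by rewrite (vt i j 0 i00 iq0 jq0) c0 v0 -(mul_jac _ dt) -mulmxA JJ mulmx1.
rewrite (vt i j 1 i11 iq1 jq1) c1 v1 -(mul_jac _ dt) !mulmxA; exact: erefl.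
Qed.

Variables (V : vectType R) (g : {vspace 'End(V)}).

(** Holonomy algebras at different points are merely conjugate, so the identification theta is
    allowed to vary with the point and the chart while g stays fixed. *)
Definition holonomy_everywhere (q : M) := forall j, dom M j q ->
  exists theta : {linear E -> V}, bijective theta /\
    [set A | A \in g] = holonomy_algebra nabla q j theta.

(** The conjugation is absorbed into the identification, replacing theta by u |-> theta (u T).
    Equality with g takes one inclusion from each direction of transport. *)
Lemma holonomy_transfer q q' i j (theta : {linear E -> V}) (S T : 'M[R]_n) :
  bijective theta -> [set A | A \in g] = holonomy_algebra nabla q i theta ->
  S *m T = 1%:M ->
  (forall P, hol q i P -> hol q' j (T *m P *m S)) ->
  (forall P, hol q' j P -> hol q i (S *m P *m T)) ->
  exists theta' : {linear E -> V}, bijective theta' /\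
    [set A | A \in g] = holonomy_algebra nabla q' j theta'.
Proof.
move=> [theta1 thetaK theta1K] gE ST H1 H2; have TS := mulmx1C ST.
exists (theta \o mulmxr T : {linear E -> V}); split.
  exists (fun v => theta1 v *m S).
    by move=> u /=; rewrite thetaK -mulmxA TS mulmx1.
  by move=> v /=; rewrite -mulmxA ST mulmx1 theta1K.
rewrite gE; apply/seteqP; split=> A [B LB AB].
  exists (T *m B *m S); first exact: lie_algebra_conj LB.
  by move=> u /=; rewrite AB -!mulmxA ST mulmx1.
exists (S *m B *m T); first exact: lie_algebra_conj LB.
move=> u; have := AB (u *m S); rewrite /= -mulmxA ST mulmx1 => ->.
by rewrite !mulmxA.
Qed.

Lemma holonomy_everywhere_chart q i (theta : {linear E -> V}) : dom M i q ->
  bijective theta -> [set A | A \in g] = holonomy_algebra nabla q i theta ->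
  holonomy_everywhere q.
Proof.
move=> iq tb gE j jq.
have ijx : overlap (M := M) i j (chart M i q) by exists q.
have E1 : trans M i j (chart M i q) = chart M j q by rewrite /trans/= chartK.
apply: (@holonomy_transfer q q i j theta (jac (trans M i j) (chart M i q))
  (jac (trans M j i) (chart M j q)) tb gE).
- by rewrite -E1; exact: jac_transK.
- by move=> P; exact: holonomy_change_chart.
- by move=> P; exact: holonomy_change_chart.
Qed.

End HolonomyTransfer.

Section LocalTransport.
Context {R : realType} {n : nat} {M : manifold R n} (nabla : connection M).
Local Notation E := 'rV[R]_n.

Lemma gamma_mx_Ck k i u : Ck k (img M i) (fun x => gamma_mx nabla i x u).
Proof.
have oU : open (img M i) by exact: img_open.
pose L (l : 'I_n) : {linear E -> 'M[R]_n} := mulmx (delta_mx l (0 : 'I_1)).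
apply: (@Ck_eq _ _ _ k _
  (fun x => \sum_(l <- index_enum 'I_n) L l (gamma nabla i x u (delta_mx 0 l)))) => //.
  move=> x ix; apply/matrixP => a b; rewrite summxE (bigD1 a)//= big1 => [|l la].
    by rewrite !mxE big_ord1 !mxE !eqxx mul1r addr0.
  by rewrite !mxE big_ord1 !mxE eq_sym (negbTE la) mul0r.
apply: Ck_sum => // l.
apply: (Ck_linear_comp (L := L l)) => //; first exact: linear_mx_continuous.
exact: gamma_smooth.
Qed.

Lemma gamma_mx_continuous i u x : img M i x ->
  {for x, continuous (fun x => gamma_mx nabla i x u)}.
Proof. by move=> ix; exact: Ck_continuous (gamma_mx_Ck 0 i u) ix. Qed.

Lemma nrm_sum (I : Type) (r : seq I) (F : I -> 'M[R]_n) :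
  nrm (\sum_(k <- r) F k) <= \sum_(k <- r) nrm (F k).
Proof.
elim: r => [|k r IH]; first by rewrite !big_nil /nrm normr0 mulr0.
by rewrite !big_cons; apply: le_trans (nrmD _ _) _; rewrite lerD2l.
Qed.

(** By linearity in w the bound need only be made near x0 on the finitely many basis vectors, where
    it follows from continuity. *)
Lemma gamma_mx_bound i x0 : img M i x0 -> exists r K : R, [/\ 0 < r, 0 < K,
  ball x0 r `<=` img M i &
  forall x, ball x0 r x -> forall w, nrm (gamma_mx nabla i x w) <= K * `|w|].
Proof.
move=> ix0.
pose K := \sum_(k < n) (nrm (gamma_mx nabla i x0 (delta_mx 0 k)) + 1) + 1.
have K0 : 0 < K.
  by rewrite /K ltr_wpDl// sumr_ge0// => k _; rewrite addr_ge0 ?nrm_ge0.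
have H1 : nbhs x0 (img M i) by apply: open_nbhs_nbhs; split => //; exact: img_open.
have H2 : \forall x \near x0, forall k : 'I_n,
    nrm (gamma_mx nabla i x (delta_mx 0 k)) <= nrm (gamma_mx nabla i x0 (delta_mx 0 k)) + 1.
  apply: (@filter_forall E 'I_n (fun k x =>
    nrm (gamma_mx nabla i x (delta_mx 0 k)) <=
    nrm (gamma_mx nabla i x0 (delta_mx 0 k)) + 1) (nbhs x0) (nbhs_filter x0)) => k.
  have /nrm_cvg/(_ 1 ltr01) := @gamma_mx_continuous i (delta_mx 0 k) x0 ix0.
  apply: filterS => x h.
  rewrite -[gamma_mx _ _ x _](subrK (gamma_mx nabla i x0 (delta_mx 0 k))) addrC.
  by apply: le_trans (nrmD _ _) _; rewrite lerD2l.
have /nbhs_ballP[r /= r0 rP] := @filterI _ _ (nbhs_filter x0) _ _ H1 H2.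
exists r, K; split => // [x /rP[]//|x /rP[ix bx] w].
pose gl : {linear E -> 'M[R]_n} := HB.pack (gamma_mx nabla i x)
  (GRing.isLinear.Build _ _ _ _ _ (gamma_mx_linear nabla ix)).
rewrite -[gamma_mx _ _ x w]/(gl w) {1}[w]row_sum_delta linear_sum.
apply: le_trans (nrm_sum _ _) _.
apply: (@le_trans _ _ (\sum_(k < n) (nrm (gamma_mx nabla i x0 (delta_mx 0 k)) + 1) * `|w|)).
  apply: ler_sum => k _; rewrite linearZ nrmZ mulrC.
  by apply: ler_pM; rewrite ?nrm_ge0//; [exact: bx|exact: le_coord_norm].
by rewrite -mulr_suml ler_wpM2r// /K lerDl.
Qed.

Lemma local_fundamental i x0 : img M i x0 -> exists r : R, [/\ 0 < r,
  ball x0 r `<=` img M i &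
  forall y w, ball x0 r y -> `|w| < 2 * r ->
   (forall t : R, t \in `[-1, 2] -> img M i (y + t *: w)) /\
   exists X Y, fundamental (fun s : R => - gamma_mx nabla i (y + s *: w) w) X Y].
Proof.
move=> ix0; have [r0 [K [r00 K0 rimg rK]]] := gamma_mx_bound ix0.
(* For y within r of x0, |w| < 2 r and |t| <= 2, the point y + t w is within 5 r of x0, and the
   coefficient is at most 2 r K <= 1/4, as Picard iteration demands. The bound 2 r on w lets any two
   points of the ball be joined. *)
pose r := Num.min (r0 / 5) (1 / (8 * K)).
have r_gt0 : 0 < r by rewrite lt_min !divr_gt0// mulr_gt0.
have r5 : 5 * r <= r0.
  have : r <= r0 / 5 by rewrite /r ge_min lexx.
  by lra.
have rK8 : K * (2 * r) <= 4^-1.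
  have : r <= 1 / (8 * K) by rewrite /r ge_min lexx orbT.
  rewrite ler_pdivlMr ?mulr_gt0// => h; lra.
exists r; split => //.
  by apply: subset_trans rimg; apply: le_ball; lra.
move=> y w x0y wr.
have yw (t : R) : t \in `[-1, 2] -> ball x0 r0 (y + t *: w).
  rewrite in_itv/= => /andP[t1 t2]; move: x0y; rewrite -!ball_normE /ball_/= => x0y.
  rewrite opprD addrA; apply: le_lt_trans (ler_normB _ _) _; rewrite normrZ.
  have t2' : `|t| <= 2 by rewrite ler_norml; apply/andP; split; lra.
  have : `|t| * `|w| <= 2 * (2 * r) by apply: ler_pM => //; exact: ltW.
  lra.
split; first by move=> t /yw/rimg.
apply: linear_ode => s s12.
  apply: cvgN; apply: (@continuous_comp _ _ _ (fun s : R => y + s *: w)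
      (fun x => gamma_mx nabla i x w)); first exact: line_continuous.
  by apply: gamma_mx_continuous; exact/rimg/yw.
rewrite nrmN; apply: le_trans (rK _ (yw _ s12) w) _.
by apply: le_trans rK8; rewrite ler_pM2l// ltW.
Qed.

Lemma segment_transports i y w X Y :
  (forall t : R, t \in `[-1, 2] -> img M i (y + t *: w)) ->
  fundamental (fun s : R => - gamma_mx nabla i (y + s *: w) w) X Y ->
  path_transport nabla i i (segment (M := M) i y w) (X 1) /\
  path_transport nabla i i (segment (M := M) i (y + w) (- w)) (Y 1).
Proof.
move=> iyw F.
have iyw' (t : R) : t \in `](-1), 2[ -> img M i (y + t *: w).
  by move=> t12; apply: iyw; exact: subset_itv_oo_cc.
have XD (t : R) := fundX F (s := t).
have YX : Y 1 *m X 1 = 1%:M.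
  by apply/mulmx1C/(fundXY F); rewrite in_itv/= lexx ler01.
split; first exact: (segment_path_transport iyw' (fundX0 F) XD).
exact: (segment_rev_path_transport iyw' XD (fundX0 F) YX).
Qed.

End LocalTransport.

Section Connectedness.
Context {R : realType} {n : nat} {M : manifold R n} (nabla : connection M).
Variables (V : vectType R) (g : {vspace 'End(V)}).
Local Notation E := 'rV[R]_n.
Local Notation hol := (restricted_holonomy_group nabla).

Lemma holonomy_segment i y w X Y P :
  (forall t : R, t \in `[-1, 2] -> img M i (y + t *: w)) ->
  fundamental (fun s : R => - gamma_mx nabla i (y + s *: w) w) X Y ->
  (hol (chartV M i (y + w)) i P -> hol (chartV M i y) i (X 1 *m P *m Y 1)) /\
  (hol (chartV M i y) i P -> hol (chartV M i (y + w)) i (Y 1 *m P *m X 1)).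
Proof.
move=> iyw F; have [T1 T2] := segment_transports iyw F.
have i12 (t : R) : t \in `[0, 1] -> t \in `[-1, 2].
  by rewrite !in_itv/= => /andP[? ?]; apply/andP; split; lra.
have E' (t : R) : y + w + t *: (- w) = y + (1 - t) *: w.
  by rewrite scalerN scalerBl scale1r addrA.
have rev (t : R) : t \in `[0, 1] -> 1 - t \in `[0, 1].
  by rewrite !in_itv/= => /andP[? ?]; apply/andP; split; lra.
have s0 : segment (M := M) i y w 0 = chartV M i y by rewrite /segment scale0r addr0.
have s1 : segment (M := M) i y w 1 = chartV M i (y + w) by rewrite /segment scale1r.
have r0 : segment (M := M) i (y + w) (- w) 0 = chartV M i (y + w).
  by rewrite /segment scale0r addr0.
have r1 : segment (M := M) i (y + w) (- w) 1 = chartV M i y.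
  by rewrite /segment scale1r addrK.
have c1 : {within `[0, 1], continuous (segment (M := M) i y w)}.
  by apply: continuous_within => t /i12/iyw; exact: segment_continuous.
have c2 : {within `[0, 1], continuous (segment (M := M) i (y + w) (- w))}.
  apply: continuous_within => t t01; apply: segment_continuous.
  by rewrite E'; exact/iyw/i12/rev.
split.
  rewrite -s0 -s1; apply: (holonomy_conj c1 _ T1 T2) => t t01.
  by rewrite /segment E'.
rewrite -r0 -r1; apply: (holonomy_conj c2 _ T2 T1) => t t01.
by rewrite /segment E' subKr.
Qed.

(** The statement is symmetric in p and p', so that it yields both openness and closedness of the
    set of good points. *)
Lemma holonomy_everywhere_near (q : M) : exists2 U : set M, nbhs q U &
  forall p p', U p -> U p' -> holonomy_everywhere nabla g p -> holonomy_everywhere nabla g p'.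
Proof.
have [i iq] := dom_cover q.
have [r [r0 rimg rP]] := local_fundamental nabla (chart_img iq).
exists [set p | dom M i p /\ ball (chart M i q) r (chart M i p)].
  have H1 : nbhs q (dom M i) by apply: open_nbhs_nbhs; split => //; exact: dom_open.
  have H2 : \forall p \near q, ball (chart M i q) r (chart M i p).
    by apply: (chart_continuous iq); exact: nbhsx_ballx.
  exact: filterI H1 H2.
move=> p p' [ip xp] [ip' xp'] /(_ i ip)[theta [tb gE]].
set y := chart M i p in xp; set y' := chart M i p' in xp'.
have w2r : `|y - y'| < 2 * r.
  move: xp xp'; rewrite -!ball_normE /ball_/= => xp xp'.
  rewrite (_ : y - y' = (chart M i q - y') - (chart M i q - y)); last first.
    by apply/rowP => k; rewrite !mxE; ring.
  by apply: le_lt_trans (ler_normB _ _) _; lra.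
have [iyw [X [Y F]]] := rP y' (y - y') xp' w2r.
have pE : chartV M i (y' + (y - y')) = p by rewrite addrC subrK chartK.
have p'E : chartV M i y' = p' by rewrite chartK.
have YX : Y 1 *m X 1 = 1%:M.
  by apply/mulmx1C/(fundXY F); rewrite in_itv/= lexx ler01.
have [theta' [tb' gE']] : exists theta' : {linear E -> V}, bijective theta' /\
    [set A | A \in g] = holonomy_algebra nabla p' i theta'.
  apply: (holonomy_transfer tb gE YX) => P hP.
    by have [+ _] := holonomy_segment P iyw F; rewrite pE p'E; exact.
  by have [_] := holonomy_segment P iyw F; rewrite pE p'E; exact.
exact: holonomy_everywhere_chart ip' tb' gE'.
Qed.

Lemma holonomy_everywhere_all o i (theta : {linear E -> V}) : dom M i o ->
  bijective theta -> [set A | A \in g] = holonomy_algebra nabla o i theta ->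
  forall q, holonomy_everywhere nabla g q.
Proof.
move=> io tb gE.
pose Q := [set q | holonomy_everywhere nabla g q].
have Qo : Q o by exact: holonomy_everywhere_chart io tb gE.
have oQ : open Q.
  rewrite openE => q Qq; have [U qU UP] := holonomy_everywhere_near q.
  have Uq := nbhs_singleton qU.
  by apply: filterS qU => p Up; exact: UP Uq Up Qq.
have cQ : closed Q.
  move=> q clq; have [U qU UP] := holonomy_everywhere_near q.
  have [p [Qp Up]] := clq _ qU.
  exact: UP Up (nbhs_singleton qU) Qp.
have QT : Q = setT.
  apply: (@mspace_connected _ _ M); first by exists o.
  - by exists Q => //; rewrite setTI.
  - by exists Q => //; rewrite setTI.
by move=> q; have : [set: M] q by []; rewrite -QT.
Qed.

End Connectedness.

(** * Curvature in the holonomy algebra *)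

Section MatrixSubspaces.
Context {R : realType} {n : nat}.
Implicit Types (L : {vspace 'M[R]_n}) (A B : 'M[R]_n).

(** A linear map with kernel L. Membership in L becomes an equation between continuous maps, and so
    passes to limits and derivatives. *)
Definition off_vspace L B := B - projv L B.

Lemma off_vspace_linear L : linear (off_vspace L).
Proof.
move=> a A B; rewrite /off_vspace linearP scalerBr opprD !addrA.
by congr (_ + _); rewrite addrAC.
Qed.

HB.instance Definition _ L := GRing.isLinear.Build R 'M[R]_n 'M[R]_n _ (off_vspace L)
  (off_vspace_linear L).

Lemma off_vspaceP L B : (off_vspace L B == 0) = (B \in L).
Proof.
rewrite /off_vspace subr_eq0 eq_sym.
by apply/eqP/idP => [<-|/projv_id //]; exact: memv_proj.
Qed.

Lemma vspace_limit L B :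
  (forall e, 0 < e -> exists2 A, A \in L & nrm (A - B) <= e) -> B \in L.
Proof.
move=> LB; rewrite -off_vspaceP; apply/eqP/nrm_le0_eq0.
apply/ler_addgt0Pr => e e0; rewrite add0r.
have /nrm_cvg/(_ _ e0)/nbhs_ballP[d /= d0 dP] := @linear_mx_continuous R _ _ _ _ (off_vspace L) B.
have [A AL AB] := LB _ (divr_gt0 d0 (ltr0n R 2)).
have : nrm (off_vspace L A - off_vspace L B) <= e.
  apply: dP; rewrite -ball_normE /ball_/= distrC.
  by apply: le_lt_trans (le_trans (norm_le_nrm _) AB) _; rewrite ltr_pdivrMr// ltr_pMr// ltr1n.
by move: AL; rewrite -off_vspaceP => /eqP ->; rewrite sub0r nrmN.
Qed.

Lemma vspace_derive L (F : R -> 'M[R]_n) (D : 'M[R]_n) :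
  (\forall t \near 0, F t \in L) -> is_derive (0 : R) (1 : R) F D -> D \in L.
Proof.
move=> FL /(is_derive_linear_comp (off_vspace L))[_ E].
rewrite -off_vspaceP -E; apply/eqP.
rewrite -[RHS](derive_cst (0 : 'M[R]_n) (0 : R) (1 : R)).
by apply: near_eq_derive; apply: filterS FL => t; rewrite -off_vspaceP => /eqP.
Qed.

End MatrixSubspaces.

Section CurveCalculus.
Context {R : realType}.

Lemma is_derive_scale_id m n (F : R -> 'M[R]_(m, n)) (t : R) D :
  is_derive t (1 : R) F D ->
  is_derive t (1 : R) (fun t => t *: F t) (F t + t *: D).
Proof.
move=> /is_derive_mxP FD; apply/is_derive_mxP => i j.
have := is_derive_mulr (is_derive_id t (1 : R)) (FD i j).
by rewrite mul1r !mxE; under [in X in _ -> X]eq_fun do rewrite mxE.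
Qed.

(** Everything follows from Y(r) - Y(t) = - Y(r) (X(r) - X(t)) Y(t): boundedness of Y gives its
    continuity, and continuity gives the derivative. *)
Lemma is_derive_mx_inverse n (X Y : R -> 'M[R]_n) (t : R) (K : R) D :
  (\forall r \near t, X r *m Y r = 1%:M) -> (\forall r \near t, nrm (Y r) <= K) ->
  is_derive t (1 : R) X D ->
  is_derive t (1 : R) Y (- (Y t *m D *m Y t)).
Proof.
move=> XY YK XD.
have XYt := nbhs_singleton XY.
have YE : \forall r \near t, Y r - Y t = - (Y r *m (X r - X t) *m Y t).
  apply: filterS XY => r XYr; rewrite mulmxBr mulmxBl.
  by rewrite (mulmx1C XYr) mul1mx -[Y r *m X t *m _]mulmxA XYt mulmx1 opprB.
have K0 : 0 <= K := le_trans (nrm_ge0 _) (nbhs_singleton YK).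
have cX : {for t, continuous X} by exact: is_derive_continuous XD.
have cY : Y @ t --> Y t.
  apply/nrm_cvg => e e0.
  have d0 : 0 < e / (K * K + 1) by rewrite divr_gt0// ltr_wpDl// mulr_ge0.
  have /nrm_cvg/(_ _ d0) Xd := cX.
  near=> r.
  have -> : Y r - Y t = - (Y r *m (X r - X t) *m Y t) by near: r.
  rewrite nrmN; apply: le_trans (nrmM _ _) _.
  apply: (@le_trans _ _ (K * (e / (K * K + 1)) * K)).
    apply: ler_pM; rewrite ?nrm_ge0//; last exact: (nbhs_singleton YK).
    apply: le_trans (nrmM _ _) _.
    by apply: ler_pM; rewrite ?nrm_ge0//; near: r.
  rewrite mulrAC mulrA ler_pdivrMr ?ltr_wpDl ?mulr_ge0//.
  by rewrite mulrC ler_wpM2l ?lerDl// ltW.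
have shift0 : (fun h : R => h *: (1 : R) + t) @ 0^' --> t.
  rewrite -[X in _ --> X]add0r -[X in _ --> X + _](scale0r (1 : R)).
  apply: cvgD; last exact: cvg_cst.
  by apply: cvgZr_tmp; apply: cvg_within_filter; exact: cvg_id.
have H : (fun h : R => h^-1 *: (Y (h *: (1 : R) + t) - Y t)) @ 0^' -->
    (- (Y t *m D *m Y t) : 'M[R]_n).
  have H' : (fun h : R => - (Y (h *: (1 : R) + t) *m
      (h^-1 *: (X (h *: (1 : R) + t) - X t)) *m Y t)) @ 0^' --> (- (Y t *m D *m Y t) : 'M[R]_n).
    apply: cvgN; apply: cvg_mulmx; last exact: cvg_cst.
    apply: cvg_mulmx; first exact: cvg_comp shift0 cY.
    by case: XD => dX <-; exact: dX.
  apply: cvg_trans H'; apply: near_eq_cvg.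
  have N : \forall h \near (0 : R)^', Y (h *: (1 : R) + t) - Y t =
      - (Y (h *: (1 : R) + t) *m (X (h *: (1 : R) + t) - X t) *m Y t) := shift0 _ YE.
  by apply: filterS N => h ->; rewrite scalerN -scalemxAr -scalemxAl.
apply: DeriveDef; first by apply/cvg_ex; exists (- (Y t *m D *m Y t)).
exact: cvg_lim.
Unshelve. all: by end_near. Qed.

Lemma C1_of_is_derive {F : normedModType R} (c c' : R -> F) (e : R) :
  (forall t : R, t \in `](- e), e[ -> is_derive t (1 : R) c (c' t)) ->
  (forall t : R, t \in `](- e), e[ -> {for t, continuous c'}) ->
  Ck 1 `](- e), e[%classic c.
Proof.
move=> cD cc'; split=> [t /cD[/derivable1_diffP]//|h].
apply: (@Ck_eq R R F 0 _ (fun t => h *: c' t)); first exact: interval_open.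
  by move=> t /cD/(derive_scale_dir h)[_ <-].
by move=> t /cc' ct; apply: cvgZ; [exact: cvg_cst|exact: ct].
Qed.

End CurveCalculus.

Section RadialFamily.
Context {R : realType} {n : nat} {M : manifold R n} (nabla : connection M).
Local Notation E := 'rV[R]_n.
Variable i : mindex M.
Local Notation G := (fun w x => gamma_mx nabla i x w).

Lemma gamma_mx_differentiable w x : img M i x -> differentiable (G w) x.
Proof. by move=> ix; have [+ _] := gamma_mx_Ck nabla 1 i w; exact. Qed.

Lemma is_derive_gamma_mx w x v : img M i x -> is_derive x v (G w) ('D_v (G w) x).
Proof.
by move=> ix; apply: DeriveDef => //; apply: diff_derivable; exact: gamma_mx_differentiable.
Qed.

Lemma derive_gamma_mx_continuous w x v : img M i x -> {for x, continuous ('D_v (G w))}.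
Proof. by move=> ix; have [_ H] := gamma_mx_Ck nabla 1 i w; exact: H v x ix. Qed.

Lemma derive_gamma_mxD x v w w' : img M i x ->
  'D_v (G (w + w')) x = 'D_v (G w) x + 'D_v (G w') x.
Proof.
move=> ix.
have [_ <-] := is_deriveD (is_derive_gamma_mx w v ix) (is_derive_gamma_mx w' v ix).
apply: near_eq_derive; apply: (@open_near _ (img M i) x _ (@img_open _ _ M i) ix) => y iy.
by rewrite gamma_mxD.
Qed.

Lemma derive_gamma_mxZ x v a w : img M i x ->
  'D_v (G (a *: w)) x = a *: 'D_v (G w) x.
Proof.
move=> ix.
have [_ <-] := is_deriveZ a (is_derive_gamma_mx w v ix).
apply: near_eq_derive; apply: (@open_near _ (img M i) x _ (@img_open _ _ M i) ix) => y iy.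
by rewrite gamma_mxZ.
Qed.

Lemma derive_gamma_mxZl x v a w : img M i x ->
  'D_(a *: v) (G w) x = a *: 'D_v (G w) x.
Proof.
move=> ix; have dG := gamma_mx_differentiable w ix.
by rewrite !deriveE// linearZ.
Qed.

Variables (y w v : E) (e : R).
Hypothesis img_ywv : forall t s : R, `|t| < e -> s \in `[0, 1] ->
  img M i (y + s *: (w + t *: v)).
(** The coefficient of the transport equation along the segment from y to y + w + t v. In its
    t-derivative A', the factor s stems from the motion of the base point, and the last term from
    the change of direction. *)
Let A t s := - gamma_mx nabla i (y + s *: (w + t *: v)) (w + t *: v).
Let A' t s := let p := y + s *: (w + t *: v) in
  - (s *: ('D_v (G w) p + t *: 'D_v (G v) p) + gamma_mx nabla i p v).

Lemma radial_derive (t s : R) : `|t| < e -> s \in `[0, 1] ->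
  is_derive t (1 : R) (A ^~ s) (A' t s).
Proof.
move=> te s01; have ip := img_ywv te s01; set p := _ + _ in ip.
have pE r : y + s *: (w + r *: v) = (y + s *: w) + r *: (s *: v).
  by rewrite scalerDr addrA !scalerA mulrC.
have lineD u : is_derive t (1 : R) (fun r => G u (y + s *: (w + r *: v))) (s *: 'D_v (G u) p).
  rewrite -(derive_gamma_mxZl _ _ _ ip); under eq_fun do rewrite pE.
  by apply: (@is_derive_line _ _ _ (G u)); rewrite -pE; exact: is_derive_gamma_mx.
have := is_deriveN (is_deriveD (lineD w) (is_derive_scale_id (lineD v))).
rewrite (_ : - (_ + _) = A' t s); last first.
  rewrite /A' -/p; congr (- _); rewrite scalerDr -addrA; congr (_ + _).
  by rewrite addrC scalerA mulrC -scalerA.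
apply: near_eq_is_derive.
near=> r; rewrite /A /= gamma_mxD ?gamma_mxZ//; apply: img_ywv => //; near: r; exact: near_lt.
Unshelve. all: by end_near. Qed.

Lemma radial_continuous (t s : R) : `|t| < e -> s \in `[0, 1] ->
  {for (t, s), continuous (fun p => A' p.1 p.2)}.
Proof.
move=> te s01; have ip := img_ywv te s01.
have cp : {for (t, s), continuous (fun p : R * R => y + p.2 *: (w + p.1 *: v))}.
  apply: cvgD; first exact: cvg_cst.
  apply: cvgZ; first exact: cvg_snd.
  apply: cvgD; first exact: cvg_cst.
  by apply: cvgZr_tmp; exact: cvg_fst.
have cG (g : E -> 'M[R]_n) : {for (y + s *: (w + t *: v)), continuous g} ->
    {for (t, s), continuous (fun p : R * R => g (y + p.2 *: (w + p.1 *: v)))}.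
  by move=> cg; apply: (@continuous_comp _ _ _ (fun p : R * R => y + p.2 *: (w + p.1 *: v)) g).
apply: cvgN; apply: cvgD; last by apply: (cG (G v)); exact: gamma_mx_continuous.
apply: cvgZ; first exact: cvg_snd.
apply: cvgD; first by apply: (cG ('D_v (G w))); exact: derive_gamma_mx_continuous.
apply: cvgZ; first exact: cvg_fst.
by apply: (cG ('D_v (G v))); exact: derive_gamma_mx_continuous.
Qed.

End RadialFamily.

Section CurvatureMatrix.
Context {R : realType} {n : nat} {M : manifold R n} (nabla : connection M).
Local Notation E := 'rV[R]_n.
Variable i : mindex M.
Local Notation G := (fun w x => gamma_mx nabla i x w).

(** Row vectors are multiplied from the right, so w (G v) (G u) means Gamma(u, Gamma(v, w)); hence
    the commutator in reversed order. *)
Definition curvature_mx (u v x : E) : 'M[R]_n :=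
  'D_u (G v) x - 'D_v (G u) x + (G v x *m G u x - G u x *m G v x).

Lemma curvature_mx_continuous u v x : img M i x -> {for x, continuous (curvature_mx u v)}.
Proof.
move=> ix; have FF := nbhs_filter x.
apply: (@cvgD _ _ _ (nbhs x) FF); apply: (@cvgB _ _ _ (nbhs x) FF).
- exact: derive_gamma_mx_continuous.
- exact: derive_gamma_mx_continuous.
- by apply: (@cvg_mulmx _ _ (nbhs x) FF); exact: gamma_mx_continuous.
- by apply: (@cvg_mulmx _ _ (nbhs x) FF); exact: gamma_mx_continuous.
Qed.

Lemma curvature_mxZl a u v x : img M i x -> curvature_mx (a *: u) v x = a *: curvature_mx u v x.
Proof.
move=> ix; rewrite /curvature_mx derive_gamma_mxZl// derive_gamma_mxZ// gamma_mxZ//.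
by rewrite -scalemxAr -scalemxAl -!scalerBr -scalerDr.
Qed.

(* Integrated over [0, 1], this expresses the velocity of the holonomy of the triangle
   with vertices x, x + w, x + w + t v at t = 0 by the curvature along [x, x + w]. *)
Lemma transported_curvature (x w v : E) (X Y : R -> 'M[R]_n) (Z : R -> 'M[R]_n) (s : R) :
  img M i (x + s *: w) -> s \in `[0, 1] ->
  fundamental (fun s : R => - gamma_mx nabla i (x + s *: w) w) X Y ->
  is_derive s (1 : R) Z (X s *m
    (- (s *: 'D_v (G w) (x + s *: w) + gamma_mx nabla i (x + s *: w) v)) *m Y s) ->
  is_derive s (1 : R) (fun s => s *: (X s *m gamma_mx nabla i (x + s *: w) v *m Y s) + Z s)
    (s *: (X s *m curvature_mx w v (x + s *: w) *m Y s)).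
Proof.
move=> ix s01 F ZD; set p := x + s *: w in ix ZD *.
have s12 : s \in `](-1), 2[.
  by move: s01; rewrite !in_itv/= => /andP[? ?]; apply/andP; split; lra.
have GD : is_derive s (1 : R) (fun s => gamma_mx nabla i (x + s *: w) v) ('D_w (G v) p).
  by apply: (@is_derive_line _ _ _ (G v)); exact: is_derive_gamma_mx.
have := is_deriveD (is_derive_scale_id
  (is_derive_mulmx (is_derive_mulmx (fundX F s12) GD) (fundY F s12))) ZD.
rewrite -/p [X in is_derive _ _ _ X -> _](_ : _ = s *: (X s *m curvature_mx w v p *m Y s)) //.
rewrite /curvature_mx opprK !(mulmxN, mulNmx, mulmxDr, mulmxDl, mulmxBr, mulmxBl).
rewrite -!(scalemxAr, scalemxAl) !mulmxA.
have id5 (m1 m2 m3 m4 m5 : 'M[R]_n) :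
    m1 + s *: (- m2 + m3 + m4) - (s *: m5 + m1) = s *: (m3 - m5 + (m4 - m2)).
  by apply/matrixP => a b; rewrite !mxE; ring.
exact: id5.
Qed.

End CurvatureMatrix.

Section CurvatureInHolonomy.
Context {R : realType} {n : nat} {M : manifold R n} (nabla : connection M).
Local Notation E := 'rV[R]_n.
Local Notation hol := (restricted_holonomy_group nabla).
Variable i : mindex M.
Local Notation G := (fun w x => gamma_mx nabla i x w).
Local Notation radial y w := (fun s : R => - gamma_mx nabla i (y + s *: w) w).

(** Used for a segment shrinking to a point, where K tends to 0: the transports that surround the
    curvature then disappear in the limit. *)
Lemma fundamental_near_id (y w : E) X Y (K : R) : 0 <= K ->
  fundamental (radial y w) X Y ->
  (forall s : R, s \in `[0, 1] -> nrm (gamma_mx nabla i (y + s *: w) w) <= K) ->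
  forall s : R, s \in `[0, 1] ->
    nrm (X s - 1%:M) <= ode_bound n * K /\
    nrm (Y s - 1%:M) <= ode_bound n * ode_bound n * K.
Proof.
move=> K0 F GK s s01.
have B0 : 0 <= ode_bound n :> R by rewrite mulr_ge0// nrm_ge0.
have i12 (r : R) : r \in `[0, 1] -> r \in `](-1), 2[.
  by rewrite !in_itv/= => /andP[? ?]; apply/andP; split; lra.
move: (s01); rewrite in_itv/= => /andP[s0 s1].
have le01 (r : R) : r \in `[0, s] -> r \in `[0, 1].
  by rewrite !in_itv/= => /andP[? ?]; apply/andP; split; lra.
have XD (r : R) : r \in `[0, s] ->
    is_derive r (1 : R) X (X r *m - gamma_mx nabla i (y + r *: w) w).
  by move=> /le01/i12; exact: (fundX F).
have XK (r : R) : r \in `[0, s] ->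
    nrm (X r *m - gamma_mx nabla i (y + r *: w) w) <= ode_bound n * K.
  move=> /le01 r01; apply: le_trans (nrmM _ _) _; rewrite nrmN.
  by apply: ler_pM; rewrite ?nrm_ge0//; [exact: (fundXb F)|exact: GK].
have XB : nrm (X s - 1%:M) <= ode_bound n * K.
  have := nrm_mean_value_bound s0 (mulr_ge0 B0 K0) XD XK.
  by rewrite (fundX0 F) subr0 => /le_trans; apply; rewrite ler_piMr// mulr_ge0.
split => //.
have -> : Y s - 1%:M = - (Y s *m (X s - 1%:M)).
  by rewrite mulmxBr mulmx1 (mulmx1C (fundXY F s01)) opprB.
rewrite nrmN; apply: le_trans (nrmM _ _) _; rewrite -mulrA.
by apply: ler_pM; rewrite ?nrm_ge0//; exact: (fundYb F).
Qed.

Variables (x : E) (r : R).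
Hypothesis r0 : 0 < r.
Hypothesis rimg : ball x r `<=` img M i.
Hypothesis rP : forall y w, ball x r y -> `|w| < 2 * r ->
   (forall t : R, t \in `[-1, 2] -> img M i (y + t *: w)) /\
   exists X Y, fundamental (radial y w) X Y.

(** The case w = 0 of the radial family. At t = 0 the coefficient vanishes, so X and Y are 1 and the
    Duhamel integrand is the constant - Gamma(v). *)
Lemma short_segment_derive (y v : E) (e : R) (X Y : R -> R -> 'M[R]_n) :
  0 < e ->
  (forall t s : R, `|t| < e -> s \in `[0, 1] -> img M i (y + s *: (t *: v))) ->
  (forall t : R, `|t| < e -> fundamental (radial y (t *: v)) (X t) (Y t)) ->
  [/\ X 0 1 = 1%:M, Y 0 1 = 1%:M & exists F' : R -> 'M[R]_n, F' 0 = - gamma_mx nabla i y v /\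
    forall t : R, `|t| < e -> is_derive t (1 : R) (X ^~ 1) (F' t) /\ {for t, continuous F'}].
Proof.
move=> e0 yimg F.
have i12 (s : R) : s \in `[0, 1] -> s \in `](-1), 2[.
  by rewrite !in_itv/= => /andP[? ?]; apply/andP; split; lra.
have i11 : (1 : R) \in `[0, 1] by rewrite in_itv/= lexx ler01.
have i00 : (0 : R) \in `[0, 1] by rewrite in_itv/= lexx ler01.
have te0 : `|0 : R| < e by rewrite normr0.
have iy : img M i y by have := yimg 0 0 te0 i00; rewrite scale0r addr0.
have F0 := F 0 te0.
have G0 z : img M i z -> gamma_mx nabla i z 0 = 0.
  by move=> iz; rewrite -(scale0r (0 : E)) gamma_mxZ// scale0r.
have X0E (s : R) : s \in `[0, 1] -> X 0 s = 1%:M.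
  move=> s01; rewrite -(fundX0 F0).
  apply: (@derive0_cst _ _ _ _ 0 1) s01 => a /i12 a01.
  have := fundX F0 a01; rewrite scale0r scaler0 addr0 G0// oppr0 mulmx0.
  exact.
have Y0E (s : R) : s \in `[0, 1] -> Y 0 s = 1%:M.
  by move=> s01; have := fundXY F0 s01; rewrite X0E// mul1mx.
have wE (t : R) : 0 + t *: v = t *: v by rewrite add0r.
have yimg' (t s : R) : `|t| < e -> s \in `[0, 1] -> img M i (y + s *: (0 + t *: v)).
  by rewrite wE; exact: yimg.
have F1 (t : R) : `|t| < e -> fundamental
    (fun s => - gamma_mx nabla i (y + s *: (0 + t *: v)) (0 + t *: v)) (X t) (Y t).
  by rewrite wE; exact: F.
have DG0 : 'D_v (G 0) y = 0.
  rewrite -[RHS](derive_cst (0 : 'M[R]_n) y v); apply: near_eq_derive.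
  by apply: (@open_near _ (img M i) y _ (@img_open _ _ M i) iy) => z iz; rewrite /= G0.
have [F' F'P] := fundamental_param_C1 F1 (radial_derive nabla yimg') (radial_continuous yimg').
split; [exact: X0E|exact: Y0E|exists F'; split].
  have [_ _ [Z [Z0 ZD ->]]] := F'P 0 te0.
  rewrite X0E// mulmx1; apply/eqP; rewrite -subr_eq0 opprK; apply/eqP.
  pose W s := Z s + s *: gamma_mx nabla i y v.
  have WD (s : R) : s \in `[0, 1] -> is_derive s (1 : R) W 0.
    move=> s01; have := is_deriveD (ZD s s01) (is_derive_scalel (gamma_mx nabla i y v) s).
    rewrite X0E// Y0E// mul1mx mulmx1; cbv zeta.
    rewrite !scale0r !addr0 scaler0 addr0 DG0 scaler0 add0r addNr; exact.
  have := derive0_cst WD i11; rewrite /W Z0 !scale0r scale1r addr0; exact.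
by move=> t te; have [? ? _] := F'P t te.
Qed.

(** The ball is convex, so the triangle and its straight contraction to x both stay in the chart. *)
Lemma triangle_loop (w v : E) (X0 X1 Y2 : 'M[R]_n) :
  path_transport nabla i i (segment (M := M) i x w) X0 ->
  path_transport nabla i i (segment (M := M) i (x + w) v) X1 ->
  path_transport nabla i i (segment (M := M) i (x + (w + v)) (- (w + v))) Y2 ->
  ball x r (x + w) -> ball x r (x + (w + v)) ->
  hol (chartV M i x) i (X0 *m (X1 *m Y2)).
Proof.
move=> P0 P1 P2 b1 b2.
have ix : img M i x by apply: rimg; exact: ballxx.
have seg0 y u : segment (M := M) i y u 0 = chartV M i y by rewrite /segment scale0r addr0.
have seg1 y u : segment (M := M) i y u 1 = chartV M i (y + u) by rewrite /segment scale1r.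
apply/restricted_holonomyP; first exact: img_dom.
exists (concat (segment i x w)
  (concat (segment i (x + w) v) (segment i (x + (w + v)) (- (w + v))))).
split.
- by rewrite concat0 seg0.
- by rewrite !concat1 seg1 addrK.
- pose l y u := (fun t : R => y + t *: u : E).
  have l0 y u : l y u 0 = y by rewrite /l scale0r addr0.
  have l1 y u : l y u 1 = y + u by rewrite /l scale1r.
  pose k := concat (l x w) (concat (l (x + w) v) (l (x + (w + v)) (- (w + v)))).
  have cl y u : {within `[0, 1], continuous (l y u)}.
    by apply: continuous_within => t _; exact: line_continuous.
  apply: (@null_homotopic_chart _ _ _ i k x).
  + apply: concat_continuous; [by rewrite concat0 l0 l1|exact: cl|].
    by apply: concat_continuous; [by rewrite l0 l1 addrA|exact: cl|exact: cl].
  + by rewrite /k concat0 l0.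
  + by rewrite /k !concat1 l1 addrK.
  + by move=> t _; rewrite /k -[RHS]/((chartV M i \o _) t) !comp_concat.
  + have cvx (a b : E) (t : R) : ball x r a -> ball x r b -> t \in `[0, 1] ->
        ball x r (a + t *: (b - a)).
      rewrite -!ball_normE /ball_/= in_itv/= => xa xb /andP[t0 t1].
      have -> : x - (a + t *: (b - a)) = (1 - t) *: (x - a) + t *: (x - b).
        by apply/rowP => c; rewrite !mxE; ring.
      apply: le_lt_trans (ler_normD _ _) _; rewrite !normrZ !ger0_norm ?subr_ge0//.
      have [->|tn0] := eqVneq t 0; first by rewrite mul0r addr0 subr0 mul1r.
      have t_gt0 : 0 < t by rewrite lt_neqAle eq_sym tn0.
      have h1 : (1 - t) * `|x - a| <= (1 - t) * r by rewrite ler_wpM2l ?subr_ge0// ltW.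
      have h2 : t * `|x - b| < t * r by rewrite ltr_pM2l.
      by have := ler_ltD h1 h2; rewrite -mulrDl subrK mul1r.
    have bk t : t \in `[0, 1] -> ball x r (k t).
      have lb a b s : ball x r a -> ball x r (a + b) -> s \in `[0, 1] -> ball x r (l a b s).
        move=> ba bb s01; have := cvx a (a + b) s ba bb s01.
        by rewrite [a + b - a]addrC addKr.
      move=> t01; rewrite /k /concat; case: ifPn => t2.
        by apply: lb => //; [exact: ballxx|exact: half_itvl].
      have t01' := half_itvr t01 (ltW (_ : 2^-1 < t)).
      have {}t01' : 2 * t - 1 \in `[0, 1] by apply: t01'; rewrite ltNge.
      case: ifPn => t4.
        by apply: lb; rewrite -?addrA//; exact: half_itvl.
      apply: lb => //; first by rewrite addrK; exact: ballxx.
      by apply: half_itvr => //; rewrite ltW// ltNge.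
    move=> s t s01 t01; apply: rimg; apply: cvx => //; [exact: bk|exact: ballxx].
- apply: path_transport_concat P0 _; first by rewrite concat0 seg0 seg1.
  by apply: path_transport_concat P1 P2; rewrite seg0 seg1 addrA.
Qed.

Lemma fundamental_choice (e : R) (A : R -> R -> 'M[R]_n) :
  (forall t : R, `|t| < e -> exists X Y, fundamental (A t) X Y) ->
  exists X Y : R -> R -> 'M[R]_n, forall t : R, `|t| < e -> fundamental (A t) (X t) (Y t).
Proof.
move=> H; have /choice[XY XYP] : forall t : R, exists XY : (R -> 'M[R]_n) * (R -> 'M[R]_n),
    `|t| < e -> fundamental (A t) XY.1 XY.2.
  move=> t; case: (boolP (`|t| < e)) => [te|_]; last by exists (cst 0, cst 0).
  by have [X [Y F]] := H t te; exists (X, Y).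
by exists (fun t => (XY t).1), (fun t => (XY t).2).
Qed.

(** U 1 is minus the velocity at t = 0 of the holonomy of the triangle. That velocity is - X
    Gamma(v) Y - Z at s = 1, the first term from the moving side x + w, x + w + t v and the second
    from the side back to x; [transported_curvature] recognises the sum as an integral. *)
Lemma triangle_derivative (w v : E) (L : {vspace 'M[R]_n}) : `|w| < r ->
  (forall B, lie_algebra (hol (chartV M i x) i) B -> B \in L) ->
  exists X Y U, [/\ fundamental (radial x w) X Y, U 0 = 0,
    forall s : R, s \in `[0, 1] ->
      is_derive s (1 : R) U (s *: (X s *m curvature_mx nabla i w v (x + s *: w) *m Y s)) &
    U 1 \in L].
Proof.
move=> wr HL; pose e := (r - `|w|) / (`|v| + 1).
have v1 : 0 < `|v| + 1 by rewrite ltr_wpDl.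
have e0 : 0 < e by rewrite divr_gt0// subr_gt0.
have tv (t : R) : `|t| < e -> `|w| + `|t *: v| < r.
  move=> te; rewrite -ltrBrDl normrZ.
  apply: (@le_lt_trans _ _ (`|t| * (`|v| + 1))); first by rewrite ler_wpM2l// lerDl.
  by rewrite -ltr_pdivlMr.
have wtv (t : R) : `|t| < e -> `|w + t *: v| < r.
  by move=> te; apply: le_lt_trans (ler_normD _ _) (tv t te).
have rr2 : r < 2 * r by rewrite ltr_pMl// ltr1n.
have xball y : `|y| < r -> ball x r (x + y).
  by rewrite -ball_normE /ball_/= opprD addrA subrr add0r normrN.
have te0 : `|0 : R| < e by rewrite normr0.
have rP2 (t : R) : `|t| < e -> _ := fun te =>
  rP (ballxx x r0) (lt_trans (wtv t te) rr2).
have rP1 (t : R) : `|t| < e -> _ := fun te =>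
  rP (xball _ wr) (lt_trans (le_lt_trans (ler_wpDl (normr_ge0 w) (lexx _)) (tv t te)) rr2).
have [X2 [Y2 F2]] := fundamental_choice (fun t te => (rP2 t te).2).
have [X1 [Y1 F1]] := fundamental_choice (fun t te => (rP1 t te).2).
have i01 (s : R) : s \in `[0, 1] -> s \in `[-1, 2].
  by rewrite !in_itv/= => /andP[? ?]; apply/andP; split; lra.
have i11 : (1 : R) \in `[0, 1] by rewrite in_itv/= lexx ler01.
have img2 (t s : R) : `|t| < e -> s \in `[0, 1] -> img M i (x + s *: (w + t *: v)).
  by move=> te /i01; exact: (rP2 t te).1.
have img1 (t s : R) : `|t| < e -> s \in `[0, 1] -> img M i (x + w + s *: (t *: v)).
  by move=> te /i01; exact: (rP1 t te).1.
have [X10 Y10 [D1 [D10 D1P]]] := short_segment_derive e0 img1 F1.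
have [D2 D2P] := fundamental_param_C1 F2 (radial_derive nabla img2) (radial_continuous img2).
have [_ _ [Z [Z0 ZD D20]]] := D2P 0 te0.
have near_e (t : R) : `|t| < e -> \forall q \near t, `|q| < e by move=> te; exact: near_lt.
(* The third side is run towards x, so the inverse transport Y2 enters, and its derivative is
   deduced from that of X2. *)
have D2Y (t : R) : `|t| < e -> is_derive t (1 : R) (Y2 ^~ 1) (- (Y2 t 1 *m D2 t *m Y2 t 1)).
  move=> te; have [XD _ _] := D2P t te.
  apply: (is_derive_mx_inverse (K := ode_bound n) (Y := Y2 ^~ 1)) XD.
  - by apply: filterS (near_e t te) => q qe; exact: (fundXY (F2 q qe)).
  - by apply: filterS (near_e t te) => q qe; exact: (fundYb (F2 q qe)).
pose P t := X2 0 1 *m (X1 t 1 *m Y2 t 1).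
pose P' t := X2 0 1 *m (D1 t *m Y2 t 1 + X1 t 1 *m - (Y2 t 1 *m D2 t *m Y2 t 1)).
have PD (t : R) : `|t| < e -> is_derive t (1 : R) P (P' t).
  move=> te; pose LX : {linear 'M[R]_n -> 'M[R]_n} := mulmx (X2 0 1).
  apply: (is_derive_linear_comp LX (f := fun t => X1 t 1 *m Y2 t 1)).
  by apply: is_derive_mulmx; [exact: (D1P t te).1|exact: D2Y].
have P'c (t : R) : `|t| < e -> {for t, continuous P'}.
  move=> te; have FF := nbhs_filter t.
  have cX1 : {for t, continuous (X1 ^~ 1)} by exact: is_derive_continuous (D1P t te).1.
  have cY2 : {for t, continuous (Y2 ^~ 1)} by exact: is_derive_continuous (D2Y t te).
  have [_ cD2 _] := D2P t te; have [_ cD1] := D1P t te.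
  apply: (@cvg_mulmx _ _ (nbhs t) FF); first exact: cvg_cst.
  apply: (@cvgD _ _ _ (nbhs t) FF); apply: (@cvg_mulmx _ _ (nbhs t) FF);
    [exact: cD1|exact: cY2|exact: cX1|].
  apply: (@cvgN _ _ _ (nbhs t) FF).
  apply: (@cvg_mulmx _ _ (nbhs t) FF); last exact: cY2.
  by apply: (@cvg_mulmx _ _ (nbhs t) FF); [exact: cY2|exact: cD2].
have itve (t : R) : t \in `](- e), e[ -> `|t| < e by rewrite in_itv/= ltr_norml.
have F20 := F2 0 te0; rewrite scale0r addr0 in F20.
have P'L : P' 0 \in L.
  apply: HL; exists e, P; split.
  - exact: e0.
  - exact: (C1_of_is_derive (fun t te => PD t (itve t te)) (fun t te => P'c t (itve t te))).
  - move=> t /itve te.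
    have h0 : forall s : R, s \in `[-1, 2] -> img M i (x + s *: w).
      by move=> s s12; have := (rP2 0 te0).1 s s12; rewrite scale0r addr0.
    apply: (@triangle_loop w (t *: v)).
    + exact: (segment_transports h0 F20).1.
    + exact: (segment_transports (rP1 t te).1 (F1 t te)).1.
    + exact: (segment_transports (rP2 t te).1 (F2 t te)).2.
    + exact: xball.
    + exact: xball (wtv t te).
  - have XY := fundXY F20 i11.
    by rewrite /P X10 mul1mx.
  - by have [_] := PD 0 te0.
exists (X2 0), (Y2 0), (fun s => s *: (X2 0 s *m gamma_mx nabla i (x + s *: w) v *m Y2 0 s) + Z s).
split.
- exact: F20.
- by rewrite scale0r add0r Z0.
- move=> s s01; apply: transported_curvature => //.
    by have := img2 0 s te0 s01; rewrite scale0r addr0.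
  have := ZD s s01; cbv zeta; rewrite !scale0r !addr0; exact.
- have XY := fundXY F20 i11.
  move: P'L; rewrite /P' D10 X10 mul1mx D20 -memvN !mulmxA.
  have -> : - (X2 0 1 *m (- gamma_mx nabla i (x + w) v *m Y2 0 1 -
      Y2 0 1 *m Z 1 *m X2 0 1 *m Y2 0 1))
    = X2 0 1 *m gamma_mx nabla i (x + w) v *m Y2 0 1 + Z 1.
    have id2 (A B C D : 'M[R]_n) : A *m B = 1%:M ->
        - (A *m (- C *m B - B *m D *m A *m B)) = A *m C *m B + D.
      move=> AB; rewrite mulmxBr mulNmx mulmxN opprB opprK addrC !mulmxA AB mul1mx.
      by rewrite -[D *m A *m B]mulmxA AB mulmx1.
    exact: id2.
  by rewrite !scale1r.
Qed.

(** For w = eps u the integral U 1 is eps times the integral of s X R(u, v) Y, that is, about (eps /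
    2) R(u, v) at x; hence the approximant (2 / eps) U 1, which lies in L. *)
Lemma curvature_holonomy (u v : E) (L : {vspace 'M[R]_n}) :
  (forall B, lie_algebra (hol (chartV M i x) i) B -> B \in L) ->
  curvature_mx nabla i u v x \in L.
Proof.
move=> HL; have ix : img M i x by apply: rimg; exact: ballxx.
set C := curvature_mx nabla i u v; apply: vspace_limit => d d0.
pose b : R := ode_bound n; pose c := nrm (C x) + 1; pose k := nrm (gamma_mx nabla i x u) + 1.
have b0 : 0 <= b by rewrite mulr_ge0// nrm_ge0.
have c0 : 0 <= c by rewrite addr_ge0// nrm_ge0.
have k0 : 0 <= k by rewrite addr_ge0// nrm_ge0.
(* Here b bounds the transports, c the curvature near x, and eps k the connection along the segment;
   m eps then bounds the error made in replacing either X or Y by 1. *)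
pose m := b * b * c * k.
have m0 : 0 <= m by rewrite !mulr_ge0.
have near_d (f : E -> 'M[R]_n) (a : R) : 0 < a -> {for x, continuous f} ->
    exists2 q : R, 0 < q & forall y, `|y| < q -> nrm (f (x + y) - f x) <= a.
  move=> a0 /nrm_cvg/(_ _ a0)/nbhs_ballP[q /= q0 qP]; exists q => // y yq.
  by apply: qP; rewrite -ball_normE /ball_/= opprD addrA subrr add0r normrN.
have cC : {for x, continuous C} by exact: curvature_mx_continuous.
have cG : {for x, continuous (G u)} by exact: gamma_mx_continuous.
have nrmB (A B : 'M[R]_n) : nrm A - nrm B <= nrm (A - B).
  by rewrite lerBlDr -{1}(subrK B A); exact: nrmD.
have d4 : 0 < d / 4 by rewrite divr_gt0.
have [q1 q10 Q1] := near_d _ _ d4 cC.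
have [q2 q20 Q2] := near_d _ _ ltr01 cC.
have [q3 q30 Q3] := near_d _ _ ltr01 cG.
pose q := Num.min (Num.min q1 q2) (Num.min q3 r).
have q0 : 0 < q by rewrite !lt_min q10 q20 q30.
(* The first term keeps the segment where the three continuity estimates hold; the second makes both
   transport errors together at most d / 4. *)
pose eps := Num.min (q / (2 * (`|u| + 1))) (d / (8 * (m + 1))).
have u1 : 0 < `|u| + 1 by rewrite ltr_wpDl.
have m1 : 0 < m + 1 by rewrite ltr_wpDl.
have eps0 : 0 < eps by rewrite lt_min !divr_gt0// mulr_gt0.
have eu : `|eps *: u| < q.
  rewrite normrZ gtr0_norm//; apply: (@lt_le_trans _ _ (eps * (2 * (`|u| + 1)))).
    by rewrite ltr_pM2l//; have := normr_ge0 u; lra.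
  by rewrite -ler_pdivlMr ?mulr_gt0// ge_min lexx.
have em : 2 * (m * eps) <= d / 4.
  have : eps * (8 * (m + 1)) <= d by rewrite -ler_pdivlMr ?mulr_gt0// ge_min lexx orbT.
  by rewrite mulrC; nra.
have seu (s : R) : s \in `[0, 1] -> `|s *: (eps *: u)| < q.
  rewrite in_itv/= => /andP[s0 s1]; rewrite normrZ ger0_norm//.
  by apply: le_lt_trans eu; rewrite ler_piMl.
have sq (s : R) : s \in `[0, 1] -> [/\ `|s *: (eps *: u)| < q1, `|s *: (eps *: u)| < q2,
    `|s *: (eps *: u)| < q3 & `|s *: (eps *: u)| < r].
  by move=> /seu; rewrite !lt_min => /andP[/andP[? ?] /andP[? ?]]; split.
have eur : `|eps *: u| < r by have := eu; rewrite !lt_min => /andP[_ /andP[]].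
have [X [Y [U [F U0 UD U1]]]] := triangle_derivative v eur HL.
have GK (s : R) : s \in `[0, 1] ->
    nrm (gamma_mx nabla i (x + s *: (eps *: u)) (eps *: u)) <= eps * k.
  move=> /sq[_ _ s3 sr].
  rewrite gamma_mxZ; last first.
    by apply: rimg; rewrite -ball_normE /ball_/= opprD addrA subrr add0r normrN.
  rewrite nrmZ gtr0_norm// ler_pM2l// /k -lerBlDl.
  exact: le_trans (nrmB _ _) (Q3 _ s3).
have XY1 := fundamental_near_id (mulr_ge0 (ltW eps0) k0) F GK.
(* The term s^2 C(x) has derivative 2 s C(x), so W' measures only how far the transported curvature
   is from C(x); W 1 is the error to be bounded. *)
pose W (s : R) := (2 / eps) *: U s - (s * s) *: C x.
pose W' (s : R) := (2 * s) *: (X s *m C (x + s *: (eps *: u)) *m Y s - C x).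
have WD (s : R) : s \in `[0, 1] -> is_derive s (1 : R) W (W' s).
  move=> s01; have [_ _ _ sr] := sq s s01.
  have ip : img M i (x + s *: (eps *: u)).
    by apply: rimg; rewrite -ball_normE /ball_/= opprD addrA subrr add0r normrN.
  have H1 := is_deriveZ (2 / eps) (UD s s01).
  have H2 := is_derive_scale_id (is_derive_scalel (C x) s).
  have := is_deriveB H1 H2.
  rewrite (_ : _ - _ = W' s); last first.
    rewrite /W' curvature_mxZl// -scalemxAr -scalemxAl !scalerA scalerBr.
    congr (_ - _); last by rewrite -scalerDl; congr (_ *: _); rewrite mulr2n; ring.
    by congr (_ *: _); field; rewrite gt_eqF.
  apply: near_eq_is_derive; near=> t; rewrite /W /=.
  by congr (_ - _); rewrite scalerA.
have WK (s : R) : s \in `[0, 1] -> nrm (W' s) <= d.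
  move=> s01; have [s1 s2 _ _] := sq s s01; have [X1 Y1] := XY1 s s01.
  move: (s01); rewrite in_itv/= => /andP[s_ge0 s_le1].
  rewrite /W'; set p := x + _.
  have Cp : nrm (C p) <= c.
    rewrite /c -lerBlDl; exact: le_trans (nrmB _ _) (Q2 _ s2).
  have -> : X s *m C p *m Y s - C x =
      (X s - 1%:M) *m C p *m Y s + C p *m (Y s - 1%:M) + (C p - C x).
    have id6 (A B D H : 'M[R]_n) : A *m B *m D - H =
        (A - 1%:M) *m B *m D + B *m (D - 1%:M) + (B - H).
      by rewrite !(mulmxBl, mulmxBr) mul1mx mulmx1 !addrA !subrK.
    exact: id6.
  rewrite nrmZ ger0_norm ?mulr_ge0//.
  have h1 : nrm ((X s - 1%:M) *m C p *m Y s) <= m * eps.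
    apply: le_trans (nrmM _ _) _.
    have <- : b * (eps * k) * c * b = m * eps by rewrite /m; ring.
    apply: ler_pM; rewrite ?nrm_ge0//; last exact: (fundYb F).
    by apply: le_trans (nrmM _ _) _; apply: ler_pM; rewrite ?nrm_ge0.
  have h2 : nrm (C p *m (Y s - 1%:M)) <= m * eps.
    apply: le_trans (nrmM _ _) _.
    have <- : c * (b * b * (eps * k)) = m * eps by rewrite /m; ring.
    by apply: ler_pM; rewrite ?nrm_ge0.
  have h3 := Q1 _ s1.
  have h : nrm ((X s - 1%:M) *m C p *m Y s + C p *m (Y s - 1%:M) + (C p - C x)) <= d / 2.
    apply: le_trans (nrmD _ _) _; have := nrmD ((X s - 1%:M) *m C p *m Y s) (C p *m (Y s - 1%:M)).
    rewrite -/p in h3; lra.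
  have := nrm_ge0 ((X s - 1%:M) *m C p *m Y s + C p *m (Y s - 1%:M) + (C p - C x)).
  by nra.
exists ((2 / eps) *: U 1); first exact: memvZ.
have := nrm_mean_value_bound ler01 (ltW d0) WD WK.
rewrite /W U0 !scaler0 mulr1 mulr0 scale0r scale1r !subr0 mulr1; exact.
Unshelve. all: by end_near. Qed.

End CurvatureInHolonomy.

(** * Bianchi identities *)

Section BianchiAlgebra.
Context {R : realType} {n : nat}.
Local Notation E := 'rV[R]_n.

(** [Duv] stands for the derivative of Gamma(v) in direction u. The hypotheses are the symmetry of
    Gamma, i.e. vanishing torsion, and its derivatives; under them the terms cancel in pairs. *)
Lemma first_Bianchi_algebra (u v w : E) (Gu Gv Gw Duv Dvu Dvw Dwv Dwu Duw : 'M[R]_n) :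
  w *m Duv = v *m Duw -> w *m Dvu = u *m Dvw -> u *m Dwv = v *m Dwu ->
  w *m Gv = v *m Gw -> w *m Gu = u *m Gw -> u *m Gv = v *m Gu ->
  w *m (Duv - Dvu + (Gv *m Gu - Gu *m Gv)) +
  u *m (Dvw - Dwv + (Gw *m Gv - Gv *m Gw)) +
  v *m (Dwu - Duw + (Gu *m Gw - Gw *m Gu)) = 0.
Proof.
move=> H1 H2 H3 H4 H5 H6; rewrite !(mulmxDr, mulmxN) !mulmxA H1 H2 H3 H4 H5 H6.
have id6 (a b c d e f : E) :
    a - b + (d - e) + (b - c + (e - f)) + (c - a + (f - d)) = 0.
  by apply/rowP => k; rewrite !mxE; ring.
exact: id6.
Qed.

(** The correction terms of the covariant derivative regroup into instances of the first Bianchi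
    identity: one multiplied by G on the right, and three in which u, v or w is replaced by its
    image under G. *)
Lemma nabla_first_Bianchi_algebra (u v w : E)
    (G D1 D2 D3 C1 C2 C3 Au Av Bv Bw Cw Cu : 'M[R]_n) :
  w *m D1 + u *m D2 + v *m D3 = 0 -> w *m C1 + u *m C2 + v *m C3 = 0 ->
  w *m Au + u *m G *m C2 + v *m Cu = 0 -> w *m Av + u *m Bv + v *m G *m C3 = 0 ->
  w *m G *m C1 + u *m Bw + v *m Cw = 0 ->
  w *m (D1 + (C1 *m G - G *m C1) - (Au + Av)) +
  u *m (D2 + (C2 *m G - G *m C2) - (Bv + Bw)) +
  v *m (D3 + (C3 *m G - G *m C3) - (Cw + Cu)) = 0.
Proof.
move=> H1 /(congr1 (fun a => a *m G)); rewrite !mulmxDl mul0mx => H2 H3 H4 H5.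
rewrite !(mulmxDr, mulmxN) !mulmxA.
have id15 (a1 a2 a3 b1 b2 b3 c1 c2 c3 d1 d2 d3 e1 e2 e3 : E) :
    a1 + a2 + a3 = 0 -> b1 + b2 + b3 = 0 -> c1 + c2 + c3 = 0 -> d1 + d2 + d3 = 0 ->
    e1 + e2 + e3 = 0 ->
    a1 + (b1 - e1) - (c1 + d1) + (a2 + (b2 - c2) - (d2 + e2)) + (a3 + (b3 - d3) - (e3 + c3)) = 0.
  move=> H6 H7 H8 H9 H10; apply/rowP => k.
  move: H6 H7 H8 H9 H10 => /rowP/(_ k) + /rowP/(_ k) + /rowP/(_ k) + /rowP/(_ k) + /rowP/(_ k).
  by rewrite !mxE; lra.
exact: id15.
Qed.

(** The H are second derivatives of Gamma, equal in pairs by Schwarz. A, B and C are curvatures with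
    an argument of the form Gamma(z, u), which coincide up to sign by vanishing torsion. The rest is
    the Jacobi identity and its differentiated terms. *)
Lemma second_Bianchi_algebra (Gz Gu Gv Dzu Duz Duv Dvu Dvz Dzv : 'M[R]_n)
    (Hzuv Huzv Hzvu Hvzu Huvz Hvuz A B C : 'M[R]_n) :
  Huzv = Hzuv -> Hvzu = Hzvu -> Hvuz = Huvz ->
  let Cuv := Duv - Dvu + (Gv *m Gu - Gu *m Gv) in
  let Cvz := Dvz - Dzv + (Gz *m Gv - Gv *m Gz) in
  let Czu := Dzu - Duz + (Gu *m Gz - Gz *m Gu) in
  Hzuv - Hzvu + (Dzv *m Gu + Gv *m Dzu - (Dzu *m Gv + Gu *m Dzv)) + (Cuv *m Gz - Gz *m Cuv) -
    (A - B) +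
  (Huvz - Huzv + (Duz *m Gv + Gz *m Duv - (Duv *m Gz + Gv *m Duz)) + (Cvz *m Gu - Gu *m Cvz) -
    (C - A)) +
  (Hvzu - Hvuz + (Dvu *m Gz + Gu *m Dvz - (Dvz *m Gu + Gz *m Dvu)) + (Czu *m Gv - Gv *m Czu) -
    (B - C)) = 0.
Proof.
move=> -> -> -> Cuv Cvz Czu; rewrite /Cuv /Cvz /Czu.
rewrite !(mulmxDl, mulmxDr, mulmxN, mulNmx) !mulmxA.
(* The noncommutative products become atoms, after which the identity is linear and can be checked
   on entries. *)
set m1 := Dzv *m _; set m2 := Gv *m Dzu; set m3 := Dzu *m Gv; set m4 := Gu *m Dzv.
set m5 := Duz *m _; set m6 := Gz *m Duv; set m7 := Duv *m Gz; set m8 := Gv *m Duz.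
set m9 := Dvu *m _; set m10 := Gu *m Dvz; set m11 := Dvz *m Gu; set m12 := Gz *m Dvu.
set c1 := Gu *m Gv *m Gz; set c2 := Gu *m Gz *m Gv; set c3 := Gv *m Gu *m Gz.
set c4 := Gv *m Gz *m Gu; set c5 := Gz *m Gu *m Gv; set c6 := Gz *m Gv *m Gu.
move: m1 m2 m3 m4 m5 m6 m7 m8 m9 m10 m11 m12 c1 c2 c3 c4 c5 c6.
move=> m1 m2 m3 m4 m5 m6 m7 m8 m9 m10 m11 m12 c1 c2 c3 c4 c5 c6.
by apply/matrixP => k l; rewrite !mxE; ring.
Qed.

End BianchiAlgebra.

Section CurvatureDerivative.
Context {R : realType} {n : nat} {M : manifold R n} (nabla : connection M).
Local Notation E := 'rV[R]_n.
Local Notation hol := (restricted_holonomy_group nabla).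
Variable i : mindex M.
Local Notation G := (fun w x => gamma_mx nabla i x w).
Local Notation C := (curvature_mx nabla i).

Definition derive_curvature_mx (z u v x : E) : 'M[R]_n :=
  'D_z ('D_u (G v)) x - 'D_z ('D_v (G u)) x +
  ('D_z (G v) x *m G u x + G v x *m 'D_z (G u) x -
   ('D_z (G u) x *m G v x + G u x *m 'D_z (G v) x)).

Definition nabla_curvature_mx (z u v x : E) : 'M[R]_n :=
  derive_curvature_mx z u v x + (C u v x *m G z x - G z x *m C u v x) -
  (C (u *m G z x) v x + C u (v *m G z x) x).

Lemma is_derive_derive_gamma_mx z u v x : img M i x ->
  is_derive x z ('D_u (G v)) ('D_z ('D_u (G v)) x).
Proof.
move=> ix; have [_ H] := gamma_mx_Ck nabla 2 i v; have [Hd _] := H u.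
by apply: DeriveDef => //; apply: diff_derivable; exact: Hd.
Qed.

Lemma is_derive_curvature_mx z u v x : img M i x ->
  is_derive x z (C u v) (derive_curvature_mx z u v x).
Proof.
move=> ix.
have H1 a b := is_derive_derive_gamma_mx z a b ix.
have H0 a := is_derive_gamma_mx nabla a z ix.
exact: (is_deriveD (is_deriveB (H1 u v) (H1 v u))
  (is_deriveB (is_derive_mulmx (H0 v) (H0 u)) (is_derive_mulmx (H0 u) (H0 v)))).
Qed.

Lemma curvature_mx_linear a u u' v x : img M i x ->
  C (a *: u + u') v x = a *: C u v x + C u' v x.
Proof.
move=> ix; rewrite /curvature_mx derive_gamma_mxD// derive_gamma_mxZ// gamma_mxD// gamma_mxZ//.
have dG := gamma_mx_differentiable nabla v ix.
have DE z : 'D_z (G v) x = 'd (G v) x z by exact: deriveE.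
rewrite (DE (a *: u + u')) (DE u) (DE u') linearP.
have id5 (A A' B B' F H H' : 'M[R]_n) :
    a *: A + A' - (a *: B + B') + (F *m (a *: H + H') - (a *: H + H') *m F) =
    a *: (A - B + (F *m H - H *m F)) + (A' - B' + (F *m H' - H' *m F)).
  rewrite mulmxDl mulmxDr -scalemxAl -scalemxAr.
  move: (F *m H) (H *m F) (F *m H') (H' *m F) => p q p' q'.
  by apply/matrixP => k l; rewrite !mxE; ring.
exact: id5.
Qed.

(** The equivalence at nearby points y is essential: curvature is known to lie in every subspace
    that contains the holonomy algebra, whereas transport back to x applies to elements of that
    algebra itself. *)
Lemma nabla_curvature_holonomy (L : {vspace 'M[R]_n}) z u v x : img M i x ->
  (forall y, img M i y -> exists Ly : {vspace 'M[R]_n},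
     forall B, B \in Ly <-> lie_algebra (hol (chartV M i y) i) B) ->
  (forall B, lie_algebra (hol (chartV M i x) i) B -> B \in L) ->
  nabla_curvature_mx z u v x \in L.
Proof.
move=> ix HL Lx.
have C_in y a b (Ly : {vspace 'M[R]_n}) : img M i y ->
    (forall B, lie_algebra (hol (chartV M i y) i) B -> B \in Ly) -> C a b y \in Ly.
  move=> iy; have [r [r0 rimg rP]] := local_fundamental nabla iy.
  exact: curvature_holonomy r0 rimg rP _ _ _.
(* The corrections in the slots u and v are themselves values of the curvature at x. The remaining
   terms form the derivative at t = 0 of the curvature at x + t z transported back to x, since there
   X' = - Gamma(z) and Y' = Gamma(z). *)
apply: memvB; last by apply: memvD; apply: C_in.
have [r [r0 rimg rP]] := local_fundamental nabla ix.
pose e := r / (`|z| + 1).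
have z1 : 0 < `|z| + 1 by rewrite ltr_wpDl.
have e0 : 0 < e by rewrite divr_gt0.
have tz (t : R) : `|t| < e -> `|t *: z| < 2 * r.
  move=> te; rewrite normrZ; apply: (@le_lt_trans _ _ (`|t| * (`|z| + 1))).
    by rewrite ler_wpM2l// lerDl.
  rewrite -ltr_pdivlMr//; apply: lt_trans te _.
  by rewrite /e ltr_pM2r ?invr_gt0// ltr_pMl// ltr1n.
have rPz (t : R) : `|t| < e -> _ := fun te => rP x (t *: z) (ballxx x r0) (tz t te).
have [X [Y F]] := fundamental_choice (fun t te => (rPz t te).2).
have i01 (s : R) : s \in `[0, 1] -> s \in `[-1, 2].
  by rewrite !in_itv/= => /andP[? ?]; apply/andP; split; lra.
have i11 : (1 : R) \in `[0, 1] by rewrite in_itv/= lexx ler01.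
have imgz (t s : R) : `|t| < e -> s \in `[0, 1] -> img M i (x + s *: (t *: z)).
  by move=> te /i01; exact: (rPz t te).1.
have te0 : `|0 : R| < e by rewrite normr0.
have [X0 Y0 [D [D0 DP]]] := short_segment_derive e0 imgz F.
have near_e : \forall q \near (0 : R), `|q| < e by exact: near_lt.
have XD : is_derive (0 : R) (1 : R) (X ^~ 1) (- G z x) by rewrite -D0; exact: (DP 0 te0).1.
have YD : is_derive (0 : R) (1 : R) (Y ^~ 1) (G z x).
  have -> : G z x = - (Y 0 1 *m (- G z x) *m Y 0 1) by rewrite Y0 mul1mx mulmx1 opprK.
  apply: (is_derive_mx_inverse (K := ode_bound n) (Y := Y ^~ 1)) XD.
  - by apply: filterS near_e => q qe; exact: (fundXY (F q qe)).
  - by apply: filterS near_e => q qe; exact: (fundYb (F q qe)).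
have CD : is_derive (0 : R) (1 : R) (fun t : R => C u v (x + t *: z)) (derive_curvature_mx z u v x).
  apply: (@is_derive_line _ _ _ (C u v)); rewrite scale0r addr0; exact: is_derive_curvature_mx.
have PD := is_derive_mulmx (is_derive_mulmx XD CD) YD.
rewrite X0 Y0 mul1mx mulmx1 mul1mx scale0r addr0 in PD.
have id4 (a b c : 'M[R]_n) : a + (b *m c - c *m b) = - c *m b + a + b *m c.
  by rewrite mulNmx addrA addrAC [a - _]addrC.
rewrite id4.
apply: (vspace_derive _ PD); apply: filterS near_e => t te.
have it : img M i (x + t *: z) by have := imgz t 1 te i11; rewrite scale1r.
have [Lt LtP] := HL _ it; apply: Lx.
apply: lie_algebra_conj (mulmx1C (fundXY (F t te) i11)) _ _.
  by move=> P; exact: (holonomy_segment P (rPz t te).1 (F t te)).1.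
by apply/LtP; apply: C_in => // B /LtP.
Qed.

Lemma curvature_mxE u v w x : img M i x -> w *m C u v x = curvature nabla i u v w x.
Proof.
move=> ix.
have covE a b : covD nabla i (cst a) (covD nabla i (cst b) (cst w)) x =
    w *m 'D_a (G b) x + w *m G b x *m G a x.
  rewrite /covD /= derive_cst add0r -!mul_gamma_mx//; congr (_ + _).
  have := is_derive_mulmx (is_derive_cst w x a) (is_derive_gamma_mx nabla b a ix).
  rewrite mul0mx add0r => -[_ <-]; apply: near_eq_derive.
  apply: (@open_near _ (img M i) x _ (@img_open _ _ M i) ix) => y iy.
  by rewrite derive_cst add0r mul_gamma_mx.
rewrite /curvature !covE /curvature_mx !(mulmxDr, mulmxN) !mulmxA.
by rewrite opprD addrACA.
Qed.

Lemma nabla_curvature_mxE z u v w x : img M i x ->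
  w *m nabla_curvature_mx z u v x = nabla_curvature nabla i z u v w x.
Proof.
move=> ix; rewrite /nabla_curvature.
have covE a : covD nabla i (cst z) (cst a) x = a *m G z x.
  by rewrite /covD derive_cst add0r mul_gamma_mx.
rewrite !covE.
have -> : covD nabla i (cst z) (curvature nabla i u v w) x =
    w *m derive_curvature_mx z u v x + w *m C u v x *m G z x.
  rewrite /covD /= -mul_gamma_mx// curvature_mxE//; congr (_ + _).
  have := is_derive_mulmx (is_derive_cst w x z) (is_derive_curvature_mx z u v ix).
  rewrite mul0mx add0r => -[_ <-]; apply: near_eq_derive.
  apply: (@open_near _ (img M i) x _ (@img_open _ _ M i) ix) => y iy.
  by rewrite curvature_mxE.
rewrite -!curvature_mxE// /nabla_curvature_mx.
have id7 (a b c d f : 'M[R]_n) : w *m (a + (b *m c - c *m b) - (d + f)) =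
    w *m a + w *m b *m c - w *m d - w *m f - w *m c *m b.
  rewrite !(mulmxDr, mulmxN) !mulmxA.
  have id5 (p q r s t : E) : p + (q - r) - (s + t) = p + q - s - t - r.
    by apply/rowP => k; rewrite !mxE; ring.
  exact: id5.
exact: id7.
Qed.

Hypothesis nabla_torsion_free : torsion_free nabla.

Lemma gamma_mx_sym x u v : img M i x -> v *m G u x = u *m G v x.
Proof.
move=> ix; have := nabla_torsion_free ix u v.
by rewrite /torsion /covD /= !derive_cst !add0r -!mul_gamma_mx// => /subr0_eq.
Qed.

Lemma derive_gamma_mx_sym x z u v : img M i x -> v *m 'D_z (G u) x = u *m 'D_z (G v) x.
Proof.
move=> ix.
have H a (b : E) := is_derive_mulmx (is_derive_cst b x z) (is_derive_gamma_mx nabla a z ix).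
have [_] := H u v; have [_] := H v u; rewrite !mul0mx !add0r => <- <-.
apply: near_eq_derive.
apply: (@open_near _ (img M i) x _ (@img_open _ _ M i) ix) => y iy.
exact: gamma_mx_sym.
Qed.

Lemma curvature_mx_skew u v x : C u v x = - C v u x.
Proof. by rewrite /curvature_mx opprD !opprB. Qed.

Lemma first_Bianchi x u v w : img M i x ->
  w *m C u v x + u *m C v w x + v *m C w u x = 0.
Proof.
move=> ix; have S := gamma_mx_sym _ _ ix; have DS z a b := derive_gamma_mx_sym z a b ix.
exact: first_Bianchi_algebra (DS _ _ _) (DS _ _ _) (DS _ _ _) (S _ _) (S _ _) (S _ _).
Qed.

Lemma derive_curvature_mx_skew z u v x :
  derive_curvature_mx z u v x = - derive_curvature_mx z v u x.
Proof.
have id6 (a b c d e f : 'M[R]_n) : a - b + (c + d - (e + f)) = - (b - a + (e + f - (c + d))).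
  by rewrite [RHS]opprD !opprB.
exact: id6.
Qed.

Lemma nabla_curvature_mx_skew z u v x :
  nabla_curvature_mx z u v x = - nabla_curvature_mx z v u x.
Proof.
rewrite /nabla_curvature_mx (derive_curvature_mx_skew z v u).
rewrite (curvature_mx_skew v u) (curvature_mx_skew (v *m _)) (curvature_mx_skew v).
have id5 (a b c d e : 'M[R]_n) :
    a + (b *m c - c *m b) - (d + e) = - (- a + (- b *m c - c *m - b) - (- e - d)).
  rewrite mulNmx mulmxN; move: (b *m c) (c *m b) => p q.
  by apply/matrixP => k l; rewrite !mxE; ring.
exact: id5.
Qed.

Lemma derive_first_Bianchi x z u v w : img M i x ->
  w *m derive_curvature_mx z u v x + u *m derive_curvature_mx z v w x +
  v *m derive_curvature_mx z w u x = 0.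
Proof.
move=> ix.
have H a b (c : E) : is_derive x z (fun y => c *m C a b y) (c *m derive_curvature_mx z a b x).
  pose L : {linear 'M[R]_n -> E} := mulmx c.
  exact: (is_derive_linear_comp L (is_derive_curvature_mx z a b ix)).
have [_ <-] := is_deriveD (is_deriveD (H u v w) (H v w u)) (H w u v).
rewrite -[RHS](derive_cst (0 : E) x z); apply: near_eq_derive.
apply: (@open_near _ (img M i) x _ (@img_open _ _ M i) ix) => y iy.
exact: first_Bianchi.
Qed.

Lemma nabla_first_Bianchi x z u v w : img M i x ->
  w *m nabla_curvature_mx z u v x + u *m nabla_curvature_mx z v w x +
  v *m nabla_curvature_mx z w u x = 0.
Proof.
move=> ix; apply: nabla_first_Bianchi_algebra; first exact: derive_first_Bianchi.
- exact: first_Bianchi.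
- exact: first_Bianchi.
- exact: first_Bianchi.
- exact: first_Bianchi.
Qed.

Lemma nabla_second_Bianchi x z u v : img M i x ->
  nabla_curvature_mx z u v x + nabla_curvature_mx u v z x + nabla_curvature_mx v z u x = 0.
Proof.
move=> ix; rewrite /nabla_curvature_mx.
rewrite (curvature_mx_skew u (v *m _)) (curvature_mx_skew v (z *m _)).
rewrite (curvature_mx_skew z (u *m _)).
have S := gamma_mx_sym _ _ ix.
rewrite (S v z) (S z u) (S u v) /derive_curvature_mx.
have oU : open (img M i) by exact: img_open.
have W a b c : 'D_a ('D_b (G c)) x = 'D_b ('D_a (G c)) x.
  exact: Schwarz oU ix (gamma_mx_Ck nabla 2 i c).
exact: second_Bianchi_algebra (W _ _ _) (W _ _ _) (W _ _ _).
Qed.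

End CurvatureDerivative.

Section NablaLinear.
Context {R : realType} {n : nat} {M : manifold R n} (nabla : connection M).
Local Notation E := 'rV[R]_n.
Variable i : mindex M.

Lemma derive_curvature_mx_linear z v x a u u' : img M i x ->
  derive_curvature_mx nabla i z (a *: u + u') v x =
  a *: derive_curvature_mx nabla i z u v x + derive_curvature_mx nabla i z u' v x.
Proof.
move=> ix.
have H b := is_derive_curvature_mx nabla z b v ix.
have [_ <-] := H (a *: u + u').
have [_ <-] := is_deriveD (is_deriveZ a (H u)) (H u').
apply: near_eq_derive.
apply: (@open_near _ (img M i) x _ (@img_open _ _ M i) ix) => y iy.
exact: curvature_mx_linear.
Qed.

Lemma nabla_curvature_mx_linear z v x a u u' : img M i x ->
  nabla_curvature_mx nabla i z (a *: u + u') v x =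
  a *: nabla_curvature_mx nabla i z u v x + nabla_curvature_mx nabla i z u' v x.
Proof.
move=> ix; rewrite /nabla_curvature_mx derive_curvature_mx_linear//.
have -> : (a *: u + u') *m gamma_mx nabla i x z =
    a *: (u *m gamma_mx nabla i x z) + u' *m gamma_mx nabla i x z.
  by rewrite mulmxDl scalemxAl.
rewrite !curvature_mx_linear//.
have id5 (A A' B B' G D D' F F' : 'M[R]_n) :
   a *: A + A' + ((a *: B + B') *m G - G *m (a *: B + B')) - (a *: D + D' + (a *: F + F')) =
   a *: (A + (B *m G - G *m B) - (D + F)) + (A' + (B' *m G - G *m B') - (D' + F')).
  rewrite mulmxDl mulmxDr -scalemxAl -scalemxAr.
  move: (B *m G) (G *m B) (B' *m G) (G *m B') => p q p' q'.
  by apply/matrixP => k l; rewrite !mxE; ring.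
exact: id5.
Qed.

End NablaLinear.

(** * The algebraic argument on V1 and V2 *)

Section FirstProlongation.
Context {R : realType} {V : vectType R}.
Variables (g : {vspace 'End(V)}) (V1 V2 : {vspace V}).
Hypothesis V12_sum : (V1 + V2)%VS = fullv.
Hypothesis V12_direct : (V1 :&: V2)%VS = 0%VS.
Hypotheses (V1_invariant : invariant_subspace g V1) (V2_invariant : invariant_subspace g V2).
Hypotheses (V1_faithful : faithful_on g V1) (V2_faithful : faithful_on g V2).

Lemma lfun_of_linear (aT rT : vectType R) (f : aT -> rT) : linear f ->
  exists F : 'Hom(aT, rT), forall x, F x = f x.
Proof.
move=> fL; pose f' : {linear aT -> rT} := HB.pack f (GRing.isLinear.Build _ _ _ _ _ fL).
by exists (linfun f') => x; rewrite lfunE.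
Qed.

Lemma invariant_mem (W : {vspace V}) A x : invariant_subspace g W -> A \in g -> x \in W ->
  A x \in W.
Proof. by move=> gW Ag xW; apply: (subvP (gW _ Ag)); exact: memv_img. Qed.

(** T abstracts the covariant derivative of the curvature at one point, with T z u v in the place of
    (nabla_z R)(u, v); the argument uses nothing of the geometry but these properties. *)
Variable T : V -> V -> V -> 'End(V).
Hypothesis T_in : forall z u v, T z u v \in g.
Hypothesis T_linear : forall z v, linear (fun u => T z u v).
Hypothesis T_skew : forall z u v, T z u v = - T z v u.
Hypothesis T_Bianchi1 : forall z u v w, T z u v w + T z v w u + T z w u v = 0.
Hypothesis T_Bianchi2 : forall z u v, T z u v + T u v z + T v z u = 0.

Lemma T_linear3 z u : linear (T z u).
Proof.
move=> a v v'; rewrite T_skew [T z u v]T_skew [T z u v']T_skew T_linear.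
by rewrite opprD scalerN.
Qed.

(** The second Bianchi identity moves the direction z into the other two slots, where linearity is
    known. *)
Lemma T_linear1 u v : linear (fun z => T z u v).
Proof.
move=> a z z'.
have H y : T y u v = - (T u v y + T v y u).
  by apply/eqP; rewrite -subr_eq0 opprK addrA T_Bianchi2.
rewrite !H T_linear3 T_linear scalerN -opprD scalerDr; congr (- _).
by rewrite addrACA.
Qed.

Lemma T_vanish (W W' : {vspace V}) : invariant_subspace g W -> invariant_subspace g W' ->
  faithful_on g W' -> (W :&: W')%VS = 0%VS ->
  forall z x y, x \in W -> y \in W -> T z x y = 0.
Proof.
move=> gW gW' fW' WW' z x y xW yW; apply: fW' => // w wW'.
apply/eqP; rewrite -memv0 -WW' memv_cap; apply/andP; split; last exact: invariant_mem.
have -> : T z x y w = - (T z y w x + T z w x y).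
  by apply/eqP; rewrite -subr_eq0 opprK addrA T_Bianchi1.
by rewrite memvN memvD//; exact: invariant_mem.
Qed.

Lemma k1_g_neq0 z0 u0 v0 : T z0 u0 v0 != 0 -> k1_g g V1 V2 <> [set 0].
Proof.
move=> T0 k0.
have T11 := T_vanish V1_invariant V2_invariant V2_faithful V12_direct.
have T22 : forall z x y, x \in V2 -> y \in V2 -> T z x y = 0.
  by apply: T_vanish V2_invariant V1_invariant V1_faithful _; rewrite capvC.
(* The restriction of T is packed into nested spaces of linear maps one argument at a time, from the
   inside out; each level uses linearity in its own variable. *)
have H1 v (x : subvs_of V1) : exists F : 'Hom(subvs_of V2, 'End(V)),
    forall y, F y = T v (vsval x) (vsval y).
  by apply: lfun_of_linear => a y y'; rewrite linearP T_linear3.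
pose F1 v x := sval (cid (H1 v x)).
have F1E v x y : F1 v x y = T v (vsval x) (vsval y) := svalP (cid (H1 v x)) y.
have H2 v : exists F : 'Hom(subvs_of V1, 'Hom(subvs_of V2, 'End(V))),
    forall x, F x = F1 v x.
  apply: lfun_of_linear => a x x'; apply/lfunP => y.
  by rewrite add_lfunE scale_lfunE !F1E linearP T_linear.
pose F2 v := sval (cid (H2 v)).
have F2E v x : F2 v x = F1 v x := svalP (cid (H2 v)) x.
have [D DE] : exists D : 'Hom(V, 'Hom(subvs_of V1, 'Hom(subvs_of V2, 'End(V)))),
    forall v, D v = F2 v.
  apply: lfun_of_linear => a v v'; apply/lfunP => x; apply/lfunP => y.
  have -> : (a *: F2 v + F2 v') x = a *: F1 v x + F1 v' x.
    by apply: etrans (add_lfunE _ _ _) _; rewrite (scale_lfunE a (F2 v)) !F2E.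
  by rewrite F2E add_lfunE scale_lfunE !F1E T_linear1.
have {DE F2E}DE v x y : D v x y = T v (vsval x) (vsval y) by rewrite DE F2E F1E.
have Dk : k1_g g V1 V2 D.
  split=> [v|x y z'|y z' t']; last 2 first.
  - rewrite !DE; have := T_Bianchi2 (vsval x) (vsval y) (vsval z').
    rewrite (T11 (vsval z')) ?subvsP// addr0 [T (vsval y) _ _]T_skew.
    exact: subr0_eq.
  - rewrite !DE; have := T_Bianchi2 (vsval t') (vsval y) (vsval z').
    rewrite (T22 (vsval y)) ?subvsP// addr0 [T (vsval z') _ _]T_skew.
    exact: subr0_eq.
  split=> [x y'|x y' z'|x t y'].
  - by rewrite DE.
  - rewrite !DE; have := T_Bianchi1 v (vsval x) (vsval y') (vsval z').
    rewrite (T22 v (vsval y')) ?subvsP// zero_lfunE addr0 [T v (vsval z') _]T_skew opp_lfunE.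
    exact: subr0_eq.
  - rewrite !DE; have := T_Bianchi1 v (vsval x) (vsval y') (vsval t).
    rewrite (T11 v (vsval t)) ?subvsP// zero_lfunE addr0 [T v (vsval y') _]T_skew opp_lfunE.
    exact: subr0_eq.
have D0 : D = 0 by have : [set 0] D by rewrite -k0.
have T12 v x y : x \in V1 -> y \in V2 -> T v x y = 0.
  move=> xV yV; have := DE v (vsproj V1 x) (vsproj V2 y).
  by rewrite D0 !zero_lfunE !vsprojK.
have T21 v x y : x \in V2 -> y \in V1 -> T v x y = 0.
  by move=> xV yV; rewrite T_skew T12// oppr0.
(* The coefficient 1 gives the sum the shape expected by the linearity hypotheses. *)
have dec x : exists x1 x2, [/\ x1 \in V1, x2 \in V2 & x = 1 *: x1 + x2].
  have : x \in (V1 + V2)%VS by rewrite V12_sum memvf.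
  by move=> /memv_addP[x1 x1V [x2 x2V ->]]; exists x1, x2; rewrite scale1r.
have [u1 [u2 [u1V u2V uE]]] := dec u0; have [v1 [v2 [v1V v2V vE]]] := dec v0.
move: T0; rewrite uE vE T_linear !T_linear3 (T11 _ _ _ u1V v1V) (T22 _ _ _ u2V v2V).
rewrite (T12 _ _ _ u1V v2V) (T21 _ _ _ u2V v1V).
by rewrite !(scaler0, addr0) eqxx.
Qed.

End FirstProlongation.

Section MatrixEndomorphism.
Context {R : realType} {V : vectType R} {n : nat}.
Local Notation E := 'rV[R]_n.
Variables (theta : {linear E -> V}) (thetaV : {linear V -> E}).
Hypotheses (thetaK : cancel theta thetaV) (thetaVK : cancel thetaV theta).

Definition mx_lfun (B : 'M[R]_n) : 'End(V) := linfun (theta \o mulmxr B \o thetaV).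

Lemma mx_lfunE B v : mx_lfun B v = theta (thetaV v *m B).
Proof. by rewrite lfunE. Qed.

Lemma mx_lfun_linear : linear mx_lfun.
Proof.
move=> a B B'; apply/lfunP => v.
by rewrite add_lfunE scale_lfunE !mx_lfunE mulmxDr -scalemxAr linearP.
Qed.

HB.instance Definition _ :=
  GRing.isLinear.Build R 'M[R]_n 'End(V) _ mx_lfun mx_lfun_linear.

(** Pulling g back to matrices exhibits the set of holonomy velocities as a vector subspace, which
    the limit and derivative arguments require. *)
Lemma mx_lfun_holonomy (M : manifold R n) (nabla : connection M) (g : {vspace 'End(V)}) q i :
  [set A | A \in g] = holonomy_algebra nabla q i theta ->
  forall B, B \in (linfun mx_lfun @^-1: g)%VS <->
    lie_algebra (restricted_holonomy_group nabla q i) B.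
Proof.
move=> gE B; rewrite -memv_preim lfunE /=.
have -> : (mx_lfun B \in g : Prop) = holonomy_algebra nabla q i theta (mx_lfun B).
  by rewrite -gE.
split=> [[B' hB' BB']|hB]; last by exists B => // u; rewrite mx_lfunE thetaK.
suff -> : B = B' by [].
apply/row_matrixP => k; rewrite !rowE; apply: (can_inj thetaK).
by rewrite -BB' mx_lfunE thetaK.
Qed.

End MatrixEndomorphism.

Theorem proposition4 (R : realType) (V : vectType R)
  (g : {vspace 'End(V)}) (g_lie : lie_subalgebra g)
  (V1 V2 : {vspace V})
  (V12_sum : (V1 + V2)%VS = fullv) (V12_direct : (V1 :&: V2)%VS = 0%VS)
  (V1_invariant : invariant_subspace g V1)
  (V2_invariant : invariant_subspace g V2)
  (V1_faithful : faithful_on g V1) (V2_faithful : faithful_on g V2)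
  (n : nat) (M : manifold R n) (nabla : connection M)
  (nabla_torsion_free : torsion_free nabla)
  (nabla_not_symmetric : ~ locally_symmetric nabla)
  (o : M) (i : mindex M) (o_dom : dom M i o)
  (theta : {linear 'rV[R]_n -> V}) (theta_bij : bijective theta)
  (g_holonomy : [set A | A \in g] = holonomy_algebra nabla o i theta) :
  k1_g g V1 V2 <> [set 0].
Proof.
move=> k0; apply: nabla_not_symmetric => j x jx z u v w.
rewrite -nabla_curvature_mxE//; apply/eqP; apply: contraT => N0; exfalso; move: k0.
have H := holonomy_everywhere_all o_dom theta_bij g_holonomy.
have inverse (t : {linear 'rV[R]_n -> V}) : bijective t ->
    exists tV : {linear V -> 'rV[R]_n}, cancel t tV /\ cancel tV t.
  move=> [f tf ft].
  pose tV : {linear V -> 'rV[R]_n} :=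
    HB.pack f (GRing.isLinear.Build _ _ _ _ _ (can2_linear tf ft)).
  by exists tV.
have HL y : img M j y -> exists L : {vspace 'M[R]_n},
    forall B, B \in L <-> lie_algebra (restricted_holonomy_group nabla (chartV M j y) j) B.
  move=> jy; have [t [/inverse[tV [tK tVK]] tE]] := H _ _ (img_dom jy).
  by exists (linfun (mx_lfun t tV) @^-1: g)%VS; exact: mx_lfun_holonomy.
have [t [/inverse[tV [tK _]] tE]] := H _ _ (img_dom jx).
have LP := mx_lfun_holonomy tK tE.
(* Both Bianchi identities are cyclic sums of three terms; they are carried from matrices to V by
   additive maps. *)
have add3 (U W : zmodType) (f : {additive U -> W}) (a b c : U) :
    a + b + c = 0 -> f a + f b + f c = 0.
  by rewrite -!raddfD => ->; rewrite raddf0.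
pose N a b c := nabla_curvature_mx nabla j (tV a) (tV b) (tV c) x.
apply: (@k1_g_neq0 R V g V1 V2 V12_sum V12_direct V1_invariant V2_invariant
  V1_faithful V2_faithful (fun a b c => mx_lfun t tV (N a b c)) _ _ _ _ _ (t z) (t u) (t v)).
- move=> a b c.
  have : N a b c \in (linfun (mx_lfun t tV) @^-1: g)%VS.
    by apply: nabla_curvature_holonomy => // B /LP.
  by rewrite -memv_preim lfunE.
- by move=> a c k b b'; rewrite /N !linearP /= nabla_curvature_mx_linear// linearP.
- by move=> a b c; rewrite /N nabla_curvature_mx_skew linearN.
- move=> a b c d; apply: etrans _ (add3 _ _ t _ _ _
    (nabla_first_Bianchi nabla_torsion_free (tV a) (tV b) (tV c) (tV d) jx)).
  by congr (_ + _ + _); exact: mx_lfunE.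
- move=> a b c.
  exact: (add3 _ _ (mx_lfun t tV)) (nabla_second_Bianchi nabla_torsion_free _ _ _ jx).
- apply: contra N0 => /eqP/lfunP/(_ (t w)).
  rewrite mx_lfunE zero_lfunE /N !tK => /(congr1 tV).
  by rewrite tK linear0 => ->.
Qed.
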